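(* Assume $L'=L$. Then for every $\tau>\frac{2(L-l)}{\sqrt{gh_0}}$ we have $$(W\cap S)\subset \operatorname{Ran}\Phi_\tau\subset (X\cap S),$$ where each inclusion is dense and with continuous embedding. Here $W$, $S$, $X$ and the input maps $\Phi_\tau$ of the linearized floating body system are as defined in the context.
   Context: Parameters: $g,\rho,h_0,l,L,L'>0$ with $l<\min\{L,L'\}$; $h_{\rm eq}$ is a positive even function on $[-l,l]$ (regular enough for the integrals below to be finite); $m=\rho\int_{-l}^l(h_0-h_{\rm eq}(x))\,dx>0$. Put $\underline\alpha=\frac1{2l}\int_{-l}^l\frac{dx}{h_{\rm eq}(x)}$ and $\underline M=m+\int_{-l}^l\frac{\rho x^2}{h_{\rm eq}(x)}dx$. Notation: $\mathcal E=(-L,-l)\cup(l,L')$; for $f$ on $\mathcal E$ with traces at $\pm l$, $[\![f]\!]=f(l)-f(-l)$ and $\langle f\rangle=\frac12(f(l)+f(-l))$. As a component of a state vector, $\langle q_{\rm i}\rangle$ is just the name of a scalar. $L'=L$ means that the object floats in the middle of the tank. State space: $X=\{(\zeta,q,\langle q_{\rm i}\rangle,\delta,\eta)^\intercal\in (L^2(\mathcal E))^2\times\mathbb C^3\mid \int_{\mathcal E}\zeta\,dx+2l\delta=0\}$ with inner product $$\langle z,\tilde z\rangle_X=\tfrac{\rho g}{2}\langle\zeta,\tilde\zeta\rangle_{L^2(\mathcal E)}+\tfrac{\rho}{2h_0}\langle q,\tilde q\rangle_{L^2(\mathcal E)}+\rho l\underline\alpha\,\langle q_{\rm i}\rangle\overline{\langle\tilde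 q_{\rm i}\rangle}+\rho g l\,\delta\overline{\tilde\delta}+\tfrac{\underline M}{2}\eta\overline{\tilde\eta}.$$ Regular states: $$W=\Big\{(\zeta,q,\langle q_{\rm i}\rangle,\delta,\eta)^\intercal\in (H^1(\mathcal E))^2\times\mathbb C^3\ \Big|\ \int_{\mathcal E}\zeta\,dx+2l\delta=0,\ [\![q]\!]=-2l\eta,\ \langle q\rangle=\langle q_{\rm i}\rangle,\ q(-L)=0=q(L')\Big\},$$ with the norm of $(H^1(\mathcal E))^2\times\mathbb C^3$. Symmetric states: $$S=\{(\zeta,q,\langle q_{\rm i}\rangle,\delta,\eta)^\intercal\in (L^2(\mathcal E))^2\times\mathbb C^3\mid \zeta(-x)=\zeta(x),\ q(-x)=-q(x)\ (x\in\mathcal E),\ \langle q_{\rm i}\rangle=0\}.$$ Control system: $\dot z=Az+Bu$ on $X$ with scalar input $u(t)\in U=\mathbb C$, where $\mathcal D(A)=W$, $$A(\zeta,q,\langle q_{\rm i}\rangle,\delta,\eta)^\intercal=\Big(-\tfrac{dq}{dx},\,-gh_0\tfrac{d\zeta}{dx},\,-\tfrac{g}{2l\underline\alpha}[\![\zeta]\!],\,\eta,\,\tfrac{2\rho gl}{\underline M}(\langle\zeta\rangle-\delta)\Big)^\intercal,\qquad B=(0,0,0,0,\tfrac1{\underline M})^\intercal .$$ $A$ generates a unitary group $(\mathbb T_t)_{t\in\mathbb R}$ on $X$. The input map $\Phi_\tau$ gives the state at time $\tau$ starting from $z(0)=0$: $\Phi_\tau u=z(\tau)=\int_0^\tau\mathbb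 T_{\tau-s}Bu(s)\,ds$ for $u\in L^2([0,\infty);U)$. $\operatorname{Ran}\Phi_\tau$ is the reachable space in time $\tau$, equipped with the norm $\|z\|=\inf\{\|u\|_{L^2([0,\tau];U)}: \Phi_\tau u=z\}$; ''dense inclusion'' means that the smaller space is dense in the larger one, and ''continuous embedding'' means that the inclusion map is bounded. *)

(* Defs.v *)
From HB Require Import structures.
From mathcomp Require Import all_boot all_order all_algebra.
From mathcomp Require Import all_classical all_reals all_analysis.
From mathcomp.real_closed Require Import complex.

Set Implicit Arguments.
Unset Strict Implicit.
Unset Printing Implicit Defensive.

Import Order.TTheory GRing.Theory Num.Theory.
Import numFieldNormedType.Exports.

Local Open Scope classical_set_scope.
Local Open Scope complex_scope.
Local Open Scope ring_scope.

Local Notation Re := complex.Re.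
Local Notation Im := complex.Im.
Local Notation leb := (@lebesgue_measure _).

Definition L2 (R : realType) (D : set R) (f : R -> R) : Prop :=
  measurable_fun D f /\ leb.-integrable D (fun x => (f x ^+ 2)%:E).

(* [C^1] functions on the line with compact support contained in [D]; for
   locally integrable functions they give the same weak derivatives as
   smooth test functions. *)
Definition test_function (R : realType) (D : set R) (phi : R -> R) : Prop :=
  [/\ forall x, derivable phi x 1,
      continuous (derive1 phi) &
      exists K : set R, [/\ compact K, K `<=` D &
                            forall x, ~ K x -> phi x = 0]].

Definition is_weak_deriv (R : realType) (D : set R) (f df : R -> R) : Prop :=
  forall phi, test_function D phi ->
    \int[leb]_(x in D) (f x * derive1 phi x) =
    - \int[leb]_(x in D) (df x * phi x).

Definition H1 (R : realType) (D : set R) (f : R -> R) : Prop :=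
  L2 D f /\ exists df, L2 D df /\ is_weak_deriv D f df.

(* Meaningful only for [f] in [H1 D], and then unique up to equality almost
   everywhere on [D]. *)
Definition weak_deriv (R : realType) (D : set R) (f : R -> R) : R -> R :=
  xget (cst 0) [set df | L2 D df /\ is_weak_deriv D f df].

(* [c] is the limit at [a], from inside [D], of the continuous representative
   of [f] on the open set [D]. *)
Definition is_trace (R : realType) (D : set R) (f : R -> R) (a c : R) : Prop :=
  exists fc : R -> R, [/\ {within D, continuous fc},
    f = fc %[ae leb in D] & fc @ within D (nbhs a) --> c].

Definition trace (R : realType) (D : set R) (f : R -> R) (a : R) : R :=
  xget 0 [set c | is_trace D f a c].

Definition cL2 (R : realType) (D : set R) (f : R -> R[i]) : Prop :=
  L2 D (fun x => Re (f x)) /\ L2 D (fun x => Im (f x)).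

Definition cH1 (R : realType) (D : set R) (f : R -> R[i]) : Prop :=
  H1 D (fun x => Re (f x)) /\ H1 D (fun x => Im (f x)).

Definition cintegrable (R : realType) (D : set R) (f : R -> R[i]) : Prop :=
  leb.-integrable D (fun x => (Re (f x))%:E) /\
  leb.-integrable D (fun x => (Im (f x))%:E).

Definition cintegral (R : realType) (D : set R) (f : R -> R[i]) : R[i] :=
  (\int[leb]_(x in D) Re (f x)) +i* (\int[leb]_(x in D) Im (f x)).

Definition cweak_deriv (R : realType) (D : set R) (f : R -> R[i])
    : R -> R[i] :=
  fun x => weak_deriv D (fun y => Re (f y)) x
           +i* weak_deriv D (fun y => Im (f y)) x.

Definition ctrace (R : realType) (D : set R) (f : R -> R[i]) (a : R) : R[i] :=
  trace D (fun y => Re (f y)) a +i* trace D (fun y => Im (f y)) a.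

Definition L2inner (R : realType) (D : set R) (f h : R -> R[i]) : R[i] :=
  cintegral D (fun x => f x * (h x)^*).

Definition sqrabs (R : realType) (z : R[i]) : R := Re (z * z^*).

Definition sqrL2norm (R : realType) (D : set R) (f : R -> R[i]) : R :=
  Re (L2inner D f f).

Definition L2norm (R : realType) (D : set R) (f : R -> R[i]) : R :=
  Num.sqrt (sqrL2norm D f).

Definition sqrH1norm (R : realType) (D : set R) (f : R -> R[i]) : R :=
  sqrL2norm D f + sqrL2norm D (cweak_deriv D f).

Record params (R : realType) := Params {
  grav : R;
  rho : R;
  h0 : R;
  halfl : R;
  Lleft : R;
  Lright : R;
  heq : R -> R }.

Section Params.
Context {R : realType} (p : params R).

Local Notation l := (halfl p).

Definition mass : R :=
  rho p * \int[leb]_(x in `[- l, l]) (h0 p - heq p x).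

Definition alpha_ : R :=
  (2 * l)^-1 * \int[leb]_(x in `[- l, l]) (heq p x)^-1.

Definition M_ : R :=
  mass + \int[leb]_(x in `[- l, l]) (rho p * x ^+ 2 / heq p x).

Definition admissible : Prop :=
  [/\ [/\ 0 < grav p, 0 < rho p & 0 < h0 p],
      [/\ 0 < l, 0 < Lleft p, 0 < Lright p & l < Num.min (Lleft p) (Lright p)],
      {in `[- l, l], forall x, 0 < heq p x /\ heq p (- x) = heq p x},
      [/\ leb.-integrable `[- l, l] (fun x => (h0 p - heq p x)%:E),
          leb.-integrable `[- l, l] (fun x => ((heq p x)^-1)%:E) &
          leb.-integrable `[- l, l] (fun x => (rho p * x ^+ 2 / heq p x)%:E)] &
      0 < mass].

Definition Edom : set R := `]- Lleft p, - l[ `|` `]l, Lright p[.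

Definition jump (f : R -> R[i]) : R[i] :=
  ctrace Edom f l - ctrace Edom f (- l).

Definition average (f : R -> R[i]) : R[i] :=
  (2^-1)%:C * (ctrace Edom f l + ctrace Edom f (- l)).

End Params.

(* The two functions are representatives on the whole line; only their
   classes modulo equality almost everywhere on [Edom p] matter (see
   [eq_state]). The regular algebra [R[i]^o] makes [state R] a module
   over [R[i]]. *)

Definition state (R : realType) : Type :=
  ((R -> R[i]^o) * (R -> R[i]^o) * R[i]^o * R[i]^o * R[i]^o)%type.

Definition mkstate (R : realType) (zeta q : R -> R[i]) (qi delta eta : R[i])
  : state R := (zeta, q, qi, delta, eta).

Definition zeta (R : realType) (z : state R) : R -> R[i] := z.1.1.1.1.
Definition q_ (R : realType) (z : state R) : R -> R[i] := z.1.1.1.2.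
Definition qi (R : realType) (z : state R) : R[i] := z.1.1.2.
Definition delta (R : realType) (z : state R) : R[i] := z.1.2.
Definition eta (R : realType) (z : state R) : R[i] := z.2.

Section System.
Context {R : realType} (p : params R).

Local Notation g := (grav p).
Local Notation l := (halfl p).
Local Notation E := (Edom p).

Definition eq_state (z w : state R) : Prop :=
  [/\ zeta z = zeta w %[ae leb in E], q_ z = q_ w %[ae leb in E],
      qi z = qi w, delta z = delta w & eta z = eta w].

Definition spaceX : set (state R) :=
  [set z | [/\ cL2 E (zeta z), cL2 E (q_ z) &
               cintegral E (zeta z) + (2 * l)%:C * delta z = 0]].

Definition innerX (z w : state R) : R[i] :=
  (rho p * g / 2)%:C * L2inner E (zeta z) (zeta w)
  + (rho p / (2 * h0 p))%:C * L2inner E (q_ z) (q_ w)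
  + (rho p * l * alpha_ p)%:C * (qi z * (qi w)^*)
  + (rho p * g * l)%:C * (delta z * (delta w)^*)
  + (M_ p / 2)%:C * (eta z * (eta w)^*).

Definition normX (z : state R) : R := Num.sqrt (Re (innerX z z)).

Definition spaceW : set (state R) :=
  [set z | [/\ cH1 E (zeta z) /\ cH1 E (q_ z),
               cintegral E (zeta z) + (2 * l)%:C * delta z = 0,
               jump p (q_ z) = - (2 * l)%:C * eta z,
               average p (q_ z) = qi z &
               ctrace E (q_ z) (- Lleft p) = 0 /\
               0 = ctrace E (q_ z) (Lright p)]].

Definition normW (z : state R) : R :=
  Num.sqrt (sqrH1norm E (zeta z) + sqrH1norm E (q_ z)
            + sqrabs (qi z) + sqrabs (delta z) + sqrabs (eta z)).

Definition spaceS : set (state R) :=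
  [set z | [/\ cL2 E (zeta z) /\ cL2 E (q_ z),
               (fun x => zeta z (- x)) = zeta z %[ae leb in E],
               (fun x => q_ z (- x)) = (fun x => - q_ z x) %[ae leb in E] &
               qi z = 0]].

(* Meaningful on the domain [spaceW] only. *)
Definition opA (z : state R) : state R :=
  mkstate (fun x => - cweak_deriv E (q_ z) x)
          (fun x => - (g * h0 p)%:C * cweak_deriv E (zeta z) x)
          (- (g / (2 * l * alpha_ p))%:C * jump p (zeta z))
          (eta z)
          ((2 * rho p * g * l / M_ p)%:C * (average p (zeta z) - delta z)).

Definition opB : state R :=
  mkstate (fun=> 0) (fun=> 0) 0 0 ((M_ p)^-1)%:C.

(* Strongly continuous group of unitary operators on [spaceX]; a state stands for
   its class modulo [eq_state]. *)
Definition unitary_group (T : R -> state R -> state R) : Prop :=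
  [/\ forall t z, spaceX z -> spaceX (T t z),
      forall t (a : R[i]) z w, spaceX z -> spaceX w ->
        eq_state (T t (a *: z + w)) (a *: T t z + T t w),
      forall t z w, spaceX z -> spaceX w -> innerX (T t z) (T t w) = innerX z w,
      forall z, spaceX z -> eq_state (T 0 z) z /\
        forall s t, eq_state (T (s + t) z) (T s (T t z)) &
      forall z, spaceX z -> normX (T t z - z) @[t --> (0 : R)] --> (0 : R)].

Definition generated_by_A (T : R -> state R -> state R) : Prop :=
  forall z y, spaceX z -> spaceX y ->
    (normX ((t^-1)%:C *: (T t z - z) - y) @[t --> (0 : R)^'] --> (0 : R)
     <-> spaceW z /\ eq_state y (opA z)).

(* [z] is the integral over [D] of the function [F] with values in the Hilbert
   space [spaceX], in the weak sense (for a Bochner integrable [F] this is the Bochner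
   integral). *)
Definition is_integralX (D : set R) (F : R -> state R) (z : state R) : Prop :=
  spaceX z /\ forall w, spaceX w ->
    cintegrable D (fun s => innerX (F s) w) /\
    innerX z w = cintegral D (fun s => innerX (F s) w).

(* The graph of [Phi_tau], a function up to [eq_state]. *)
Definition input_map (T : R -> state R -> state R) (tau : R) (u : R -> R[i])
    (z : state R) : Prop :=
  is_integralX `[0, tau] (fun s => T (tau - s) ((u s : R[i]) *: opB)) z.

Definition Ran (T : R -> state R -> state R) (tau : R) : set (state R) :=
  [set z | exists u, cL2 `[0, +oo[ u /\ input_map T tau u z].

Definition normRan (T : R -> state R -> state R) (tau : R) (z : state R) : R :=
  inf [set L2norm `[0, tau] u | u in
        [set u | cL2 `[0, +oo[ u /\ input_map T tau u z]].

End System.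

Definition dense_continuous_inclusion (R : realType)
    (V1 : set (state R)) (N1 : state R -> R)
    (V2 : set (state R)) (N2 : state R -> R) : Prop :=
  [/\ V1 `<=` V2,
      forall z, V2 z -> forall e : R, 0 < e -> exists2 w, V1 w & N2 (z - w) < e &
      exists C : R, forall z, V1 z -> N2 z <= C * N1 z].

(* Main.v *)
From Pilot Require Import Defs.
From HB Require Import structures.
From mathcomp Require Import all_boot all_order all_algebra.
From mathcomp Require Import all_classical all_reals all_analysis measurable_realfun.
From mathcomp.real_closed Require Import complex.
From mathcomp Require Import ring lra.

(** The object floats in the middle of the tank, so a symmetric motion is
    determined by the waves that leave it on one side. Let [c] be the celerity
    and [T0 = 2 (L - l) / c] the time of a round trip to the wall. A signal
    [v], square integrable and supported in [[0, tau]], with primitive [P],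
    generates by d'Alembert's formula an outgoing wave and its reflection: on
    [(l, L)] and at time [s],
      zeta = (P (s - (x - l) / c) + P (s - (2 L - l - x) / c)) / (2 c),
      q    = (P (s - (x - l) / c) - P (s - (2 L - l - x) / c)) / 2,
    extended by parity to the left of the object. The condition at the object
    gives the velocity [eta = (P (s - T0) - P s) / (2 l)], the volume gives
    [delta], and the equation of motion of the object can be solved for the
    input, called [force v] below. Hence steering the system amounts to
    choosing a signal.

    That such a wave is the trajectory driven by [force v] is proved for
    continuous signals with compact support in [(0, tau)]: there the curve is
    differentiable in the state space, and Duhamel's formula follows by
    differentiating its pairing with the unitary group ([duhamel]). Both the
    force and the final state are continuous in the signal for the L2 norm, so
    the conclusion extends to all signals ([input_sig]). Complex states are
    treated through two real signals.

    Symmetric states of [spaceW] are reachable. The values of [zeta']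
    and [q'] on [(l, L)], carried by the two families of
    characteristics, form a signal on [[tau - T0, tau]] whose wave has the
    same derivatives. The condition at the wall makes [q] agree; for [zeta] a
    constant is left, which is corrected by a constant signal on
    [[0, tau - T0]]. This interval has positive length because [tau > T0]
    ([preimage_signal]). The scalar components then agree, by the traces at the
    object and by the volume constraint ([W_preimage]), and the signal, hence
    the input, is bounded by the norm of [spaceW].

    Reachable states are symmetric, and those of [spaceW] are dense. The inputs
    [force v] are dense in L2 ([force_dense]). Indeed the equation [eta = g] is
    solved by a finite sum of delayed copies of [g], and what remains of the
    force is a Volterra operator, contracting for a norm with exponential
    weight; a Neumann series solves [force v = u] up to a small error. So every
    reachable state is a limit, for the norm of inputs and therefore for that
    of the state space, of waves, which lie in [spaceW] and are symmetric;
    symmetric states form a closed set ([S_closed]).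

    Reachable states are dense. For a symmetric state of finite energy the
    characteristics now carry [zeta] and [q] themselves, and determine [P] on
    [[tau - T0, tau]]. A function of class C^1 approximates it in L2, and a
    steep ramp just before [tau], of small L2 norm, adjusts [P tau] so that the
    velocity of the object is exact ([dense_signal]).

    The embeddings are bounded: by Cauchy-Schwarz and unitarity the state is
    controlled by the input ([input_norm]). *)

Set Implicit Arguments.
Unset Strict Implicit.
Unset Printing Implicit Defensive.

Import Order.TTheory GRing.Theory Num.Theory.
Import numFieldNormedType.Exports.

Local Open Scope classical_set_scope.
Local Open Scope complex_scope.
Local Open Scope ring_scope.

Local Notation leb := (@lebesgue_measure _).
Local Notation intg D f := (leb.-integrable D (EFin \o f)).
Local Notation mble D := (@measurable _ (measurableTypeR _) D).
Local Notation mblefun D f := (@measurable_fun _ _ (measurableTypeR _) _ D f).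
Local Notation Re := complex.Re.
Local Notation Im := complex.Im.
Local Notation eta := Pilot.Defs.eta.

(** * Square integrable functions on subsets of the line *)

Definition n2 (R : realType) (D : set R) (f : R -> R) : R :=
  \int[leb]_(x in D) (f x ^+ 2).

Section L2.
Context {R : realType}.
Implicit Types (D : set R) (f g : R -> R).

Lemma integrable_cst D k : mble D -> (leb D < +oo)%E -> intg D (fun=> k).
Proof.
move=> mD fD; apply: measurable_bounded_integrable => //.
exists `|k|; split; rewrite ?num_real// => x kx y _ /=; exact: ltW.
Qed.

Lemma integrable_dom D f g : mble D -> mblefun D f ->
  intg D g -> (forall x, D x -> `|f x| <= g x) -> intg D f.
Proof.
move=> mD mf ig fg; apply: (le_integrable _ _ _ ig) => //.
  exact/measurable_EFinP.
by move=> x Dx /=; rewrite lee_fin (le_trans (fg _ Dx))// ler_norm.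
Qed.

Lemma L2_int_mul D f g : mble D -> L2 D f -> L2 D g ->
  intg D (fun x => f x * g x).
Proof.
move=> mD [mf f2] [mg g2].
apply: (@integrable_dom _ _ (fun x => f x ^+ 2 + g x ^+ 2)) => //.
- exact: measurable_funM.
- by have := integrableD mD f2 g2; apply: eq_integrable.
- move=> x _; rewrite ler_norml; have := sqr_ge0 (f x - g x).
  have := sqr_ge0 (f x + g x); have := sqr_ge0 (f x); have := sqr_ge0 (g x).
  by move=> ? ? ? ?; apply/andP; split; nra.
Qed.

Lemma integrableN' D f : mble D -> intg D f -> intg D (fun x => - f x).
Proof. by move=> mD /integrableN; apply: eq_integrable. Qed.

Lemma integrableD' D f g : mble D -> intg D f -> intg D g ->
  intg D (fun x => f x + g x).
Proof. by move=> mD fi gi; have := integrableD mD fi gi; apply: eq_integrable. Qed.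

Lemma integrableB' D f g : mble D -> intg D f -> intg D g ->
  intg D (fun x => f x - g x).
Proof. by move=> mD fi gi; have := integrableB mD fi gi; apply: eq_integrable. Qed.

Lemma integrableZ' D k f : mble D -> intg D f ->
  intg D (fun x => k * f x).
Proof. by move=> mD fi; have := integrableZl mD k fi; apply: eq_integrable. Qed.

Lemma L2Z D k f : mble D -> L2 D f -> L2 D (fun x => k * f x).
Proof.
move=> mD [mf f2]; split; first exact: measurable_funM.
have := integrableZ' (k ^+ 2) mD f2; apply: eq_integrable => // x _ /=.
by rewrite exprMn.
Qed.

Lemma L2D D f g : mble D -> L2 D f -> L2 D g -> L2 D (fun x => f x + g x).
Proof.
move=> mD hf hg; split; first exact: measurable_funD hf.1 hg.1.
have := integrableD' mD (integrableD' mD hf.2 hg.2)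
  (integrableZ' 2 mD (L2_int_mul mD hf hg)).
by apply: eq_integrable => // x _ /=; congr EFin; ring.
Qed.

Lemma L2N D f : mble D -> L2 D f -> L2 D (fun x => - f x).
Proof.
move=> mD /(L2Z (-1) mD); congr L2; apply/funext => x; ring.
Qed.

Lemma L2B D f g : mble D -> L2 D f -> L2 D g -> L2 D (fun x => f x - g x).
Proof. by move=> mD hf hg; apply: L2D => //; exact: L2N. Qed.

Lemma L2_0 D : mble D -> L2 D (fun=> 0).
Proof.
move=> mD; split; first exact: measurable_cst.
have := integrable0 leb D; apply: eq_integrable => // x _ /=.
by rewrite expr0n.
Qed.

Lemma L2_bounded D f M : mble D -> (leb D < +oo)%E -> mblefun D f ->
  (forall x, D x -> `|f x| <= M) -> L2 D f.
Proof.
move=> mD fD mf fM; split => //.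
apply: (@integrable_dom _ _ (cst (M ^+ 2))) => //.
- exact: measurable_funX.
- exact: integrable_cst.
- move=> x Dx /=; rewrite normrX; apply: lerXn2r; rewrite ?nnegrE//.
    by rewrite (le_trans _ (fM _ Dx)).
  exact: fM.
Qed.

Lemma L2_integrable D f : mble D -> (leb D < +oo)%E -> L2 D f -> intg D f.
Proof.
move=> mD fD hf.
have h1 : L2 D (fun=> 1).
  by apply: (@L2_bounded _ _ 1) => //; move=> x _; rewrite normr1.
by have := L2_int_mul mD hf h1; apply: eq_integrable => // x _ /=; rewrite mulr1.
Qed.

Lemma L2S D D' f : mble D -> mble D' -> D' `<=` D -> L2 D f -> L2 D' f.
Proof.
move=> mD mD' DD [mf f2]; split; first exact: measurable_funS mf.
exact: integrableS f2.
Qed.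

Lemma n2_ge0 D f : 0 <= n2 D f.
Proof. by apply: Rintegral_ge0 => x _; exact: sqr_ge0. Qed.

Lemma n2Z D k f : mble D -> L2 D f ->
  n2 D (fun x => k * f x) = k ^+ 2 * n2 D f.
Proof.
move=> mD hf; rewrite /n2 -RintegralZl//; last exact: hf.2.
by apply: eq_Rintegral => x _; rewrite exprMn.
Qed.

Lemma n2N D f : n2 D (fun x => - f x) = n2 D f.
Proof. by apply: eq_Rintegral => x _; rewrite sqrrN. Qed.

Lemma n2DE D f g : mble D -> L2 D f -> L2 D g ->
  n2 D (fun x => f x + g x) =
  n2 D f + n2 D g + 2 * \int[leb]_(x in D) (f x * g x).
Proof.
move=> mD hf hg; rewrite /n2.
have fgi := L2_int_mul mD hf hg.
rewrite -RintegralZl// -RintegralD//; [|exact: hf.2|exact: hg.2].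
rewrite -RintegralD//; [|exact: integrableD' hf.2 hg.2|exact: integrableZ'].
by apply: eq_Rintegral => x _; ring.
Qed.

Lemma le_Rint D f g : mble D -> intg D f -> intg D g ->
  (forall x, D x -> f x <= g x) ->
  \int[leb]_(x in D) f x <= \int[leb]_(x in D) g x.
Proof. exact: le_Rintegral. Qed.

Lemma n2D_le D f g : mble D -> L2 D f -> L2 D g ->
  n2 D (fun x => f x + g x) <= 2 * n2 D f + 2 * n2 D g.
Proof.
move=> mD hf hg.
rewrite -!RintegralZl//; [|exact: hg.2|exact: hf.2].
have i1 := integrableZ' 2 mD hf.2; have i2 := integrableZ' 2 mD hg.2.
rewrite -RintegralD//; apply: le_Rint => //; first exact: (L2D mD hf hg).2.
  exact: integrableD'.
by move=> x _; have := sqr_ge0 (f x - g x); nra.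
Qed.

Lemma n2B_le D f g : mble D -> L2 D f -> L2 D g ->
  n2 D (fun x => f x - g x) <= 2 * n2 D f + 2 * n2 D g.
Proof.
move=> mD hf hg; rewrite -(n2N _ g); apply: n2D_le => //; exact: L2N.
Qed.

Lemma cauchy_schwarz D f g : mble D -> L2 D f -> L2 D g ->
  (\int[leb]_(x in D) (f x * g x)) ^+ 2 <= n2 D f * n2 D g.
Proof.
move=> mD hf hg; set I := \int[_]_(_ in _) _.
have key k : 0 <= n2 D f + k ^+ 2 * n2 D g + 2 * k * I.
  have := n2_ge0 D (fun x => f x + k * g x).
  rewrite n2DE//; last exact: L2Z.
  rewrite n2Z//.
  under eq_Rintegral do rewrite mulrCA.
  by rewrite RintegralZl ?mulrA//; exact: L2_int_mul.
have [g0|g0] := eqVneq (n2 D g) 0.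
  move: key; rewrite g0 mulr0 => key.
  have [->|I0] := eqVneq I 0; first by rewrite expr0n.
  have := key (- (n2 D f + 1) / (2 * I)).
  rewrite mulr0 addr0.
  have -> : 2 * (- (n2 D f + 1) / (2 * I)) * I = - (n2 D f + 1).
    by field.
  by lra.
have gp : 0 < n2 D g by rewrite lt_neqAle eq_sym g0 n2_ge0.
have := key (- I / n2 D g).
have -> : n2 D f + (- I / n2 D g) ^+ 2 * n2 D g + 2 * (- I / n2 D g) * I
  = (n2 D f * n2 D g - I ^+ 2) / n2 D g by field.
by rewrite pmulr_lge0 ?invr_gt0// subr_ge0.
Qed.

Lemma n2S D D' f : mble D -> mble D' -> D' `<=` D -> L2 D f ->
  n2 D' f <= n2 D f.
Proof.
move=> mD mD' DD hf; have hf' := L2S mD mD' DD hf.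
rewrite /n2 /Rintegral fine_le//; [apply: integrable_fin_num => //; exact: hf'.2|
  apply: integrable_fin_num => //; exact: hf.2|].
apply: ge0_subset_integral => //.
  by apply/measurable_EFinP; apply: measurable_funX; exact: hf.1.
by move=> x _; rewrite lee_fin sqr_ge0.
Qed.

Lemma n2_bounded D f M : mble D -> (leb D < +oo)%E -> mblefun D f ->
  (forall x, D x -> `|f x| <= M) -> n2 D f <= M ^+ 2 * fine (leb D).
Proof.
move=> mD fD mf fM; rewrite -Rintegral_cst//.
apply: le_Rint => //; first exact: (L2_bounded mD fD mf fM).2.
  exact: integrable_cst.
move=> x Dx; rewrite -(real_normK (num_real _)).
by apply: lerXn2r; rewrite ?nnegrE ?fM// (le_trans _ (fM _ Dx)).
Qed.

Lemma n2_eq0 D f : mble D -> L2 D f -> n2 D f = 0 ->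
  f = (fun=> 0) %[ae leb in D].
Proof.
move=> mD hf f0.
have : (\int[leb]_(x in D) `|(f x ^+ 2)%:E| = 0)%E.
  under eq_integral => x _ do rewrite gee0_abs ?lee_fin ?sqr_ge0//.
  apply/eqP; rewrite -[X in X == _]fineK ?eqe; first exact/eqP.
  by apply: integrable_fin_num => //; exact: hf.2.
move=> /ae_eq_integral_abs.
move=> /(_ mD (measurable_int _ hf.2)).
apply: filterS => x /= fx0 Dx.
have /eqP := fx0 Dx; rewrite /cst eqe sqrf_eq0 => /eqP //.
Qed.

(** Some arguments below reflect an exceptional set or need its measure, and
    so need it as a set. *)
Lemma ae_eq_lebP (U : Type) D (f g : R -> U) :
  f = g %[ae leb in D] <->
  exists2 N : set R, mble N /\ leb N = 0%E & forall x, D x -> ~ N x -> f x = g x.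
Proof.
split=> [[N [mN N0 sub]]|[N [mN N0] fg]].
  exists N; first by split.
  by move=> x Dx Nx; apply: contrapT => fgx; apply: Nx; apply: sub => /(_ Dx).
exists N; split=> // x /=; apply: contra_notP => Nx Dx; exact: fg.
Qed.

Lemma ae_eq_imp2 (U V W : Type) D (f g : R -> U) (h k : R -> V) (f' g' : R -> W) :
  (forall x, D x -> f x = g x -> h x = k x -> f' x = g' x) ->
  f = g %[ae leb in D] -> h = k %[ae leb in D] -> f' = g' %[ae leb in D].
Proof.
move=> H /ae_eq_lebP[M [mM M0] fg] /ae_eq_lebP[N [mN N0] hk].
apply/ae_eq_lebP; exists (M `|` N).
  by split; [exact: measurableU|exact: null_set_setU].
move=> x Dx MN; apply: H => //; [apply: fg|apply: hk] => // ?; apply: MN;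
  by [left|right].
Qed.

Lemma ae_eq_imp (U V : Type) D (f g : R -> U) (f' g' : R -> V) :
  (forall x, D x -> f x = g x -> f' x = g' x) ->
  f = g %[ae leb in D] -> f' = g' %[ae leb in D].
Proof. by move=> H fg; apply: (ae_eq_imp2 _ fg fg) => x Dx e _; exact: H. Qed.

Lemma ae_of_eq (U : Type) D (f g : R -> U) :
  (forall x, D x -> f x = g x) -> f = g %[ae leb in D].
Proof.
move=> fg; apply/ae_eq_lebP; exists set0 => [|x Dx _]; last exact: fg.
by split => //; exact: measure0.
Qed.

Lemma n2_ae D f g : mble D -> mblefun D f -> mblefun D g ->
  f = g %[ae leb in D] -> n2 D f = n2 D g.
Proof.
move=> mD mf mg fg; congr fine; apply: ae_eq_integral => //.
- by apply/measurable_EFinP/measurable_funX.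
- by apply/measurable_EFinP/measurable_funX.
- by apply: (ae_eq_imp _ fg) => x _ /= ->.
Qed.

Lemma Rint_ae D f g : mble D -> mblefun D f -> mblefun D g ->
  f = g %[ae leb in D] -> \int[leb]_(x in D) f x = \int[leb]_(x in D) g x.
Proof.
move=> mD mf mg fg; congr fine; apply: ae_eq_integral => //.
- exact/measurable_EFinP.
- exact/measurable_EFinP.
- by apply: (ae_eq_imp _ fg) => x _ /= ->.
Qed.

Lemma int_sqr_le D f : mble D -> (leb D < +oo)%E -> L2 D f ->
  (\int[leb]_(x in D) f x) ^+ 2 <= fine (leb D) * n2 D f.
Proof.
move=> mD fD hf.
have h1 : L2 D (fun=> 1).
  by apply: (@L2_bounded _ _ 1) => //; move=> x _; rewrite normr1.
have := cauchy_schwarz mD hf h1.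
have -> : n2 D (fun=> 1) = fine (leb D).
  by rewrite /n2 expr1n Rintegral_cst// mul1r.
under eq_Rintegral do rewrite mulr1.
by rewrite mulrC.
Qed.

Lemma L2_patch D f : mble D -> L2 D f -> L2 setT (f \_ D).
Proof.
move=> mD [mf f2]; split.
  by apply/(measurable_restrictT _ _).1.
have := (integrable_mkcond _ mD).1 f2.
apply: eq_integrable => // x _ /=; rewrite /patch /=.
by case: ifP => //; rewrite expr0n.
Qed.

Lemma n2_patch D f : n2 setT (f \_ D) = n2 D f.
Proof.
rewrite /n2 [RHS]Rintegral_mkcond; apply: eq_Rintegral => x _.
by rewrite /patch; case: ifP => //; rewrite expr0n.
Qed.

End L2.

Section Affine.
Context {R : realType}.
Variables (a b : R).
Hypothesis a0 : a != 0.

Let phi (x : measurableTypeR R) : measurableTypeR R := a * x + b.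

Lemma mphi : measurable_fun setT phi.
Proof.
apply: (@measurable_funD _ (measurableTypeR R) R setT (fun x => a * x) (cst b)).
  by apply: (@measurable_funM _ (measurableTypeR R) R setT (cst a) id).
exact: measurable_cst.
Qed.

Let pf : {measure set (measurableTypeR R) -> \bar R} :=
  measure_function_pushforward__canonical__measure_function_Measure leb mphi.

Let k : {nonneg R} := NngNum (normr_ge0 a).

(** Both sides are measures in [A], and they agree on half-open intervals. *)
Lemma leb_affine A : mble A -> (`|a|%:E * leb (phi @^-1` A) = leb A)%E.
Proof.
move=> mA.
suff : leb A = mscale k pf A by move=> ->.
apply: lebesgue_measure_unique => //=.
move=> _ [[x y]] _ <-; rewrite /mscale /= /pf /= /pushforward /=.
have [a_gt0|a_lt0] : 0 < a \/ a < 0.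
  by move: a0; rewrite neq_lt => /orP[]; [right|left].
- have -> : phi @^-1` `]x, y]%classic = `](x - b) / a, (y - b) / a]%classic.
    apply/seteqP; split => t /=; rewrite !in_itv/= /phi;
    by rewrite ltr_pdivrMr// ler_pdivlMr// ltrBlDr lerBrDr (mulrC t).
  rewrite !lebesgue_measure_itv/= !lte_fin ltr_pM2r ?invr_gt0// ltrD2r.
  case: ifPn => xy; last by rewrite mule0.
  by rewrite -!EFinB -EFinM gtr0_norm//; congr EFin; field.
- have -> : phi @^-1` `]x, y]%classic = `[(y - b) / a, (x - b) / a[%classic.
    apply/seteqP; split => t /=; rewrite !in_itv/= /phi;
    by rewrite ltr_ndivlMr// ler_ndivrMr// ltrBlDr lerBrDr (mulrC t) andbC.
  rewrite !lebesgue_measure_itv/= !lte_fin ltr_nM2r ?invr_lt0// ltrD2r.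
  case: ifPn => xy; last by rewrite mule0.
  by rewrite -!EFinB -EFinM ltr0_norm//; congr EFin; field.
Qed.

Lemma null_affine N : mble N -> leb N = 0%E ->
  mble (fun x => N (a * x + b)) /\ leb (fun x => N (a * x + b)) = 0%E.
Proof.
move=> mN N0; split.
  by rewrite -[X in mble X]setTI; exact: mphi.
apply/eqP; have := leb_affine mN; rewrite N0 => /eqP.
by rewrite mule_eq0 eqe normr_eq0 (negbTE a0).
Qed.

Lemma L2_affine f : L2 setT f -> L2 setT (fun x => f (a * x + b)) /\
  n2 setT (fun x => f (a * x + b)) = `|a|^-1 * n2 setT f.
Proof.
move=> [mf f2].
have mf' : mblefun setT f by [].
have mfp : mblefun setT (fun x => f (a * x + b)).
  exact: (measurableT_comp mf' mphi).
have key : (`|a|%:E * \int[leb]_x (f (phi x) ^+ 2)%:E = \int[leb]_x (f x ^+ 2)%:E)%E.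
  pose F (x : measurableTypeR R) := (f x ^+ 2)%:E.
  have mF : measurable_fun setT F by apply/measurable_EFinP; exact: measurable_funX.
  have F0 x : (0 <= F x)%E by rewrite lee_fin sqr_ge0.
  have -> : (\int[leb]_x (f (phi x) ^+ 2)%:E = \int[pf]_x F x)%E.
    by rewrite (@ge0_integral_pushforward _ _ _ _ _ phi mphi leb).
  rewrite  -[X in (X%:E * _)%E]/(k%:num) -ge0_integral_mscale//.
  by apply: eq_measure_integral => /= A mA _; rewrite /mscale/= leb_affine.
have fin : (\int[leb]_x (f (phi x) ^+ 2)%:E < +oo)%E.
  rewrite ltey; apply/eqP => e; move: key; rewrite e gt0_muley ?lte_fin ?normr_gt0//.
  by move=> e2; have := integrable_fin_num measurableT f2; rewrite -e2.
split.
  split => //; apply/integrableP; split.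
    by apply/measurable_EFinP; exact: measurable_funX.
  by under eq_integral => x _ do rewrite gee0_abs ?lee_fin ?sqr_ge0//.
rewrite /n2 /Rintegral -key fineM//; last first.
  by rewrite ge0_fin_numE// integral_ge0// => x _; rewrite lee_fin sqr_ge0.
by rewrite mulKf// normr_eq0.
Qed.

End Affine.

Section Misc.
Context {R : realType}.
Implicit Types (f g : R -> R).

(** The two half-lines contribute at most [n2 setT f] each, by reflection. *)
Lemma L2_abs f : L2 setT f -> L2 setT (fun x => f `|x|) /\
  n2 setT (fun x => f `|x|) <= 2 * n2 setT f.
Proof.
move=> hf.
have m1 : (-1 : R) != 0 by rewrite oppr_eq0 oner_eq0.
have [hfN] := L2_affine 0 m1 hf.
rewrite normrN normr1 invr1 mul1r.
have -> : (fun x => f (-1 * x + 0)) = (fun x => f (- x)).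
  by apply/funext => x; rewrite mulN1r addr0.
move=> nfN.
have {}hfN : L2 setT (fun x => f (- x)).
  by move: hfN; congr L2; apply/funext => x; rewrite mulN1r addr0.
have mfa : mblefun setT (fun x => f `|x|).
  have mf : mblefun setT f by case: hf.
  exact: (measurableT_comp mf (@normr_measurable R setT)).
have si := integrableD' measurableT hf.2 hfN.2.
have le x : f `|x| ^+ 2 <= f x ^+ 2 + f (- x) ^+ 2.
  by case: (ger0P x) => _; rewrite ?lerDl ?lerDr sqr_ge0.
have hfa : L2 setT (fun x => f `|x|).
  split => //; apply: integrable_dom si _ => //.
    exact: measurable_funX.
  by move=> x _; rewrite ger0_norm ?sqr_ge0.
split => //.
rewrite mulrDl mul1r -{2}nfN /n2 -RintegralD//; [|exact: hf.2|exact: hfN.2].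
by apply: le_Rint => //; exact: hfa.2.
Qed.

Lemma mble_itv (i : interval R) : mble [set` i].
Proof. exact: measurable_itv. Qed.

Lemma leb_itv_fin (a b : R) (x y : bool) :
  (leb [set` Interval (BSide x a) (BSide y b)] < +oo)%E.
Proof. by rewrite lebesgue_measure_itv/=; case: ifP => _; rewrite ?ltry// -EFinB ltry. Qed.

End Misc.

(** * Approximation by regular functions, and primitives *)

Section Density.
Context {R : realType}.
Implicit Types (D : set R) (f g df : R -> R) (x y a b k d eps : R).

Lemma cvg0_lt (u : nat -> R) (eps : R) : u @ \oo --> (0 : R) -> 0 < eps ->
  exists n, `|u n| < eps.
Proof.
move=> u0 e0; have /cvgrPdist_lt /(_ _ e0) [n _ /(_ n (leqnn n))] := u0.
by rewrite /= sub0r normrN => ?; exists n.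
Qed.

Lemma n2_dominated D (f_ : nat -> R -> R) g : mble D -> L2 D g ->
  (forall n, mblefun D (f_ n)) ->
  (forall x, D x -> f_ n x @[n --> \oo] --> (0 : R)) ->
  (forall n x, D x -> `|f_ n x| <= `|g x|) ->
  n2 D (f_ n) @[n --> \oo] --> (0 : R).
Proof.
move=> mD hg mf f0 fg.
have := @dominated_cvg _ (measurableTypeR R) R leb D mD
  (fun n x => (f_ n x ^+ 2)%:E) (cst 0%E) (fun x => (g x ^+ 2)%:E).
rewrite integral0 => key.
apply: (@fine_cvg _ _ _ _ _ 0); apply: key.
- by move=> n; apply/measurable_EFinP/measurable_funX.
- move=> x Dx; apply/fine_cvgP; split; first exact: nearW.
  have -> : fine \o (fun n => (f_ n x ^+ 2)%:E) = (fun n => f_ n x * f_ n x).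
    by apply/funext => n.
  by rewrite -[X in _ --> X](mulr0 (0 : R)); apply: cvgM; exact: f0.
- by [].
- exact: hg.2.
- move=> n x Dx; rewrite gee0_abs ?lee_fin ?sqr_ge0//.
  rewrite -(real_normK (num_real (f_ _ _))) -(real_normK (num_real (g x))).
  by rewrite lerXn2r ?nnegrE// fg.
Qed.

Definition clip (N : R) (y : R) := Num.max (- N) (Num.min y N).

Lemma clip_bound N y : 0 <= N -> `|clip N y| <= N.
Proof.
move=> N0; rewrite ler_norml /clip le_max ge_max lexx/=.
by rewrite ge_min lexx orbT andbT; lra.
Qed.

Lemma clip_dist N x y : `|x| <= N -> `|x - clip N y| <= `|x - y|.
Proof.
rewrite ler_norml => /andP[x1 x2]; rewrite /clip /Num.max /Num.min.
have [h1|h1] := ltP y N; case: ltP => h2;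
rewrite ler_norml; case: (ger0P (x - y)) => h3; apply/andP; split; lra.
Qed.

Lemma clip_le N y : 0 <= N -> `|y - clip N y| <= `|y|.
Proof.
move=> N0; rewrite /clip /Num.max /Num.min.
have [h1|h1] := ltP y N; case: ltP => h2;
rewrite ler_norml; case: (ger0P y) => h3; apply/andP; split; lra.
Qed.

Lemma clip_le0 N y : 0 <= N -> `|clip N y| <= `|y|.
Proof.
move=> N0; rewrite /clip /Num.max /Num.min.
have [h1|h1] := ltP y N; case: ltP => h2;
rewrite ler_norml; case: (ger0P y) => h3; apply/andP; split; lra.
Qed.

Lemma clip_id N y : `|y| <= N -> clip N y = y.
Proof.
rewrite ler_norml => /andP[x1 x2]; rewrite /clip.
by rewrite (min_idPl x2) (max_idPr x1).
Qed.

Lemma clip_meas D N f : mblefun D f -> mblefun D (fun x => clip N (f x)).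
Proof.
move=> mf.
apply: (@measurable_maxr _ (measurableTypeR R) R D (cst (- N)) (fun x => Num.min (f x) N)).
  exact: measurable_cst.
by apply: (@measurable_minr _ (measurableTypeR R) R D f (cst N)).
Qed.

Lemma cts_min f g : continuous f -> continuous g ->
  continuous (fun x => Num.min (f x) (g x)).
Proof. by move=> cf cg x; apply: continuous_min; [exact: cf|exact: cg]. Qed.

Lemma cts_max f g : continuous f -> continuous g ->
  continuous (fun x => Num.max (f x) (g x)).
Proof. by move=> cf cg x; apply: continuous_max; [exact: cf|exact: cg]. Qed.

Lemma cts_mul f g : continuous f -> continuous g -> continuous (fun x => f x * g x).
Proof. by move=> cf cg x; apply: continuousM; [exact: cf|exact: cg]. Qed.

Lemma cts_add f g : continuous f -> continuous g -> continuous (fun x => f x + g x).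
Proof. by move=> cf cg x; apply: continuousD; [exact: cf|exact: cg]. Qed.

Lemma cts_sub f g : continuous f -> continuous g -> continuous (fun x => f x - g x).
Proof. by move=> cf cg x; apply: continuousB; [exact: cf|exact: cg]. Qed.

Lemma cts_cst (k : R) : continuous (fun _ : R => k).
Proof. by move=> x; exact: cvg_cst. Qed.

Lemma cts_aff (k m : R) : continuous (fun x : R => k * x + m).
Proof.
by apply: cts_add; [apply: cts_mul; [exact: cts_cst|move=> x; exact: cvg_id]|exact: cts_cst].
Qed.

Lemma cts_meas D f : mble D -> continuous f -> mblefun D f.
Proof.
move=> mD cf; have := @continuous_measurable_fun R f cf.
by move=> mf; apply: (@measurable_funS _ _ (measurableTypeR R) R setT).
Qed.

(** A trapezoid, equal to 1 on [[a + 2 h, b - 2 h]] and vanishing outside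
    [[a + h, b - h]]. *)
Definition cutoff (a b h x : R) : R :=
  Num.max 0 (Num.min 1 (Num.min (h^-1 * x + (- a / h - 1)) (- h^-1 * x + (b / h - 1)))).

Lemma cutoff_cts a b h : continuous (cutoff a b h).
Proof.
apply: cts_max; first exact: cts_cst.
apply: cts_min; first exact: cts_cst.
by apply: cts_min; exact: cts_aff.
Qed.

Lemma cutoff_ge0 a b h x : 0 <= cutoff a b h x.
Proof. by rewrite /cutoff le_max lexx. Qed.

Lemma cutoff_le1 a b h x : cutoff a b h x <= 1.
Proof. by rewrite /cutoff ge_max ler01/= ge_min lexx. Qed.

Lemma cutoff1 a b h x : 0 < h -> a + 2 * h <= x <= b - 2 * h -> cutoff a b h x = 1.
Proof.
move=> h0 /andP[x1 x2]; rewrite /cutoff.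
have e1 : 1 <= h^-1 * x + (- a / h - 1).
  have -> : h^-1 * x + (- a / h - 1) = (x - a) / h - 1 by field; rewrite gt_eqF.
  by rewrite lerBrDr ler_pdivlMr//; lra.
have e2 : 1 <= - h^-1 * x + (b / h - 1).
  have -> : - h^-1 * x + (b / h - 1) = (b - x) / h - 1 by field; rewrite gt_eqF.
  by rewrite lerBrDr ler_pdivlMr//; lra.
rewrite (min_idPl _) ?le_min ?e1 ?e2//.
by rewrite (max_idPr _).
Qed.

Lemma cutoff0 a b h x : 0 < h -> ~ (a + h <= x <= b - h) -> cutoff a b h x = 0.
Proof.
move=> h0 hx; rewrite /cutoff; apply/max_idPl; rewrite ge_min; apply/orP; right.
rewrite ge_min.
have -> : h^-1 * x + (- a / h - 1) = (x - a) / h - 1 by field; rewrite gt_eqF.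
have -> : - h^-1 * x + (b / h - 1) = (b - x) / h - 1 by field; rewrite gt_eqF.
rewrite !lerBlDr !add0r !ler_pdivrMr//.
apply: contra_notT hx; rewrite negb_or -!ltNge => /andP[? ?].
by apply/andP; split; lra.
Qed.

(** Clipping [f] and restricting it to a smaller interval changes it by little,
    by dominated convergence, and makes it bounded by some [n]. Continuous
    functions are dense for the L1 norm, and for functions bounded by [n] the
    square of a difference is at most [2 n + 1] times its absolute value. *)
Lemma dense_Cc a b f eps : a < b -> L2 `]a, b[ f -> 0 < eps ->
  exists psi : R -> R, exists2 h : R, 0 < h &
  [/\ continuous psi, forall x, ~ (a + h <= x <= b - h) -> psi x = 0 &
      n2 `]a, b[ (fun x => f x - psi x) < eps].
Proof.
move=> ab hf e0; set D : set R := `]a, b[%classic.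
have mD : mble D by exact: mble_itv.
have fD : (leb D < +oo)%E by exact: leb_itv_fin.
have mf : mblefun D f by case: hf.
pose h (n : nat) : R := n.+1%:R^-1.
have h0 n : 0 < h n by rewrite invr_gt0 ltr0n.
pose I n : set R := `[a + 2 * h n, b - 2 * h n]%classic.
pose f' n x := clip n%:R (f x) * \1_(I n) x.
have mf' n : mblefun D (f' n).
  apply: measurable_funM; first exact: clip_meas.
  by apply: measurable_indic; exact: mble_itv.
have f'N n x : `|f' n x| <= n%:R.
  rewrite /f' indicE; case: (x \in I n).
    by rewrite mulr1 clip_bound.
  by rewrite mulr0 normr0.
have : n2 D (fun x => f x - f' n x) @[n --> \oo] --> (0 : R).
  apply: (@n2_dominated _ _ f) => //.
  - by move=> n; apply: measurable_funB.
  - move=> x; rewrite /D /= in_itv/= => /andP[ax xb].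
    apply: cvg_near_cst; near=> n.
    have hn : 2 * h n <= Num.min (x - a) (b - x).
      near: n.
      have c0 : 2 * h n @[n --> \oo] --> (2 * 0 : R).
        apply: cvgM; first exact: cvg_cst.
        exact: cvg_harmonic.
      rewrite mulr0 in c0.
      have m0 : 0 < Num.min (x - a) (b - x) by rewrite lt_min !subr_gt0 ax.
      exact: (cvgr_le _ c0).
    have fn : `|f x| <= n%:R by near: n; exact: nbhs_infty_ger.
    rewrite /f' clip_id// indicE mem_set ?mulr1 ?subrr//.
    rewrite /I /= in_itv/=; move: hn; rewrite le_min => /andP[h1 h2].
    by apply/andP; split; lra.
  - move=> n x _; rewrite /f' indicE; case: (x \in I n).
      by rewrite mulr1 clip_le.
    by rewrite mulr0 subr0.
have e4 : 0 < eps / 4 by lra.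
move=> /cvg0_lt /(_ e4) [n].
rewrite ger0_norm ?n2_ge0// => fn.
have L2f' : L2 D (f' n) by apply: (@L2_bounded _ _ _ n%:R) => //.
have if' := L2_integrable mD fD L2f'.
have [g_ [gc gi gl]] := approximation_continuous_integrable mD fD if'.
(* bounds [`|f' n x - psi x|] *)
pose K : R := 2 * n%:R + 1.
have K0 : 0 < K by rewrite /K; have := ler0n R n; lra.
have [k gk] : exists k : nat, (\int[leb]_(z in D) `|(f' n z - g_ k z)%:E| < (eps / 4 / K)%:E)%E.
  have /fine_cvgP [fg /cvgrPdist_lt /(_ (eps / 4 / K))] := gl.
  have -> : 0 < eps / 4 / K by rewrite divr_gt0.
  move=> /(_ isT) hk.
  have [k _ /(_ k (leqnn _)) [kf kl]] := filterI fg hk.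
  exists k; rewrite -[X in (X < _)%E]fineK// lte_fin.
  move: kl; rewrite /= sub0r normrN; exact: le_lt_trans (ler_norm _).
pose psi x := clip n%:R (g_ k x) * cutoff a b (h n) x.
have cpsi : continuous psi.
  apply: cts_mul; last exact: cutoff_cts.
  apply: cts_max; first exact: cts_cst.
  by apply: cts_min; [exact: gc|exact: cts_cst].
have bpsi x : `|psi x| <= n%:R.
  rewrite /psi normrM (ger0_norm (cutoff_ge0 _ _ _ _)) -[leRHS]mulr1.
  by apply: ler_pM; rewrite ?normr_ge0 ?cutoff_ge0 ?clip_bound ?cutoff_le1.
have mpsi : mblefun D psi by exact: cts_meas.
have L2psi : L2 D psi by apply: (@L2_bounded _ _ _ n%:R) => //.
exists psi; exists (h n) => //; split => //.
  by move=> x hx; rewrite /psi cutoff0// mulr0.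
have le : n2 D (fun x => f' n x - psi x) <= K * \int[leb]_(z in D) `|f' n z - g_ k z|.
  have ia : intg D (fun z => `|f' n z - g_ k z|).
    have := integrable_abse (integrableB' mD if' (gi k)).
    by apply: eq_integrable.
  rewrite -RintegralZl//; apply: le_Rint => //.
  - exact: (L2B mD L2f' L2psi).2.
  - exact: integrableZ'.
  - move=> x Dx.
    have [xI|xI] := pselect (I n x).
      have -> : psi x = clip n%:R (g_ k x).
        rewrite /psi cutoff1 ?mulr1//; move: xI; rewrite /I /= in_itv //.
      rewrite -(real_normK (num_real (_ - _))) expr2.
      apply: ler_pM => //; last exact: clip_dist.
      rewrite (le_trans (ler_normB _ _))//.
      have := f'N n x; have := clip_bound (g_ k x) (ler0n R n); rewrite /K; lra.
    have f'0 : f' n x = 0 by rewrite /f' indicE memNset// mulr0.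
    rewrite f'0 !sub0r sqrrN normrN -(real_normK (num_real _)) expr2.
    apply: ler_pM => //; first by have := bpsi x; rewrite /K; have := ler0n R n; lra.
    rewrite /psi normrM (ger0_norm (cutoff_ge0 _ _ _ _)) -[leRHS]mulr1.
    by apply: ler_pM; rewrite ?normr_ge0 ?cutoff_ge0 ?cutoff_le1 ?clip_le0.
have le2 : \int[leb]_(z in D) `|f' n z - g_ k z| < eps / 4 / K.
  rewrite /Rintegral -lte_fin fineK//.
  rewrite ge0_fin_numE; first exact: lt_trans gk (ltry _).
  by apply: integral_ge0 => x _; rewrite lee_fin.
have le3 : n2 D (fun x => f' n x - psi x) < eps / 4.
  by rewrite (le_lt_trans le)// mulrC -ltr_pdivlMr.
have -> : (fun x => f x - psi x) = (fun x => (f x - f' n x) + (f' n x - psi x)).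
  by apply/funext => x; ring.
rewrite (le_lt_trans (n2D_le _ _ _))//; [exact: L2B|exact: L2B|].
lra.
Unshelve. all: by end_near. Qed.

Lemma heine f (a b eps : R) : continuous f -> 0 < eps ->
  exists2 d : R, 0 < d &
    forall x y, a <= x <= b -> `|x - y| < d -> `|f x - f y| < eps.
Proof.
move=> cf e0.
have : compact `[a, b] by exact: segment_compact.
move=> /compact_near_coveringP.
move=> /(_ R (nbhs (0:R)^'+)
  (fun d x => forall y, `|x - y| < d -> `|f x - f y| < eps)) H.
have {H} : \forall d \near (0:R)^'+, `[a, b]%classic `<=`
   (fun x => forall y, `|x - y| < d -> `|f x - f y| < eps).
  apply: H => x _.
  have e2 : 0 < eps / 2 by lra.
  have /cvgrPdist_lt /(_ _ e2) /nbhs_ballP[r /= r0 rf] := cf x.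
  exists (ball x (r / 2), [set d | d < r / 2]).
    split => /=; first by apply: nbhsx_ballx; lra.
    by apply: nbhs_right_lt; lra.
  move=> [x' d] /= [xx' dr] y x'y.
  have h1 : `|f x - f x'| < eps / 2.
    by apply: rf; rewrite /ball /= (lt_trans xx')//; lra.
  have h2 : `|f x - f y| < eps / 2.
    apply: rf; rewrite /ball /=.
    have -> : x - y = (x - x') + (x' - y) by ring.
    rewrite (le_lt_trans (ler_normD _ _))//; rewrite /ball /= in xx'; lra.
  have -> : f x' - f y = (f x - f y) - (f x - f x') by ring.
  rewrite (le_lt_trans (ler_normB _ _))//; lra.
move=> H.
have [d] : exists d : R, 0 < d /\ `[a, b]%classic `<=`
   (fun x => forall y, `|x - y| < d -> `|f x - f y| < eps).
  near (0:R)^'+ => d; exists d; split; first by near: d; exact: nbhs_right_gt.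
  by near: d.
move=> [d0 dP]; exists d => // x y xab; apply: dP.
by rewrite /= in_itv.
Unshelve. all: by end_near. Qed.

Definition supp_in (a b : R) f := forall x, ~ (a <= x <= b) -> f x = 0.

Lemma heine_supp f (a b eps : R) : continuous f -> supp_in a b f -> 0 < eps ->
  exists2 d : R, 0 < d & forall x y, `|x - y| < d -> `|f x - f y| < eps.
Proof.
move=> cf sf e0; have [d d0 H] := heine a b cf e0; exists d => // x y xy.
have [xab|xab] := boolP (a <= x <= b); first exact: H.
have [yab|yab] := boolP (a <= y <= b); first by rewrite distrC; apply: H; rewrite // distrC.
by rewrite !sf ?subrr ?normr0//; exact/negP.
Qed.

(** Starting at minus infinity spares the distinction between positive and
    negative times: the functions of time used below vanish on the left. *)
Definition Prim f (x : R) := \int[leb]_(t in `]-oo, x]) f t.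

Lemma eq_patch_int D D' f g : mble D -> mble D' -> (forall x, f \_ D x = g \_ D' x) ->
  (intg D f -> intg D' g) /\ \int[leb]_(x in D) f x = \int[leb]_(x in D') g x.
Proof.
move=> mD mD' fg; split.
  move=> /(integrable_mkcond _ mD).1 h; apply/(integrable_mkcond _ mD').2.
  move: h; apply: eq_integrable => // x _ /=.
  have := fg x; rewrite /patch /=.
  by do 2 case: ifP => //; move=> _ _; first [move=> ->|move=> <-].
rewrite Rintegral_mkcond [RHS]Rintegral_mkcond; apply: eq_Rintegral => x _.
exact: fg.
Qed.

Lemma Rint_shrink D D' f : mble D -> mble D' -> D' `<=` D ->
  (forall x, D x -> ~ D' x -> f x = 0) ->
  \int[leb]_(x in D) f x = \int[leb]_(x in D') f x.
Proof.
move=> mD mD' DD f0; apply: (eq_patch_int mD mD' _).2 => x.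
rewrite /patch; case: ifPn => xD; case: ifPn => xD' //.
  by apply: f0; [exact: set_mem|move=> /mem_set; exact/negP].
by exfalso; move/negP: xD; apply; apply/mem_set/DD/set_mem.
Qed.

Lemma left_cts_int f a u : continuous f -> (forall x, x < a -> f x = 0) ->
  intg `]-oo, u] f.
Proof.
move=> cf f0.
have : intg `[a, u] f.
  apply: continuous_compact_integrable; first exact: segment_compact.
  exact: continuous_subspaceT.
apply: (eq_patch_int _ _ _).1; [exact: mble_itv|exact: mble_itv|].
move=> x; rewrite /patch !mem_setE !in_itv/=.
case: ifPn => [/andP[_ ->]//|]; rewrite negb_and -!ltNge => /orP[xa|ux].
  by rewrite f0//; case: ifP.
by rewrite leNgt ux.
Qed.

Lemma Prim_der f x : {for x, continuous f} -> (forall u, intg `]-oo, u] f) ->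
  is_derive x 1 (Prim f) (f x).
Proof.
move=> cf fi; have x1 : x < x + 1 by rewrite ltrDl.
have := @continuous_FTC1 R f -oo%O x (x + 1) x1 (fi _) (ltNyr _) cf.
rewrite /= -/(Prim f) derive1E => -[d e]; exact: DeriveDef d e.
Qed.

Lemma Prim_left f a x : (forall t, t < a -> f t = 0) -> x < a -> Prim f x = 0.
Proof.
move=> f0 xa; rewrite /Prim (@eq_Rintegral _ _ _ _ _ (cst 0)).
  by rewrite Rintegral_cst ?mul0r//; exact: mble_itv.
by move=> t /set_mem /=; rewrite in_itv/= => tx; rewrite f0// (le_lt_trans tx).
Qed.

Lemma Prim_sub f s t : (forall u, intg `]-oo, u] f) -> s <= t ->
  Prim f t - Prim f s = \int[leb]_(x in `]s, t]) f x.
Proof.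
move=> fi st; rewrite /Prim.
by rewrite (@Rintegral_itvB R f -oo%O (BRight t) s)// bnd_simp.
Qed.

Lemma derive_cts f df : (forall x, is_derive x 1 f (df x)) -> continuous f.
Proof.
move=> fd x; apply: differentiable_continuous; apply/derivable1_diffP.
by have [h _] := fd x.
Qed.

Lemma Prim_right f a b x : continuous f -> supp_in a b f -> b <= x ->
  Prim f x = \int[leb]_(t in `[a, b]) f t.
Proof.
move=> cf sf bx; rewrite /Prim; apply: Rint_shrink; [exact: mble_itv|exact: mble_itv| |].
  by move=> t /=; rewrite !in_itv/= => /andP[_ tb]; rewrite (le_trans tb).
by move=> t _ /= tn; apply: sf => tab; apply: tn; rewrite in_itv.
Qed.

Lemma Prim_Cc_der f a b : continuous f -> supp_in a b f ->
  forall x, is_derive x 1 (Prim f) (f x).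
Proof.
move=> cf sf x; apply: Prim_der; first exact: cf.
move=> u; apply: (@left_cts_int _ a) => // y ya; apply: sf => /andP[ay _].
by move: ya; rewrite ltNge ay.
Qed.

Lemma is_derive_aff f (d k m x : R) : is_derive (k * x + m) 1 f d ->
  is_derive x 1 (fun y => f (k * y + m)) (k * d).
Proof.
move=> fd.
have g : is_derive x 1 (fun y : R => k * y + m) k.
  apply: (is_derive_eq (is_deriveD (is_deriveZ k (is_derive_id x 1)) (is_derive_cst m x 1))).
  by rewrite addr0 /GRing.scale /= mulr1.
apply: (is_derive_eq (is_derive1_comp (f := f) (g := (fun y : R => k * y + m)) fd g)).
by rewrite mulrC.
Qed.

Lemma derive1_is f x d : is_derive x 1 f d -> derive1 f x = d.
Proof. by move=> fd; rewrite derive1E derive_val. Qed.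

(** The mean of [f] over [[x, x + k]], written as a difference quotient so that
    its derivative is explicit. *)
Definition moll (k : R) f x := (Prim f (x + k) - Prim f x) / k.

Lemma moll_der f a b k x : continuous f -> supp_in a b f ->
  is_derive x 1 (moll k f) ((f (x + k) - f x) / k).
Proof.
move=> cf sf; have Pd := Prim_Cc_der cf sf.
have d1 : is_derive x 1 (fun y => Prim f (y + k)) (f (x + k)).
  have := @is_derive_aff (Prim f) (f (1 * x + k)) 1 k x (Pd _).
  rewrite !mul1r; congr is_derive; apply/funext => y; by rewrite mul1r.
have := is_deriveZ k^-1 (is_deriveB d1 (Pd x)).
rewrite /GRing.scale /=; set g := (X in is_derive _ _ X _ -> _).
have -> : g = moll k f by apply/funext => y; rewrite /g /moll /= mulrC.
by rewrite mulrC.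
Qed.

(** By the mean value theorem the quotient is a value of [f] near [t], and [f]
    is uniformly continuous. *)
Lemma unif_der f a b eps : continuous f -> supp_in a b f -> 0 < eps ->
  exists2 d : R, 0 < d & forall t h, h != 0 -> `|h| < d ->
    `|h^-1 * (Prim f (t + h) - Prim f t) - f t| <= eps.
Proof.
move=> cf sf e0; have [d d0 dP] := heine_supp cf sf e0.
have Pd := Prim_Cc_der cf sf.
have cP : continuous (Prim f) by exact: derive_cts Pd.
exists d => // t h hn hd.
have [hp|hm] : 0 < h \/ h < 0 by move: hn; rewrite neq_lt => /orP[]; [right|left].
- have th : t < t + h by rewrite ltrDl.
  have cw : {within `[t, t + h], continuous (Prim f)} by exact: continuous_subspaceT.
  have [c cI ->] := @MVT R (Prim f) f t (t + h) th (fun y _ => Pd y) cw.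
  have -> : h^-1 * (f c * (t + h - t)) - f t = f c - f t by field.
  move: cI hd; rewrite in_itv/= gtr0_norm// => /andP[c1 c2] hd.
  by apply: ltW; apply: dP; rewrite ltr_norml; apply/andP; split; lra.
- have th : t + h < t by rewrite gtrDl.
  have cw : {within `[t + h, t], continuous (Prim f)} by exact: continuous_subspaceT.
  have [c cI E] := @MVT R (Prim f) f (t + h) t th (fun y _ => Pd y) cw.
  have -> : Prim f (t + h) - Prim f t = - (f c * (t - (t + h))) by rewrite -E; ring.
  have -> : h^-1 * - (f c * (t - (t + h))) - f t = f c - f t by field.
  move: cI hd; rewrite in_itv/= ltr0_norm// => /andP[c1 c2] hd.
  by apply: ltW; apply: dP; rewrite ltr_norml; apply/andP; split; lra.
Qed.

Lemma moll_supp f a b k : continuous f -> supp_in a b f -> 0 < k -> a <= b ->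
  supp_in (a - k) b (moll k f).
Proof.
move=> cf sf k0 ab x xn; rewrite /moll.
have fl t : t < a -> f t = 0.
  by move=> ta; apply: sf => /andP[+ _]; rewrite leNgt ta.
have [xb|xb] := ltP b x.
  by rewrite !(Prim_right cf sf) ?subrr ?mul0r//; lra.
have xa : x < a - k by rewrite ltNge; apply/negP => h; apply: xn; rewrite h.
by rewrite !(Prim_left fl) ?subrr ?mul0r//; lra.
Qed.

Lemma supp_test f df a b a' b' : (forall x, is_derive x 1 f (df x)) ->
  continuous df -> supp_in a' b' f -> a < a' -> b' < b ->
  test_function `]a, b[ f.
Proof.
move=> fd cdf sf aa bb.
have e : derive1 f = df by apply/funext => x; apply: derive1_is.
split.
- by move=> x; have [h _] := fd x.
- by rewrite e.
- exists `[a', b']%classic; split; first exact: segment_compact.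
    move=> x /=; rewrite !in_itv/= => /andP[x1 x2].
    by rewrite (lt_le_trans aa x1) (le_lt_trans x2 bb).
  by move=> x /= xn; apply: sf => h; apply: xn; rewrite in_itv.
Qed.

(** Mollification moves a continuous approximation by little in the sup norm,
    and enlarges its support by [k] only, which can be taken smaller than the
    distance of the support to the end points. *)
Lemma dense_C1c a b f eps : a < b -> L2 `]a, b[ f -> 0 < eps ->
  exists phi dphi : R -> R, exists a' b' : R,
    [/\ a < a' /\ b' < b, forall x, is_derive x 1 phi (dphi x), continuous dphi,
        supp_in a' b' phi & n2 `]a, b[ (fun x => f x - phi x) < eps].
Proof.
move=> ab hf e0; have e4 : 0 < eps / 4 by lra.
have [psi [h h0 [cpsi spsi npsi]]] := dense_Cc ab hf e4.
set D : set R := `]a, b[%classic.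
have mD : mble D by exact: mble_itv.
have fD : (leb D < +oo)%E by exact: leb_itv_fin.
have lD : fine (leb D) = b - a.
  by rewrite lebesgue_measure_itv/= lte_fin ab -EFinB.
pose e1 := Num.min 1 (eps / 4 / (b - a)).
have e10 : 0 < e1 by rewrite lt_min ltr01/= divr_gt0// subr_gt0.
have [ahb|ahb] := ltP (b - h) (a + h).
  (* then the approximation vanishes *)
  exists (fun=> 0), (fun=> 0), ((a + b) / 2), ((a + b) / 2); split.
  - by split; lra.
  - move=> x; exact: is_derive_cst.
  - exact: cts_cst.
  - by move=> x.
  - have : n2 `]a, b[ (fun x => f x - psi x) < eps by lra.
    congr (n2 _ _ < _); apply/funext => x; congr (_ - _); apply: spsi => /andP[? ?].
    by move: ahb; rewrite ltNge (le_trans (y := x)).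
have e12 : 0 < e1 / 2 by rewrite divr_gt0.
have [d d0 dP] := unif_der cpsi spsi e12.
pose k := Num.min (d / 2) (h / 2).
have k0 : 0 < k by rewrite lt_min !divr_gt0.
have kd : k < d by rewrite gt_min; apply/orP; left; lra.
have kh : k < h by rewrite gt_min; apply/orP; right; lra.
exists (moll k psi), (fun x => (psi (x + k) - psi x) / k), (a + h - k), (b - h).
have md x := moll_der k x cpsi spsi.
have mc : continuous (moll k psi) by exact: derive_cts md.
split.
- split; lra.
- exact: md.
- apply: cts_mul; last exact: cts_cst.
  apply: cts_sub => // x; apply: continuous_comp; last exact: cpsi.
  by have := @cts_add id (cst k) (fun x => cvg_id) (@cts_cst k) x.
- exact: moll_supp.
have nm x : `|psi x - moll k psi x| < e1.
  rewrite distrC /moll mulrC; apply: le_lt_trans (dP x k _ _) _; last by lra.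
    by rewrite gt_eqF.
  by rewrite gtr0_norm.
have L2p : L2 D psi.
  have [M] : exists M, forall x, D x -> `|psi x| <= M.
    have /compact_bounded [M [_ MP]] := continuous_compact
      (continuous_subspaceT cpsi) (@segment_compact R a b).
    exists (M + 1) => x Dx; apply: (MP (M + 1)); first by rewrite ltrDl.
    by exists x => //; exact: subset_itv_oo_cc.
  by move=> MP; apply: (L2_bounded mD fD (cts_meas mD cpsi) MP).
have L2d : L2 D (fun x => psi x - moll k psi x).
  apply: (@L2_bounded _ _ _ e1) => //; last by move=> x _; exact: ltW.
  by apply: measurable_funB; exact: cts_meas.
have -> : (fun x => f x - moll k psi x) =
   (fun x => (f x - psi x) + (psi x - moll k psi x)).
  by apply/funext => x; ring.
rewrite (le_lt_trans (n2D_le mD (L2B mD hf L2p) L2d))//.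
have : n2 D (fun x => psi x - moll k psi x) <= e1 ^+ 2 * (b - a).
  by rewrite -lD; apply: n2_bounded => //; [case: L2d|move=> x _; exact: ltW].
have : e1 ^+ 2 * (b - a) <= eps / 4.
  rewrite -ler_pdivlMr ?subr_gt0//.
  have h1 : e1 <= 1 by rewrite ge_min lexx.
  have h2 : e1 <= eps / 4 / (b - a) by rewrite ge_min lexx orbT.
  rewrite (le_trans _ h2)// expr2 -[leRHS]mulr1; apply: ler_pM => //; exact: ltW.
lra.
Qed.

End Density.

(** * Weak derivatives and traces *)

Section WeakDeriv.
Context {R : realType}.
Implicit Types (D : set R) (f g df dg phi : R -> R) (x y a b k d eps : R).

(** The fluid domain of a centred object. *)
Definition two_sided (a b : R) : set R := `]- b, - a[ `|` `]a, b[.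

Lemma mble_two_sided a b : mble (two_sided a b).
Proof. by apply: measurableU; exact: mble_itv. Qed.

Lemma two_sided_sub a b : 0 < a -> two_sided a b `<=` `[- b, b].
Proof.
move=> a0 x; rewrite /two_sided /= !in_itv/= => -[|] /andP[h1 h2]; apply/andP; split; lra.
Qed.

Lemma fin_sub D a b : mble D -> D `<=` `[a, b] -> (leb D < +oo)%E.
Proof.
move=> mD Dab; apply: (@le_lt_trans _ _ (leb `[a, b]%classic)); last exact: leb_itv_fin.
by apply: le_measure; rewrite ?inE//; exact: mble_itv.
Qed.

Lemma cts_bounded f a b : continuous f -> exists M, forall x, a <= x <= b -> `|f x| <= M.
Proof.
move=> cf.
have /compact_bounded [M [_ MP]] := continuous_compact
  (continuous_subspaceT cf) (@segment_compact R a b).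
exists (M + 1) => x xab; apply: (MP (M + 1)); first by rewrite ltrDl.
by exists x => //=; rewrite in_itv.
Qed.

Lemma L2_cts D a b f : mble D -> D `<=` `[a, b] -> continuous f -> L2 D f.
Proof.
move=> mD Dab cf; have [M MP] := cts_bounded a b cf.
apply: (L2_bounded mD (fin_sub mD Dab) (cts_meas mD cf) (M := M)).
by move=> x /Dab /=; rewrite in_itv/= => /MP.
Qed.

Lemma test_cts D phi : test_function D phi -> continuous phi.
Proof.
move=> [dphi _ _] x; apply: differentiable_continuous.
by apply/derivable1_diffP; exact: dphi.
Qed.

Lemma test_L2 D a b phi : mble D -> D `<=` `[a, b] -> test_function D phi ->
  L2 D phi /\ L2 D (derive1 phi).
Proof.
move=> mD Dab tphi; split; apply: (L2_cts mD Dab); first exact: test_cts tphi.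
by case: tphi.
Qed.

Lemma test_out D phi x : test_function D phi -> ~ D x ->
  phi x = 0 /\ derive1 phi x = 0.
Proof.
move=> [dphi cphi [K [cK KD K0]]] nDx.
have nKx : ~ K x by move=> /KD.
split; first exact: K0.
have oK : open (~` K) by apply: closed_openC; apply: compact_closed => //; exact: Rhausdorff.
rewrite derive1E (@near_eq_derive _ _ _ _ (cst 0)) ?derive_cst//.
have : nbhs x (~` K) by exact: open_nbhs_nbhs.
by apply: filterS => y; exact: K0.
Qed.

Lemma test_sub D D' phi : D `<=` D' -> test_function D phi -> test_function D' phi.
Proof.
move=> DD [dphi cphi [K [cK KD K0]]]; split => //; exists K; split => //.
exact: subset_trans DD.
Qed.

Lemma wd_restrict D D' f df : mble D -> mble D' -> D' `<=` D ->
  is_weak_deriv D f df -> is_weak_deriv D' f df.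
Proof.
move=> mD mD' DD wd phi tphi.
have := wd phi (test_sub DD tphi).
rewrite (Rint_shrink mD mD' DD); last first.
  by move=> x _ /(test_out tphi)[_ ->]; rewrite mulr0.
rewrite (Rint_shrink mD mD' DD) => // x _ /(test_out tphi)[-> _].
by rewrite mulr0.
Qed.

Lemma wdB D a b f df g dg : mble D -> D `<=` `[a, b] ->
  L2 D f -> L2 D df -> L2 D g -> L2 D dg ->
  is_weak_deriv D f df -> is_weak_deriv D g dg ->
  is_weak_deriv D (fun x => f x - g x) (fun x => df x - dg x).
Proof.
move=> mD Dab Lf Ldf Lg Ldg wf wg phi tphi.
have [Lp Ldp] := test_L2 mD Dab tphi.
under eq_Rintegral do rewrite mulrBl.
rewrite RintegralB//; [|exact: L2_int_mul|exact: L2_int_mul].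
under [in RHS]eq_Rintegral do rewrite mulrBl.
rewrite RintegralB//; [|exact: L2_int_mul|exact: L2_int_mul].
by rewrite wf// wg//; ring.
Qed.

(** Both integrals in the definition of a weak derivative are continuous for the
    L2 norm, the test function being fixed. *)
Lemma wd_closed D a b f df : mble D -> D `<=` `[a, b] -> L2 D f -> L2 D df ->
  (forall eps, 0 < eps -> exists g dg, [/\ L2 D g, L2 D dg, is_weak_deriv D g dg,
    n2 D (fun x => f x - g x) < eps & n2 D (fun x => df x - dg x) < eps]) ->
  is_weak_deriv D f df.
Proof.
move=> mD Dab Lf Ldf H phi tphi.
have [Lp Ldp] := test_L2 mD Dab tphi.
apply/eqP; rewrite -subr_eq0 opprK; set X := (X in X == 0).
apply/negPn/negP => X0.
pose M := 2 * n2 D phi + 2 * n2 D (derive1 phi) + 1.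
have M0 : 0 < M.
  by have := n2_ge0 D phi; have := n2_ge0 D (derive1 phi); rewrite /M; lra.
have X2 : 0 < X ^+ 2 by rewrite exprn_even_gt0.
have [g [dg [Lg Ldg wg n1 n2']]] := H (X ^+ 2 / M) (divr_gt0 X2 M0).
set u := (fun x => f x - g x) in n1; set w := (fun x => df x - dg x) in n2'.
have Lu : L2 D u by exact: L2B.
have Lw : L2 D w by exact: L2B.
have XE : X = \int[leb]_(x in D) (u x * derive1 phi x) + \int[leb]_(x in D) (w x * phi x).
  have e1 : \int[leb]_(x in D) (u x * derive1 phi x) =
     \int[leb]_(x in D) (f x * derive1 phi x) - \int[leb]_(x in D) (g x * derive1 phi x).
    rewrite -RintegralB//; [|exact: L2_int_mul|exact: L2_int_mul].
    by apply: eq_Rintegral => x _; rewrite mulrBl.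
  have e2 : \int[leb]_(x in D) (w x * phi x) =
     \int[leb]_(x in D) (df x * phi x) - \int[leb]_(x in D) (dg x * phi x).
    rewrite -RintegralB//; [|exact: L2_int_mul|exact: L2_int_mul].
    by apply: eq_Rintegral => x _; rewrite mulrBl.
  by rewrite e1 e2 wg// /X; ring.
have c1 := cauchy_schwarz mD Lu Ldp.
have c2 := cauchy_schwarz mD Lw Lp.
set A := \int[_]_(_ in _) _ in c1 XE; set B := \int[_]_(_ in _) _ in c2 XE.
have le1 : X ^+ 2 <= 2 * A ^+ 2 + 2 * B ^+ 2.
  by rewrite XE; have := sqr_ge0 (A - B); nra.
have p1 := n2_ge0 D phi; have p2 := n2_ge0 D (derive1 phi).
have q1 : n2 D u * n2 D (derive1 phi) <= X ^+ 2 / M * n2 D (derive1 phi).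
  by apply: ler_wpM2r => //; exact: ltW.
have q2 : n2 D w * n2 D phi <= X ^+ 2 / M * n2 D phi.
  by apply: ler_wpM2r => //; exact: ltW.
have : X ^+ 2 <= X ^+ 2 / M * (M - 1).
  by rewrite /M; lra.
have -> : X ^+ 2 / M * (M - 1) = X ^+ 2 - X ^+ 2 / M by field; rewrite gt_eqF.
by have := divr_gt0 X2 M0; lra.
Qed.

Lemma Rint_oo_cc f a b : intg `[a, b] f ->
  \int[leb]_(x in `]a, b[) f x = \int[leb]_(x in `[a, b]) f x.
Proof.
move=> fi.
rewrite Rintegral_itv_bndo_bndc; last first.
  by apply: integrableS fi => //; exact: subset_itv_oo_cc.
rewrite Rintegral_itv_obnd_cbnd//.
by apply: integrableS fi => //; exact: subset_itv_oc_cc.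
Qed.

Lemma der_cts_at f d x : is_derive x 1 f d -> {for x, continuous f}.
Proof.
by move=> [h _]; apply: differentiable_continuous; apply/derivable1_diffP.
Qed.

Lemma der_LR f df a b : (forall x, a <= x <= b -> is_derive x 1 f (df x)) -> a < b ->
  derivable_oo_LRcontinuous f a b.
Proof.
move=> fd ab; split.
- move=> x; rewrite in_itv/= => /andP[ax xb].
  by have [|h _] := fd x; first by rewrite !ltW.
- apply: cvg_at_right_filter.
  by apply: (@der_cts_at _ (df a)); apply: fd; rewrite lexx ltW.
- apply: cvg_at_left_filter.
  by apply: (@der_cts_at _ (df b)); apply: fd; rewrite lexx ltW.
Qed.

Lemma FTC f df a b : a < b -> (forall x, a <= x <= b -> is_derive x 1 f (df x)) ->
  (forall x, a <= x <= b -> {for x, continuous df}) ->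
  intg `[a, b] df /\ \int[leb]_(x in `[a, b]) df x = f b - f a.
Proof.
move=> ab fd cdf.
have cw : {within `[a, b], continuous df}.
  by apply: continuous_in_subspaceT => x /set_mem /=; rewrite in_itv/= => /cdf.
split; first by apply: continuous_compact_integrable => //; exact: segment_compact.
rewrite /Rintegral (@continuous_FTC2 R df f a b)//.
- exact: (der_LR fd ab).
- by move=> x; rewrite in_itv/= => /andP[ax xb]; apply: derive1_is; apply: fd; rewrite !ltW.
Qed.

Lemma ibp f df phi a b : a < b ->
  (forall x, a <= x <= b -> is_derive x 1 f (df x)) ->
  (forall x, a <= x <= b -> {for x, continuous df}) ->
  (forall x, derivable phi x 1) -> continuous (derive1 phi) ->
  phi a = 0 -> phi b = 0 ->
  \int[leb]_(x in `]a, b[) (f x * derive1 phi x) =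
  - \int[leb]_(x in `]a, b[) (df x * phi x).
Proof.
move=> ab fd cdf dphi cphi pa pb.
have pd x : is_derive x 1 phi (derive1 phi x).
  by rewrite derive1E; apply: DeriveDef.
have cf x : a <= x <= b -> {for x, continuous f} by move=> /fd /der_cts_at.
have cp : continuous phi by exact: derive_cts pd.
have ci f1 f2 : (forall x, a <= x <= b -> {for x, continuous f1}) -> continuous f2 ->
    intg `[a, b] (fun x => f1 x * f2 x).
  move=> c1 c2; apply: continuous_compact_integrable; first exact: segment_compact.
  apply: continuous_in_subspaceT => x /set_mem /=; rewrite in_itv/= => xab.
  by apply: cvgM; [exact: c1|exact: c2].
rewrite Rint_oo_cc; last exact: ci.
rewrite Rint_oo_cc; last exact: ci.
rewrite (@Rintegration_by_parts _ f phi df (derive1 phi) a b ab); first last.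
- by move=> x _.
- exact: (der_LR (fun x _ => pd x) ab).
- exact: continuous_subspaceT.
- by move=> x; rewrite in_itv/= => /andP[ax xb]; apply: derive1_is; apply: fd; rewrite !ltW.
- exact: (der_LR fd ab).
- by apply: continuous_in_subspaceT => x /set_mem /=; rewrite in_itv/= => /cdf.
- by rewrite pa pb !mulr0 subrr sub0r.
Qed.

Lemma two_sided_disj a b : 0 < a -> [disjoint `]- b, - a[%classic & `]a, b[%classic : set R].
Proof.
move=> a0; apply/disj_setPS => y [/=]; rewrite !in_itv/= => /andP[_ h1] /andP[h2 _].
lra.
Qed.

Lemma wd_classic f df a b : 0 < a -> a < b ->
  (forall x, a <= `|x| <= b -> is_derive x 1 f (df x)) ->
  (forall x, a <= `|x| <= b -> {for x, continuous df}) ->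
  L2 (two_sided a b) f -> L2 (two_sided a b) df -> is_weak_deriv (two_sided a b) f df.
Proof.
move=> a0 ab fd cdf Lf Ldf phi tphi.
have [Lp Ldp] := test_L2 (@mble_two_sided a b) (two_sided_sub a0) tphi.
have mI (i : interval R) : mble [set` i] by exact: mble_itv.
have setU F : intg (two_sided a b) F -> \int[leb]_(x in two_sided a b) F x =
    \int[leb]_(x in `]- b, - a[) F x + \int[leb]_(x in `]a, b[) F x.
  by move=> Fi; apply: (Rintegral_setU (mI _) (mI _) Fi (two_sided_disj b a0)).
have mE := @mble_two_sided a b.
rewrite setU; last exact: L2_int_mul.
rewrite [in RHS]setU; last exact: L2_int_mul.
have [dphi cphi _] := tphi.
have out x : ~ two_sided a b x -> phi x = 0 by move=> /(test_out tphi)[].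
have nab : - b < - a by rewrite ltrN2.
have pz x : `|x| = a \/ `|x| = b -> phi x = 0.
  move=> xab; apply: out; rewrite /two_sided /= !in_itv/= => -[|] /andP[h1 h2].
    by move: xab; rewrite ler0_norm; [case; lra|lra].
  by move: xab; rewrite ger0_norm; [case; lra|lra].
have nl x : - b <= x <= - a -> a <= `|x| <= b.
  by move=> /andP[x1 x2]; rewrite ler0_norm; [apply/andP; split|]; lra.
have nr x : a <= x <= b -> a <= `|x| <= b.
  by move=> /andP[x1 x2]; rewrite ger0_norm ?x1//; lra.
rewrite (ibp nab (fun x h => fd x (nl x h)) (fun x h => cdf x (nl x h)) dphi cphi);
  [|by apply: pz; rewrite normrN gtr0_norm; [right|lra]
   |by apply: pz; rewrite normrN gtr0_norm; [left|lra]].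
rewrite (ibp ab (fun x h => fd x (nr x h)) (fun x h => cdf x (nr x h)) dphi cphi);
  [|by apply: pz; rewrite gtr0_norm; [left|lra]
   |by apply: pz; rewrite gtr0_norm; [right|lra]].
by rewrite opprD.
Qed.

(** Used to prove that a function orthogonal to a dense set vanishes. *)
Lemma n2_dual D f g : mble D -> L2 D f -> L2 D g ->
  \int[leb]_(x in D) (f x * g x) = 0 -> n2 D f <= n2 D (fun x => f x - g x).
Proof.
move=> mD Lf Lg fg0.
have Lfg := L2B mD Lf Lg.
have e : \int[leb]_(x in D) (f x * (f x - g x)) = n2 D f.
  under eq_Rintegral do rewrite mulrBr.
  rewrite RintegralB//; [|exact: L2_int_mul|exact: L2_int_mul].
  by rewrite fg0 subr0; apply: eq_Rintegral => x _; rewrite expr2.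
have := cauchy_schwarz mD Lf Lfg; rewrite e expr2.
have := n2_ge0 D f; rewrite le_eqVlt => /orP[/eqP <- _|f0]; first exact: n2_ge0.
by rewrite ler_pM2l.
Qed.

(** The difference of two weak derivatives is orthogonal to the test functions,
    which are dense by [dense_C1c]. *)
Lemma wd_unique f dg df a b : a < b -> L2 `]a, b[ df -> L2 `]a, b[ dg ->
  is_weak_deriv `]a, b[ f df -> is_weak_deriv `]a, b[ f dg ->
  df = dg %[ae leb in `]a, b[%classic].
Proof.
move=> ab Ldf Ldg w1 w2; set D : set R := `]a, b[%classic.
have mD : mble D by exact: mble_itv.
have Dab : D `<=` `[a, b] by exact: subset_itv_oo_cc.
have Ld := L2B mD Ldf Ldg; set h := (fun x => _) in Ld.
have n0 : n2 D h = 0.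
  apply/eqP; rewrite eq_le n2_ge0 andbT leNgt; apply/negP => h0.
  have [phi [dphi [a' [b' [[aa bb] pd cp sp npsi]]]]] := dense_C1c ab Ld h0.
  have tp : test_function D phi by exact: supp_test pd cp sp aa bb.
  have [Lp Ldp] := test_L2 mD Dab tp.
  have := n2_dual mD Ld Lp; rewrite leNgt npsi => H.
  suff /H : \int[leb]_(x in D) (h x * phi x) = 0 by [].
  under eq_Rintegral do rewrite mulrBl.
  rewrite RintegralB//; [|exact: L2_int_mul|exact: L2_int_mul].
  have := w1 _ tp; rewrite w2// => /eqP; rewrite eqr_opp => /eqP ->.
  exact: subrr.
apply: (ae_eq_imp _ (n2_eq0 mD Ld n0)) => x _ /eqP.
by rewrite subr_eq0 => /eqP.
Qed.

Lemma wd_unique_two_sided f dg df a b : a < b -> L2 (two_sided a b) df -> L2 (two_sided a b) dg ->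
  is_weak_deriv (two_sided a b) f df -> is_weak_deriv (two_sided a b) f dg ->
  df = dg %[ae leb in two_sided a b].
Proof.
move=> ab Ldf Ldg w1 w2.
have mI (i : interval R) : mble [set` i] by exact: mble_itv.
have mE := @mble_two_sided a b.
have sl : `]- b, - a[ `<=` two_sided a b by move=> x ?; left.
have sr : `]a, b[ `<=` two_sided a b by move=> x ?; right.
have nab : - b < - a by rewrite ltrN2.
have /ae_eq_lebP [N [mN N0] hN] := wd_unique nab (L2S mE (mI _) sl Ldf)
  (L2S mE (mI _) sl Ldg) (wd_restrict mE (mI _) sl w1) (wd_restrict mE (mI _) sl w2).
have /ae_eq_lebP [M [mM M0] hM] := wd_unique ab (L2S mE (mI _) sr Ldf)
  (L2S mE (mI _) sr Ldg) (wd_restrict mE (mI _) sr w1) (wd_restrict mE (mI _) sr w2).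
apply/ae_eq_lebP; exists (N `|` M).
  split; first exact: measurableU.
  by apply: null_set_setU.
move=> x [xl|xr] NM; [apply: hN|apply: hM] => // h; apply: NM; [left|right] => //.
Qed.

Lemma supp_end f a b : continuous f -> supp_in a b f -> f a = 0 /\ f b = 0.
Proof.
move=> cf sf.
have key x : f x != 0 -> exists2 r : R, 0 < r & forall y, `|x - y| < r -> a <= y <= b.
  move=> fx.
  have h : 0 < `|f x| by rewrite normr_gt0.
  have c : `|f y| @[y --> x] --> `|f x| by apply: cvg_norm; exact: cf.
  have : \forall y \near x, 0 < `|f y| by exact: (cvgr_gt _ c).
  move=> /nbhs_ballP[r /= r0 rP]; exists r => // y xy; apply/negP => /negP yn.
  by have := rP y xy; rewrite sf ?normr0 ?ltxx//; exact/negP.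
split; apply/eqP/negPn/negP => /key[r r0 rP].
- have := rP (a - r / 2); rewrite opprB addrC subrK gtr0_norm; last lra.
  by move=> /(_ _)/andP[]; lra.
- have := rP (b + r / 2); rewrite opprD addNKr normrN gtr0_norm; last lra.
  by move=> /(_ _)/andP[]; lra.
Qed.

(** The lemma of du Bois-Reymond. Subtracting from a continuous function
    supported in the interval a multiple of a fixed bump makes its integral 0;
    its primitive is then a test function. So [h] minus its mean is orthogonal
    to such differences, and this forces its norm to vanish, because it is
    approximated by them. *)
Lemma wd0_const h a b : a < b -> L2 `]a, b[ h ->
  is_weak_deriv `]a, b[ h (fun=> 0) ->
  exists c, h = (fun=> c) %[ae leb in `]a, b[%classic].
Proof.
move=> ab Lh w; set D : set R := `]a, b[%classic.
have mD : mble D by exact: mble_itv.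
have fD : (leb D < +oo)%E by exact: leb_itv_fin.
have Dab : D `<=` `[a, b] by exact: subset_itv_oo_cc.
have lD : fine (leb D) = b - a.
  by rewrite lebesgue_measure_itv/= lte_fin ab -EFinB.
have ba : 0 < b - a by rewrite subr_gt0.
pose m := (\int[leb]_(x in D) h x) / (b - a).
have L1 (c : R) : L2 D (fun=> c).
  by apply: (L2_cts mD Dab); exact: cts_cst.
have hi := L2_integrable mD fD Lh.
have Lhm := L2B mD Lh (L1 m); set k := (fun x => h x - m) in Lhm.
have k0 : \int[leb]_(x in D) k x = 0.
  rewrite /k RintegralB//; last exact: integrable_cst.
  by rewrite Rintegral_cst// lD /m divfK ?subrr// gt_eqF.
(* small enough for the bump to equal 1 on a nonempty interval *)
pose e := (b - a) / 5.
have e0 : 0 < e by rewrite /e; lra.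
pose th := cutoff a b e.
have cth : continuous th by exact: cutoff_cts.
have Lth : L2 D th by exact: (L2_cts mD Dab).
have thi := L2_integrable mD fD Lth.
pose J := \int[leb]_(x in D) th x.
have lI : fine (leb `[a + 2 * e, b - 2 * e]) = b - a - 4 * e.
  have abe : a + 2 * e < b - 2 * e by rewrite /e; lra.
  by rewrite lebesgue_measure_itv/= lte_fin abe -EFinB/=; ring.
have J0 : 0 < J.
  rewrite (@lt_le_trans _ _ (\int[leb]_(x in `[a + 2 * e, b - 2 * e]) th x))//.
    rewrite (@lt_le_trans _ _ (\int[leb]_(x in `[a + 2 * e, b - 2 * e]) 1))//.
      rewrite Rintegral_cst; last exact: mble_itv.
      by rewrite mul1r lI /e; lra.
    rewrite le_eqVlt; apply/orP; left; apply/eqP; apply: eq_Rintegral => x /set_mem /=; rewrite in_itv/= => xI.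
    by rewrite /th cutoff1.
  rewrite /J [leLHS]Rintegral_mkcond [leRHS]Rintegral_mkcond.
  apply: le_Rint => //.
  - rewrite -restrict_EFin; apply/(integrable_mkcond _ _).1; first exact: mble_itv.
    apply: integrableS thi => //.
    by move=> x /=; rewrite /D /= !in_itv/= => /andP[? ?]; apply/andP; split; lra.
  - by rewrite -restrict_EFin; apply/(integrable_mkcond _ _).1.
  - move=> x _; rewrite /patch; case: ifPn => [/set_mem/=|_].
      rewrite in_itv/= => /andP[? ?]; rewrite ifT// mem_set// /D/= in_itv/=.
      by apply/andP; split; lra.
    by case: ifP => // _; exact: cutoff_ge0.
have tsupp : supp_in (a + e) (b - e) th by move=> x; exact: cutoff0.
have n0 : n2 D k = 0.
  apply/eqP; rewrite eq_le n2_ge0 andbT leNgt; apply/negP => h0.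
  pose C := 2 + 2 * ((b - a) / J ^+ 2 * n2 D th) + 1.
  have C0 : 0 < C.
    rewrite /C; have : 0 <= (b - a) / J ^+ 2 * n2 D th.
      by rewrite mulr_ge0 ?n2_ge0// divr_ge0 ?sqr_ge0// ltW.
    lra.
  have [psi [h1 h10 [cpsi spsi npsi]]] := dense_Cc ab Lhm (divr_gt0 h0 C0).
  have Lpsi : L2 D psi by exact: (L2_cts mD Dab).
  have psii := L2_integrable mD fD Lpsi.
  pose s := (\int[leb]_(x in D) psi x) / J.
  pose ps x := psi x - s * th x.
  have cps : continuous ps.
    by apply: cts_sub => //; apply: cts_mul => //; exact: cts_cst.
  pose e2 := Num.min e h1.
  have e20 : 0 < e2 by rewrite lt_min e0.
  have sps : supp_in (a + e2) (b - e2) ps.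
    move=> x xn; rewrite /ps spsi ?tsupp ?mulr0 ?subrr//.
      move=> /andP[? ?]; apply: xn; have : e2 <= e by rewrite ge_min lexx.
      by move=> ?; apply/andP; split; lra.
    move=> /andP[? ?]; apply: xn; have : e2 <= h1 by rewrite ge_min lexx orbT.
    by move=> ?; apply/andP; split; lra.
  have ps0 : \int[leb]_(x in D) ps x = 0.
    rewrite /ps RintegralB//; last exact: integrableZ'.
    by rewrite RintegralZl// /s divfK ?subrr// gt_eqF.
  have e2b : a + e2 <= b - e2.
    have : e2 <= e by rewrite ge_min lexx.
    by rewrite /e => ?; lra.
  have Pd := Prim_Cc_der cps sps.
  have sP : supp_in (a + e2) (b - e2) (Prim ps).
    move=> x xn; have [xb|xb] := ltP (b - e2) x.
      rewrite (Prim_right cps sps (ltW xb)) -Rint_oo_cc; last first.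
        apply: continuous_compact_integrable; first exact: segment_compact.
        exact: continuous_subspaceT.
      have sub : `](a + e2), (b - e2)[ `<=` D.
        by move=> y /=; rewrite /D/= !in_itv/= => /andP[? ?]; apply/andP; split; lra.
      have [cpsa cpsb] := supp_end cps sps.
      have := @Rint_shrink _ D _ ps mD (mble_itv _) sub; rewrite ps0 => <- //.
      move=> x0 _ /= xn0; have [xi|/negP xi] := boolP (a + e2 <= x0 <= b - e2); last exact: sps.
      move: xi; rewrite le_eqVlt => /andP[/orP[/eqP <-//|l1]].
      rewrite le_eqVlt => /orP[/eqP ->//|l2].
      by exfalso; apply: xn0; rewrite in_itv/= l1 l2.
    apply: (@Prim_left _ _ (a + e2)).
      by move=> t ta; apply: sps => /andP[+ _]; rewrite leNgt ta.
    by rewrite ltNge; apply/negP => xa; apply: xn; rewrite xa.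
  have tp : test_function D (Prim ps) by apply: (supp_test Pd cps sP); lra.
  have dP : derive1 (Prim ps) = ps by apply/funext => x; exact: derive1_is.
  have hps : \int[leb]_(x in D) (h x * ps x) = 0.
    have := w _ tp; rewrite dP => ->.
    under eq_Rintegral do rewrite mul0r.
    by rewrite Rintegral_cst// mul0r oppr0.
  have Lps : L2 D ps by exact: (L2_cts mD Dab).
  have kps : \int[leb]_(x in D) (k x * ps x) = 0.
    under eq_Rintegral do rewrite mulrBl.
    rewrite RintegralB//; [|exact: L2_int_mul|exact: L2_int_mul].
    rewrite hps RintegralZl//; last exact: L2_integrable.
    by rewrite ps0 mulr0 subrr.
  have := n2_dual mD Lhm Lps kps.
  have -> : (fun x => k x - ps x) = (fun x => (k x - psi x) + s * th x).
    by apply/funext => x; rewrite /ps; ring.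
  have := n2D_le mD (L2B mD Lhm Lpsi) (L2Z s mD Lth).
  rewrite n2Z//.
  have s2 : s ^+ 2 * n2 D th <= (b - a) / J ^+ 2 * n2 D th * (n2 D k / C).
    rewrite [leRHS]mulrAC; apply: ler_wpM2r; first exact: n2_ge0.
    rewrite /s expr_div_n [leRHS]mulrAC; apply: ler_wpM2r; first by rewrite invr_ge0 sqr_ge0.
    have -> : \int[leb]_(x in D) psi x = - \int[leb]_(x in D) (k x - psi x).
      rewrite RintegralB//; last exact: L2_integrable.
      by rewrite k0 sub0r opprK.
    rewrite sqrrN -lD (le_trans (int_sqr_le mD fD (L2B mD Lhm Lpsi)))//.
    by rewrite lD ler_wpM2l ?(ltW ba)// ltW.
  move=> u1 u2.
  have : n2 D k <= (C - 1) * (n2 D k / C).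
    rewrite /C; move: u1 u2 s2 npsi; set A := (_ - _) / _ * _.
    set n := n2 D k / _; lra.
  have -> : (C - 1) * (n2 D k / C) = n2 D k - n2 D k / C by field; rewrite gt_eqF.
  have : 0 < n2 D k / C by rewrite divr_gt0.
  lra.
exists m; apply: (ae_eq_imp _ (n2_eq0 mD Lhm n0)) => x _ /eqP.
by rewrite subr_eq0 => /eqP.
Qed.

Lemma ae_eq_cts D f g : open D -> {in D, continuous f} -> {in D, continuous g} ->
  f = g %[ae leb in D] -> forall x, D x -> f x = g x.
Proof.
move=> oD cf cg /ae_eq_lebP [N [mN N0] fgN] x Dx.
apply/eqP/negPn/negP => fgx.
have : \forall y \near x, D y /\ f y != g y.
  apply: filterI; first exact: open_nbhs_nbhs.
  have h : 0 < `|f x - g x| by rewrite normr_gt0 subr_eq0.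
  have c : `|f y - g y| @[y --> x] --> `|f x - g x|.
    by apply: cvg_norm; apply: cvgB; [apply: cf|apply: cg]; exact: mem_set.
  have : \forall y \near x, 0 < `|f y - g y| by exact: (cvgr_gt _ c).
  by apply: filterS => y; rewrite normr_gt0 subr_eq0.
move=> /nbhs_ballP[r /= r0 rP].
have sub : ball x r `<=` N.
  move=> y /rP[Dy fgy]; apply: contrapT => Ny.
  by move: fgy; rewrite fgN// eqxx.
have : (leb (ball x r) <= leb N)%E.
  by apply: le_measure; rewrite ?inE//; exact: measurable_ball.
rewrite lebesgue_measure_ball ?(ltW r0)// N0 lee_fin leNgt => /negP; apply.
by rewrite mulr2n addr_gt0.
Qed.

(** Continuous functions that are equal almost everywhere on an open set are
    equal there, so that the representative chosen by [trace] has the same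
    limit as [g]. *)
Lemma trace_cts D f g a : open D -> {in D, continuous g} ->
  {for a, continuous g} -> ProperFilter (within D (nbhs a)) ->
  f = g %[ae leb in D] -> trace D f a = g a.
Proof.
move=> oD cg cga pf fg.
have tg : is_trace D f a (g a).
  exists g; split => //.
    by rewrite continuous_open_subspace.
  by apply: cvg_within_filter; exact: cga.
rewrite /trace; case: xgetP => [y -> /= [gc [cgc fgc gcy]]|/(_ (g a))//].
move: cgc; rewrite continuous_open_subspace// => cgc.
have e x : D x -> gc x = g x.
  apply: (ae_eq_cts oD) => //.
  by apply: (ae_eq_imp2 _ fg fgc) => t _ <- <-.
apply: (@cvg_unique _ (@Rhausdorff R) (gc @ within D (nbhs a)) _ _ _ gcy).
have : g @ within D (nbhs a) --> g a by apply: cvg_within_filter; exact: cga.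
apply: cvg_trans; apply: near_eq_cvg.
have : \forall x \near within D (nbhs a), D x by exact: withinT.
by apply: filterS => x /e.
Qed.

Lemma open_two_sided a b : open (two_sided a b).
Proof. by apply: openU; exact: interval_open. Qed.

Lemma within_two_sided a b x : 0 < a -> a < b -> `|x| = a \/ `|x| = b ->
  ProperFilter (within (two_sided a b) (nbhs x)).
Proof.
move=> a0 ab xab; apply: Build_ProperFilter_ex => A /nbhs_ballP[r /= r0 rA].
pose s := Num.min r (b - a) / 2.
have s0 : 0 < s by rewrite divr_gt0// lt_min r0 subr_gt0.
have m1 : Num.min r (b - a) <= r by rewrite ge_min lexx.
have m2 : Num.min r (b - a) <= b - a by rewrite ge_min lexx orbT.
have sr : s < r by rewrite /s; lra.
have sb : s < b - a by rewrite /s; lra.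
case: xab; case: (ger0P x) => x0 xE.
- exists (x + s); apply: rA; first by rewrite /ball/= opprD addNKr normrN gtr0_norm.
  by right; rewrite /= in_itv/=; apply/andP; split; lra.
- exists (x - s); apply: rA; first by rewrite /ball/= opprB addrC subrK gtr0_norm.
  by left; rewrite /= in_itv/=; apply/andP; split; lra.
- exists (x - s); apply: rA; first by rewrite /ball/= opprB addrC subrK gtr0_norm.
  by right; rewrite /= in_itv/=; apply/andP; split; lra.
- exists (x + s); apply: rA; first by rewrite /ball/= opprD addNKr normrN gtr0_norm.
  by left; rewrite /= in_itv/=; apply/andP; split; lra.
Qed.

End WeakDeriv.

(** * The state space as a real inner product space *)

Section States.
Context {R : realType} (p : params R).
Implicit Types (D : set R) (z w y : state R) (a b c t : R).

Lemma Re_mulc (x y : R[i]) : Re (x * y) = Re x * Re y - Im x * Im y.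
Proof. by case: x => a b; case: y => c d. Qed.

Lemma Im_mulc (x y : R[i]) : Im (x * y) = Re x * Im y + Im x * Re y.
Proof. by case: x => a b; case: y => c d. Qed.

Lemma Re_mulconj (x y : R[i]) : Re (x * y^*) = Re x * Re y + Im x * Im y.
Proof. by case: x => a b; case: y => c d /=; ring. Qed.

Lemma Re_realM a (x : R[i]) : Re (a%:C * x) = a * Re x.
Proof. by case: x => c d /=; ring. Qed.

Lemma Im_realM a (x : R[i]) : Im (a%:C * x) = a * Im x.
Proof. by case: x => c d /=; ring. Qed.

Lemma ReD (x y : R[i]) : Re (x + y) = Re x + Re y.
Proof. by case: x => a b; case: y. Qed.

Lemma ImD (x y : R[i]) : Im (x + y) = Im x + Im y.
Proof. by case: x => a b; case: y. Qed.

Lemma ReN (x : R[i]) : Re (- x) = - Re x. Proof. by case: x. Qed.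
Lemma ImN (x : R[i]) : Im (- x) = - Im x. Proof. by case: x. Qed.

Lemma complexP (x y : R[i]) : Re x = Re y -> Im x = Im y -> x = y.
Proof. by case: x => a b; case: y => c d /= -> ->. Qed.

Lemma Re_L2inner D (f g : R -> R[i]) : Re (L2inner D f g) =
  \int[leb]_(x in D) (Re (f x) * Re (g x) + Im (f x) * Im (g x)).
Proof. by apply: eq_Rintegral => x _; rewrite Re_mulconj. Qed.

Lemma zetaD z w : zeta (z + w) = (fun x => zeta z x + zeta w x). Proof. by []. Qed.
Lemma qD z w : q_ (z + w) = (fun x => q_ z x + q_ w x). Proof. by []. Qed.
Lemma qiD z w : qi (z + w) = qi z + qi w. Proof. by []. Qed.
Lemma deltaD z w : delta (z + w) = delta z + delta w. Proof. by []. Qed.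
Lemma etaD z w : eta (z + w) = eta z + eta w. Proof. by []. Qed.
Lemma zetaN z : zeta (- z) = (fun x => - zeta z x). Proof. by []. Qed.
Lemma qN z : q_ (- z) = (fun x => - q_ z x). Proof. by []. Qed.
Lemma qiN z : qi (- z) = - qi z. Proof. by []. Qed.
Lemma deltaN z : delta (- z) = - delta z. Proof. by []. Qed.
Lemma etaN z : eta (- z) = - eta z. Proof. by []. Qed.
Lemma zetaZ (k : R[i]) z : zeta (k *: z) = (fun x => k * zeta z x). Proof. by []. Qed.
Lemma qZ (k : R[i]) z : q_ (k *: z) = (fun x => k * q_ z x). Proof. by []. Qed.
Lemma qiZ (k : R[i]) z : qi (k *: z) = k * qi z. Proof. by []. Qed.
Lemma deltaZ (k : R[i]) z : delta (k *: z) = k * delta z. Proof. by []. Qed.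
Lemma etaZ (k : R[i]) z : eta (k *: z) = k * eta z. Proof. by []. Qed.

Definition stE := (zetaD, qD, qiD, deltaD, etaD, zetaN, qN, qiN, deltaN, etaN,
  zetaZ, qZ, qiZ, deltaZ, etaZ).

Lemma stateP z w : zeta z = zeta w -> q_ z = q_ w -> qi z = qi w ->
  delta z = delta w -> eta z = eta w -> z = w.
Proof.
by case: z => [[[[a b] c] d] e]; case: w => [[[[a' b'] c'] d'] e'];
  rewrite /zeta /q_ /qi /delta /eta /= => -> -> -> -> ->.
Qed.

Local Notation E := (Edom p).
Local Notation k1 := (rho p * grav p / 2).
Local Notation k2 := (rho p / (2 * h0 p)).
Local Notation k3 := (rho p * halfl p * alpha_ p).
Local Notation k4 := (rho p * grav p * halfl p).
Local Notation k5 := (M_ p / 2).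

(** The real part determines the inner product, by [Im_innerX], and spares most
    of the complex arithmetic. *)
Definition rip z w := Re (innerX p z w).
(** The volume constraint is left out: the inner product does not need it, and
    for values of the operator it has to be proved separately. *)
Definition preX z := cL2 E (zeta z) /\ cL2 E (q_ z).

Lemma mble_E : mble E.
Proof. by apply: measurableU; exact: mble_itv. Qed.
Hint Resolve mble_E : core.

Lemma ripE z w : rip z w =
  k1 * (\int[leb]_(x in E) (Re (zeta z x) * Re (zeta w x) + Im (zeta z x) * Im (zeta w x)))
  + k2 * (\int[leb]_(x in E) (Re (q_ z x) * Re (q_ w x) + Im (q_ z x) * Im (q_ w x)))
  + k3 * (Re (qi z) * Re (qi w) + Im (qi z) * Im (qi w))
  + k4 * (Re (delta z) * Re (delta w) + Im (delta z) * Im (delta w))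
  + k5 * (Re (eta z) * Re (eta w) + Im (eta z) * Im (eta w)).
Proof. by rewrite /rip /innerX !ReD !Re_realM !Re_L2inner !Re_mulconj. Qed.

Lemma lin5 (c1 c2 c3 c4 c5 a1 a2 a3 a4 a5 b1 b2 b3 b4 b5 : R) :
  a1 = b1 -> a2 = b2 -> a3 = b3 -> a4 = b4 -> a5 = b5 ->
  c1 * a1 + c2 * a2 + c3 * a3 + c4 * a4 + c5 * a5 =
  c1 * b1 + c2 * b2 + c3 * b3 + c4 * b4 + c5 * b5.
Proof. by move=> -> -> -> -> ->. Qed.

Lemma rip_sym z w : rip z w = rip w z.
Proof.
rewrite !ripE; apply: lin5.
- by apply: eq_Rintegral => x _; congr (_ + _); rewrite mulrC.
- by apply: eq_Rintegral => x _; congr (_ + _); rewrite mulrC.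
- by congr (_ + _); rewrite mulrC.
- by congr (_ + _); rewrite mulrC.
- by congr (_ + _); rewrite mulrC.
Qed.

Lemma Im_innerX z w : Im (innerX p z w) = rip z ('i *: w).
Proof.
rewrite ripE /innerX !ImD !Im_realM !stE.
apply: lin5.
- apply: eq_Rintegral => x _; case: (zeta z x) => a b; case: (zeta w x) => c d /=; ring.
- apply: eq_Rintegral => x _; case: (q_ z x) => a b; case: (q_ w x) => c d /=; ring.
- by case: (qi z) => a b; case: (qi w) => c d /=; ring.
- by case: (delta z) => a b; case: (delta w) => c d /=; ring.
- by case: (eta z) => a b; case: (eta w) => c d /=; ring.
Qed.

Lemma cL2D D (f g : R -> R[i]) : mble D -> cL2 D f -> cL2 D g ->
  cL2 D (fun x => f x + g x).
Proof.
move=> mD [f1 f2] [g1 g2]; split.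
- by have := L2D mD f1 g1; congr L2; apply/funext => x; rewrite ReD.
- by have := L2D mD f2 g2; congr L2; apply/funext => x; rewrite ImD.
Qed.

Lemma cL2Z D (k : R[i]) (f : R -> R[i]) : mble D -> cL2 D f -> cL2 D (fun x => k * f x).
Proof.
move=> mD [f1 f2]; split.
- have := L2B mD (L2Z (Re k) mD f1) (L2Z (Im k) mD f2).
  by congr L2; apply/funext => x; rewrite Re_mulc.
- have := L2D mD (L2Z (Re k) mD f2) (L2Z (Im k) mD f1).
  by congr L2; apply/funext => x; rewrite Im_mulc.
Qed.

Lemma preXD z w : preX z -> preX w -> preX (z + w).
Proof. by move=> [z1 z2] [w1 w2]; split; rewrite !stE; exact: cL2D. Qed.

Lemma preXZ (k : R[i]) z : preX z -> preX (k *: z).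
Proof. by move=> [z1 z2]; split; rewrite !stE; exact: cL2Z. Qed.

Lemma preXN z : preX z -> preX (- z).
Proof. by rewrite -scaleN1r; exact: preXZ. Qed.

Lemma preXB z w : preX z -> preX w -> preX (z - w).
Proof. by move=> ? ?; apply: preXD => //; exact: preXN. Qed.

Lemma X_preX z : spaceX p z -> preX z.
Proof. by case. Qed.

Lemma cL2_int_mul D (f g : R -> R[i]) : mble D -> cL2 D f -> cL2 D g ->
  intg D (fun x => Re (f x) * Re (g x) + Im (f x) * Im (g x)).
Proof.
by move=> mD [f1 f2] [g1 g2]; apply: integrableD' => //; exact: L2_int_mul.
Qed.

Lemma ripDl z z' w : preX z -> preX z' -> preX w ->
  rip (z + z') w = rip z w + rip z' w.
Proof.
move=> [z1 z2] [z1' z2'] [w1 w2]; rewrite !ripE !stE !(ReD, ImD).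
have -> : \int[leb]_(x in E) (Re (zeta z x + zeta z' x) * Re (zeta w x) +
     Im (zeta z x + zeta z' x) * Im (zeta w x)) =
  \int[leb]_(x in E) (Re (zeta z x) * Re (zeta w x) + Im (zeta z x) * Im (zeta w x)) +
  \int[leb]_(x in E) (Re (zeta z' x) * Re (zeta w x) + Im (zeta z' x) * Im (zeta w x)).
  rewrite -RintegralD//; [|exact: cL2_int_mul|exact: cL2_int_mul].
  by apply: eq_Rintegral => x _; rewrite ReD ImD; ring.
have -> : \int[leb]_(x in E) (Re (q_ z x + q_ z' x) * Re (q_ w x) +
     Im (q_ z x + q_ z' x) * Im (q_ w x)) =
  \int[leb]_(x in E) (Re (q_ z x) * Re (q_ w x) + Im (q_ z x) * Im (q_ w x)) +
  \int[leb]_(x in E) (Re (q_ z' x) * Re (q_ w x) + Im (q_ z' x) * Im (q_ w x)).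
  rewrite -RintegralD//; [|exact: cL2_int_mul|exact: cL2_int_mul].
  by apply: eq_Rintegral => x _; rewrite ReD ImD; ring.
ring.
Qed.

Lemma ripZl a z w : preX z -> preX w -> rip (a%:C *: z) w = a * rip z w.
Proof.
move=> [z1 z2] [w1 w2]; rewrite !ripE !stE !(Re_realM, Im_realM).
have -> : \int[leb]_(x in E) (Re (a%:C * zeta z x) * Re (zeta w x) +
     Im (a%:C * zeta z x) * Im (zeta w x)) =
  a * \int[leb]_(x in E) (Re (zeta z x) * Re (zeta w x) + Im (zeta z x) * Im (zeta w x)).
  rewrite -RintegralZl//; last exact: cL2_int_mul.
  by apply: eq_Rintegral => x _; rewrite Re_realM Im_realM; ring.
have -> : \int[leb]_(x in E) (Re (a%:C * q_ z x) * Re (q_ w x) +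
     Im (a%:C * q_ z x) * Im (q_ w x)) =
  a * \int[leb]_(x in E) (Re (q_ z x) * Re (q_ w x) + Im (q_ z x) * Im (q_ w x)).
  rewrite -RintegralZl//; last exact: cL2_int_mul.
  by apply: eq_Rintegral => x _; rewrite Re_realM Im_realM; ring.
ring.
Qed.

Lemma oppE z : - z = (-1)%:C *: z.
Proof. by rewrite -scaleN1r; congr (_ *: _); apply: complexP; rewrite /= ?oppr0. Qed.

Lemma ripNl z w : preX z -> preX w -> rip (- z) w = - rip z w.
Proof.
move=> hz hw; rewrite oppE.
by rewrite ripZl// mulN1r.
Qed.

Lemma ripBl z z' w : preX z -> preX z' -> preX w ->
  rip (z - z') w = rip z w - rip z' w.
Proof. by move=> ? ? ?; rewrite ripDl ?ripNl//; exact: preXN. Qed.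

Lemma ripDr z w w' : preX z -> preX w -> preX w' ->
  rip z (w + w') = rip z w + rip z w'.
Proof. by move=> ? ? ?; rewrite rip_sym ripDl// !(rip_sym z). Qed.

Lemma ripZr a z w : preX z -> preX w -> rip z (a%:C *: w) = a * rip z w.
Proof. by move=> ? ?; rewrite rip_sym ripZl// (rip_sym z). Qed.

Lemma ripBr z w w' : preX z -> preX w -> preX w' ->
  rip z (w - w') = rip z w - rip z w'.
Proof. by move=> ? ? ?; rewrite rip_sym ripBl// !(rip_sym z). Qed.

Lemma rip_self z : preX z -> rip z z =
  k1 * (n2 E (fun x => Re (zeta z x)) + n2 E (fun x => Im (zeta z x)))
  + k2 * (n2 E (fun x => Re (q_ z x)) + n2 E (fun x => Im (q_ z x)))
  + k3 * (Re (qi z) ^+ 2 + Im (qi z) ^+ 2)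
  + k4 * (Re (delta z) ^+ 2 + Im (delta z) ^+ 2)
  + k5 * (Re (eta z) ^+ 2 + Im (eta z) ^+ 2).
Proof.
move=> [[z1 z2] [z3 z4]]; rewrite ripE; apply: lin5; rewrite ?expr2//.
- rewrite RintegralD//; exact: L2_int_mul.
- rewrite RintegralD//; exact: L2_int_mul.
Qed.

Hypothesis adm : admissible p.

Lemma g_gt0 : 0 < grav p. Proof. by case: adm => [[]]. Qed.
Lemma rho_gt0 : 0 < rho p. Proof. by case: adm => [[]]. Qed.
Lemma h0_gt0 : 0 < h0 p. Proof. by case: adm => [[]]. Qed.
Lemma l_gt0 : 0 < halfl p. Proof. by case: adm => _ []. Qed.

Lemma M_gt0 : 0 < M_ p.
Proof.
have [_ _ hpos _ m0] := adm; rewrite /M_; apply: ltr_wpDr => //.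
apply: Rintegral_ge0 => x /= xI; have [h _] := hpos x xI.
by rewrite mulr_ge0 ?invr_ge0 ?(ltW h)// mulr_ge0 ?sqr_ge0// ltW ?rho_gt0.
Qed.

(** A nonnegative function with integral 0 vanishes almost everywhere, whereas
    the integrand is positive. *)
Lemma alpha_gt0 : 0 < alpha_ p.
Proof.
have l0 := l_gt0; have [_ _ hpos [_ ih _] _] := adm.
rewrite /alpha_ mulr_gt0// ?invr_gt0 ?mulr_gt0//.
rewrite lt_neqAle; apply/andP; split; last first.
  by apply: Rintegral_ge0 => x /= xI; have [h _] := hpos x xI; rewrite invr_ge0 ltW.
apply/eqP => e.
pose I : set R := `[- halfl p, halfl p]%classic.
have mI : mble I by exact: mble_itv.
have : (\int[leb]_(x in I) `|((heq p x)^-1)%:E| = 0)%E.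
  rewrite (@eq_integral _ _ _ _ _ (fun x : measurableTypeR R => ((heq p x)^-1)%:E)); last first.
    move=> x /set_mem/= xI; have [h _] := hpos x xI.
    by rewrite /= ger0_norm// invr_ge0 ltW.
  have fi := integrable_fin_num mI ih.
  by rewrite -(fineK fi); congr EFin; exact: esym e.
move=> /(ae_eq_integral_abs _ mI (measurable_int _ ih)).
move=> /ae_eq_lebP [N [mN N0] hN].
have sub : I `<=` N.
  move=> x xI; apply: contrapT => Nx; have := hN x xI Nx.
  have [h _] := hpos x xI; rewrite /cst => -[] /eqP.
  by rewrite invr_eq0 gt_eqF.
have : (leb I <= leb N)%E.
  by apply: le_measure; rewrite ?inE.
rewrite N0 lebesgue_measure_itv/= lte_fin ifT; last lra.
by rewrite -EFinB lee_fin; lra.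
Qed.

Lemma k1_gt0 : 0 < k1. Proof. by rewrite divr_gt0// mulr_gt0 ?rho_gt0 ?g_gt0. Qed.
Lemma k2_gt0 : 0 < k2. Proof. by rewrite divr_gt0 ?mulr_gt0 ?rho_gt0 ?h0_gt0. Qed.
Lemma k3_gt0 : 0 < k3. Proof. exact: (mulr_gt0 (mulr_gt0 rho_gt0 l_gt0) alpha_gt0). Qed.
Lemma k4_gt0 : 0 < k4. Proof. exact: (mulr_gt0 (mulr_gt0 rho_gt0 g_gt0) l_gt0). Qed.
Lemma k5_gt0 : 0 < k5. Proof. exact: (divr_gt0 M_gt0). Qed.

Lemma rip_ge0 z : preX z -> 0 <= rip z z.
Proof.
move=> hz; rewrite rip_self//.
by rewrite !addr_ge0// mulr_ge0 ?addr_ge0 ?n2_ge0 ?sqr_ge0// ltW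
  ?k1_gt0 ?k2_gt0 ?k3_gt0 ?k4_gt0 ?k5_gt0.
Qed.

Lemma normX_sqr z : preX z -> normX p z ^+ 2 = rip z z.
Proof. by move=> hz; rewrite /normX sqr_sqrtr// rip_ge0. Qed.

Lemma normX_ge0 z : 0 <= normX p z.
Proof. exact: sqrtr_ge0. Qed.

Lemma rip_CS z w : preX z -> preX w -> `|rip z w| <= normX p z * normX p w.
Proof.
move=> hz hw; rewrite -sqrtrM ?rip_ge0//.
rewrite -sqrtr_sqr ler_sqrt ?mulr_ge0 ?rip_ge0//.
rewrite -/(rip z z) -/(rip w w).
have key k : 0 <= rip z z + k ^+ 2 * rip w w + 2 * k * rip z w.
  have hk := preXZ k%:C hw.
  have := rip_ge0 (preXD hz hk).
  rewrite ripDl ?ripDr ?ripZl ?ripZr ?(rip_sym w z)//; last exact: preXD.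
  by congr (_ <= _); ring.
have [w0|w0] := eqVneq (rip w w) 0.
  move: key; rewrite w0 => key.
  have [->|I0] := eqVneq (rip z w) 0; first by rewrite expr0n mulr0.
  have := key (- (rip z z + 1) / (2 * rip z w)).
  have -> : 2 * (- (rip z z + 1) / (2 * rip z w)) * rip z w = - (rip z z + 1) by field.
  by rewrite !mulr0; lra.
have gp : 0 < rip w w by rewrite lt_neqAle eq_sym w0 rip_ge0.
have := key (- rip z w / rip w w).
have -> : rip z z + (- rip z w / rip w w) ^+ 2 * rip w w + 2 * (- rip z w / rip w w) * rip z w
  = (rip z z * rip w w - rip z w ^+ 2) / rip w w by field.
by rewrite pmulr_lge0 ?invr_gt0// subr_ge0.
Qed.

Lemma normX_triangle z w : preX z -> preX w -> normX p (z + w) <= normX p z + normX p w.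
Proof.
move=> hz hw; rewrite -(@ler_pXn2r _ 2)// ?nnegrE ?addr_ge0 ?normX_ge0//.
rewrite normX_sqr; last exact: preXD.
rewrite ripDl ?ripDr ?(rip_sym w z)//; last exact: preXD.
rewrite sqrrD !normX_sqr//.
have := le_trans (ler_norm _) (rip_CS hz hw).
lra.
Qed.

Lemma normXZ a z : preX z -> normX p (a%:C *: z) = `|a| * normX p z.
Proof.
move=> hz; rewrite /normX -!/(rip _ _) ripZl ?ripZr//; last exact: preXZ.
by rewrite mulrA -expr2 sqrtrM ?sqr_ge0// sqrtr_sqr.
Qed.

Lemma normXN z : preX z -> normX p (- z) = normX p z.
Proof.
move=> hz; rewrite oppE.
by rewrite normXZ// normrN normr1 mul1r.
Qed.

Lemma cae (D : set R) (f g : R -> R[i]) : f = g %[ae leb in D] ->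
  (fun x => Re (f x)) = (fun x => Re (g x)) %[ae leb in D] /\
  (fun x => Im (f x)) = (fun x => Im (g x)) %[ae leb in D].
Proof.
by move=> e; split; apply: (ae_eq_imp _ e) => x _ ->.
Qed.

Lemma cae_conj (D : set R) (f g : R -> R[i]) :
  (fun x => Re (f x)) = (fun x => Re (g x)) %[ae leb in D] ->
  (fun x => Im (f x)) = (fun x => Im (g x)) %[ae leb in D] ->
  f = g %[ae leb in D].
Proof.
by move=> e1 e2; apply: (ae_eq_imp2 _ e1 e2) => x _; exact: complexP.
Qed.

Lemma rip_eql z z' w : preX z -> preX z' -> preX w -> eq_state p z z' ->
  rip z w = rip z' w.
Proof.
move=> [[z1 z2] [z3 z4]] [[y1 y2] [y3 y4]] [[w1 w2] [w3 w4]] [e1 e2 e3 e4 e5].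
rewrite !ripE e3 e4 e5; apply: lin5 => //.
- apply: Rint_ae => //.
  + apply: measurable_funD; apply: measurable_funM; by [exact: z1.1|exact: z2.1|exact: w1.1|exact: w2.1].
  + apply: measurable_funD; apply: measurable_funM; by [exact: y1.1|exact: y2.1|exact: w1.1|exact: w2.1].
  + by apply: (ae_eq_imp _ e1) => x _ ->.
- apply: Rint_ae => //.
  + apply: measurable_funD; apply: measurable_funM; by [exact: z3.1|exact: z4.1|exact: w3.1|exact: w4.1].
  + apply: measurable_funD; apply: measurable_funM; by [exact: y3.1|exact: y4.1|exact: w3.1|exact: w4.1].
  + by apply: (ae_eq_imp _ e2) => x _ ->.
Qed.

Lemma rip_eqr z w w' : preX z -> preX w -> preX w' -> eq_state p w w' ->
  rip z w = rip z w'.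
Proof. by move=> hz hw hw' e; rewrite rip_sym (rip_eql _ hw') // rip_sym. Qed.

Lemma normX_eq z z' : preX z -> preX z' -> eq_state p z z' -> normX p z = normX p z'.
Proof.
move=> hz hz' e; rewrite /normX -!/(rip _ _) (rip_eql hz hz')//.
by rewrite (rip_eqr hz' hz hz').
Qed.

Lemma eq_state_sym z w : eq_state p z w -> eq_state p w z.
Proof.
move=> [e1 e2 e3 e4 e5]; split; last by rewrite e5.
- by apply: (ae_eq_imp _ e1) => x Dx h; rewrite h.
- by apply: (ae_eq_imp _ e2) => x Dx h; rewrite h.
- by rewrite e3.
- by rewrite e4.
Qed.

Lemma eq_state_refl z : eq_state p z z.
Proof.
by split => //; apply/ae_eq_lebP; exists set0 => //; split => //; exact: measure0.
Qed.

Lemma add_pair_eq0 c A B r : 0 < c -> 0 <= A -> 0 <= B -> 0 <= r ->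
  r + c * (A + B) = 0 -> [/\ r = 0, A = 0 & B = 0].
Proof.
move=> c0 A0 B0 r0 e.
have AB0 : 0 <= A + B by exact: addr_ge0.
have cAB : 0 <= c * (A + B) by exact: mulr_ge0 (ltW c0) AB0.
have : c * (A + B) = 0 by lra.
move=> /eqP; rewrite mulf_eq0 (gt_eqF c0)/= => /eqP AB.
by split; lra.
Qed.

Lemma lin5_eq0 c1 c2 c3 c4 c5 a1 a2 a3 a4 a5 a6 a7 a8 a9 a10 :
  0 < c1 -> 0 < c2 -> 0 < c3 -> 0 < c4 -> 0 < c5 ->
  0 <= a1 -> 0 <= a2 -> 0 <= a3 -> 0 <= a4 -> 0 <= a5 -> 0 <= a6 -> 0 <= a7 ->
  0 <= a8 -> 0 <= a9 -> 0 <= a10 ->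
  c1 * (a1 + a2) + c2 * (a3 + a4) + c3 * (a5 + a6) + c4 * (a7 + a8) + c5 * (a9 + a10) = 0 ->
  [/\ a1 = 0 /\ a2 = 0, a3 = 0 /\ a4 = 0, a5 = 0 /\ a6 = 0, a7 = 0 /\ a8 = 0 &
      a9 = 0 /\ a10 = 0].
Proof.
move=> C1 C2 C3 C4 C5 A1 A2 A3 A4 A5 A6 A7 A8 A9 A10.
have t1 : 0 <= c1 * (a1 + a2) by apply: mulr_ge0; [exact: ltW|exact: addr_ge0].
have t2 : 0 <= c2 * (a3 + a4) by apply: mulr_ge0; [exact: ltW|exact: addr_ge0].
have t3 : 0 <= c3 * (a5 + a6) by apply: mulr_ge0; [exact: ltW|exact: addr_ge0].
have t4 : 0 <= c4 * (a7 + a8) by apply: mulr_ge0; [exact: ltW|exact: addr_ge0].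
have s2 := addr_ge0 t1 t2; have s3 := addr_ge0 s2 t3; have s4 := addr_ge0 s3 t4.
move=> /(add_pair_eq0 C5 A9 A10 s4)[] /(add_pair_eq0 C4 A7 A8 s3)[].
move=> /(add_pair_eq0 C3 A5 A6 s2)[] /(add_pair_eq0 C2 A3 A4 t1)[] q12 q3 q4.
have := add_pair_eq0 C1 A1 A2 (lexx 0); rewrite add0r => /(_ q12)[_ q1 q2].
by [].
Qed.

(** All weights in the norm are positive, so that every component of [z - w]
    has norm 0. *)
Lemma normX0_eq z w : preX z -> preX w -> normX p (z - w) = 0 -> eq_state p z w.
Proof.
move=> hz hw n0; have hzw := preXB hz hw.
have := normX_sqr hzw; rewrite n0 expr0n /= => /esym.
rewrite rip_self//.
have [[z1 z2] [z3 z4]] := hzw.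
have [[[[c1 c2] c3] c4] c5] := (k1_gt0, k2_gt0, k3_gt0, k4_gt0, k5_gt0).
set A1 := n2 _ _; set A2 := n2 _ _; set A3 := n2 _ _; set A4 := n2 _ _.
have a1 : 0 <= A1 by exact: n2_ge0. have a2 : 0 <= A2 by exact: n2_ge0.
have a3 : 0 <= A3 by exact: n2_ge0. have a4 : 0 <= A4 by exact: n2_ge0.
set B1 := Re (qi _) ^+ 2; set B2 := Im (qi _) ^+ 2; set B3 := Re (delta _) ^+ 2.
set B4 := Im (delta _) ^+ 2; set B5 := Re (eta _) ^+ 2; set B6 := Im (eta _) ^+ 2.
have b1 : 0 <= B1 by exact: sqr_ge0. have b2 : 0 <= B2 by exact: sqr_ge0.
have b3 : 0 <= B3 by exact: sqr_ge0. have b4 : 0 <= B4 by exact: sqr_ge0.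
have b5 : 0 <= B5 by exact: sqr_ge0. have b6 : 0 <= B6 by exact: sqr_ge0.
move=> /(lin5_eq0 c1 c2 c3 c4 c5 a1 a2 a3 a4 b1 b2 b3 b4 b5 b6).
move=> [[q1 q2] [q3 q4] [q5 q6] [q7 q8] [q9 q10]].
have sq0 (x : R) : x ^+ 2 = 0 -> x = 0 by move=> /eqP; rewrite sqrf_eq0 => /eqP.
move: q5 q6 q7 q8 q9 q10 => /sq0 q5 /sq0 q6 /sq0 q7 /sq0 q8 /sq0 q9 /sq0 q10.
have sub0 (x y : R[i]) : Re (x - y) = 0 -> Im (x - y) = 0 -> x = y.
  by rewrite !(ReD, ImD, ReN, ImN) => /eqP + /eqP; rewrite !subr_eq0 => /eqP ? /eqP ?; exact: complexP.
have fae (f g : R -> R[i]) : L2 E (fun x => Re (f x - g x)) ->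
    L2 E (fun x => Im (f x - g x)) -> n2 E (fun x => Re (f x - g x)) = 0 ->
    n2 E (fun x => Im (f x - g x)) = 0 -> f = g %[ae leb in E].
  move=> lr li nr ni.
  apply: (ae_eq_imp2 _ (n2_eq0 mble_E lr nr) (n2_eq0 mble_E li ni)) => x _.
  exact: sub0.
by split; [exact: fae|exact: fae|exact: sub0|exact: sub0|exact: sub0].
Qed.

End States.

(** * The unitary group, Duhamel's formula and the input map *)

Section Filters.
Context {R : realType}.

Lemma squeeze_norm (F : set_system R) (FF : Filter F) (f g : R -> R) (l : R) :
  (forall h, `|f h - l| <= g h) -> g @ F --> (0 : R) -> f @ F --> l.
Proof.
move=> fg g0; apply/cvgrPdist_lt => e e0.
have /cvgrPdist_lt /(_ _ e0) := g0; apply: filterS => h /=.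
rewrite sub0r normrN distrC => gh; apply: le_lt_trans (fg h) _.
exact: le_lt_trans (ler_norm _) gh.
Qed.

Lemma cvg_ext (F : set_system R) (f g : R -> R) (l : R) : (forall h, f h = g h) ->
  f @ F --> l -> g @ F --> l.
Proof. by move=> /funext ->. Qed.

Lemma is_derive_cvg (f : R -> R) (x d : R) :
  (h^-1 * (f (x + h) - f x)) @[h --> (0 : R)^'] --> d -> is_derive x 1 f d.
Proof.
move=> fd.
have e : (fun h : R => h^-1 *: (f (h *: (1 : R) + x) - f x)) =
    (fun h => h^-1 * (f (x + h) - f x)).
  apply/funext => h; congr (_ * (f _ - _)); rewrite addrC; congr (_ + _).
  exact: mulr1.
apply: DeriveDef.
  by rewrite /derivable e; apply/cvg_ex; exists d.
by rewrite /derive e; apply: cvg_lim => //; exact: Rhausdorff.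
Qed.

End Filters.

Section Group.
Context {R : realType} (p : params R).
Implicit Types (z w y : state R) (a b t s h : R).

Local Notation E := (Edom p).
Local Notation rip := (rip p).
Local Notation preX := (preX p).
Local Notation X := (spaceX p).
Local Notation N := (normX p).

Hypothesis adm : admissible p.

Lemma E_sub : E `<=` `[- Lleft p, Lright p].
Proof.
have [_ [l0 L0 L0' lL] _ _ _] := adm; move: lL; rewrite lt_min => /andP[lL lL'].
by move=> x; rewrite /Edom /= !in_itv/= => -[] /andP[h1 h2]; apply/andP; split; lra.
Qed.

Lemma E_fin : (leb E < +oo)%E.
Proof. exact: (fin_sub (mble_E p) E_sub). Qed.

Lemma cintegral_lin (k : R[i]) (f g : R -> R[i]) : cL2 E f -> cL2 E g ->
  cintegral E (fun x => k * f x + g x) = k * cintegral E f + cintegral E g.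
Proof.
have mE := mble_E p; have fE := E_fin.
move=> [f1 f2] [g1 g2].
have [i1 i2] := (L2_integrable mE fE f1, L2_integrable mE fE f2).
have [j1 j2] := (L2_integrable mE fE g1, L2_integrable mE fE g2).
apply: complexP; rewrite ?(ReD, ImD) ?(Re_mulc, Im_mulc) /=.
- rewrite (@eq_Rintegral _ _ _ _ _
    (fun x : measurableTypeR R => (Re k * Re (f x) - Im k * Im (f x)) + Re (g x))); last first.
    by move=> x _; rewrite ReD Re_mulc.
  rewrite RintegralD//; last by apply: integrableB' => //; exact: integrableZ'.
  by rewrite RintegralB ?RintegralZl//; exact: integrableZ'.
- rewrite (@eq_Rintegral _ _ _ _ _
    (fun x : measurableTypeR R => (Re k * Im (f x) + Im k * Re (f x)) + Im (g x))); last first.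
    by move=> x _; rewrite ImD Im_mulc.
  rewrite RintegralD//; last by apply: integrableD' => //; exact: integrableZ'.
  by rewrite RintegralD ?RintegralZl//; exact: integrableZ'.
Qed.

Lemma X_lin (k : R[i]) z w : X z -> X w -> X (k *: z + w).
Proof.
move=> [z1 z2 z3] [w1 w2 w3]; have mE := mble_E p; split.
- by rewrite !stE; apply: cL2D => //; exact: cL2Z.
- by rewrite !stE; apply: cL2D => //; exact: cL2Z.
- rewrite !stE cintegral_lin//.
  move: z3 w3; set A := cintegral _ _; set B := cintegral _ _.
  move=> /(congr1 (fun x => k * x)); rewrite mulr0 => z3 w3.
  have -> : k * A + B + (2 * halfl p)%:C * (k * delta z + delta w) =
    k * (A + (2 * halfl p)%:C * delta z) + (B + (2 * halfl p)%:C * delta w) by ring.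
  by rewrite z3 w3 addr0.
Qed.

Lemma cintegral0 (D : set R) : mble D -> cintegral D (fun=> 0) = 0.
Proof.
move=> mD; apply: complexP; rewrite /= Rintegral_cst// mul0r//.
Qed.

Lemma cL2_0 (D : set R) : mble D -> cL2 D (fun=> 0 : R[i]).
Proof. by move=> mD; split; exact: L2_0. Qed.

Lemma X_B : X (opB p).
Proof.
have mE := mble_E p.
split; [exact: cL2_0|exact: cL2_0|].
by rewrite [cintegral _ _]cintegral0// add0r /delta /= mulr0.
Qed.

Lemma X_0 : X 0.
Proof.
have mE := mble_E p.
split; [exact: cL2_0|exact: cL2_0|].
by rewrite [cintegral _ _]cintegral0// add0r /delta /= mulr0.
Qed.

Lemma X_Z (k : R[i]) z : X z -> X (k *: z).
Proof. by move=> hz; rewrite -[_ *: _]addr0; apply: X_lin => //; exact: X_0. Qed.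

Lemma X_D z w : X z -> X w -> X (z + w).
Proof. by move=> hz hw; rewrite -[z]scale1r; exact: X_lin. Qed.

Lemma X_Sub z w : X z -> X w -> X (z - w).
Proof. by move=> hz hw; rewrite addrC -scaleN1r; exact: X_lin. Qed.

Variable T : R -> state R -> state R.
Hypothesis ug : unitary_group p T.

Lemma T_X t z : X z -> X (T t z).
Proof. by case: ug => h _ _ _ _; exact: h. Qed.

Lemma T_iso t z w : X z -> X w -> rip (T t z) (T t w) = rip z w.
Proof. by case: ug => _ _ h _ _ hz hw; rewrite /rip h. Qed.

Lemma T_zero z : X z -> eq_state p (T 0 z) z.
Proof. by case: ug => _ _ _ h _ /h[]. Qed.

Lemma T_add s t z : X z -> eq_state p (T (s + t) z) (T s (T t z)).
Proof. by case: ug => _ _ _ h _ /h[]. Qed.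

Lemma T_lin t (k : R[i]) z w : X z -> X w ->
  eq_state p (T t (k *: z + w)) (k *: T t z + T t w).
Proof. by case: ug => _ h _ _ _; exact: h. Qed.

Let pX z : X z -> preX z. Proof. exact: X_preX. Qed.

(** [T t] is an isometry with inverse [T (- t)]. *)
Lemma T_adj t z w : X z -> X w -> rip (T t z) w = rip z (T (- t) w).
Proof.
move=> hz hw.
have e := T_add t (- t) hw; rewrite subrr in e.
have e0 := T_zero hw.
rewrite -(rip_eqr (pX (T_X t hz)) (pX (T_X 0 hw)) (pX hw) e0).
rewrite (rip_eqr (pX (T_X t hz)) (pX (T_X 0 hw)) (pX (T_X t (T_X (- t) hw))) e).
by rewrite T_iso//; exact: T_X.
Qed.

Lemma T_norm t z : X z -> N (T t z) = N z.
Proof. by move=> hz; rewrite /normX -!/(rip _ _) T_iso. Qed.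

Lemma T_diff s h w : X w -> N (T (s + h) w - T s w) = N (T h w - w).
Proof.
move=> hw; have hT := T_X h hw.
rewrite -(T_norm s (X_Sub hT hw)).
have e1 : eq_state p (T s (T h w - w)) (T s (T h w) - T s w).
  by have := T_lin s (-1) hw hT; rewrite !scaleN1r ![- _ + _]addrC.
rewrite (normX_eq (pX (T_X s (X_Sub hT hw))) (pX (X_Sub (T_X s hT) (T_X s hw))) e1).
apply: normX_eq.
- exact: pX (X_Sub (T_X _ hw) (T_X s hw)).
- exact: pX (X_Sub (T_X s hT) (T_X s hw)).
- have [e2 e3 e4 e5 e6] := T_add s h hw; split; rewrite !stE.
  + by apply: (ae_eq_imp _ e2) => x _ ->.
  + by apply: (ae_eq_imp _ e3) => x _ ->.
  + by rewrite e4.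
  + by rewrite e5.
  + by rewrite e6.
Qed.

Lemma T_cvg w : X w -> N (T h w - w) @[h --> (0 : R)] --> (0 : R).
Proof. by case: ug => _ _ _ _ h; exact: h. Qed.

Lemma T_rip_cvg s z w : X z -> X w ->
  rip z (T (s + h) w) @[h --> (0 : R)] --> rip z (T s w).
Proof.
move=> hz hw.
apply: (@squeeze_norm _ _ _ _ (fun h => N z * N (T h w - w))).
- move=> h; rewrite -(T_diff s h hw).
  have hd : X (T (s + h) w - T s w) by exact: X_Sub (T_X _ hw) (T_X s hw).
  rewrite -ripBr; [|exact: pX|exact: pX (T_X _ hw)|exact: pX (T_X _ hw)].
  exact: (rip_CS adm (pX hz) (pX hd)).
- rewrite -[X in _ --> X](mulr0 (N z)); apply: cvgM; first exact: cvg_cst.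
  exact: T_cvg.
Qed.

Lemma T_rip_cts b z w : X z -> X w -> continuous (fun s => rip z (T (s - b) w)).
Proof.
move=> hz hw s; have H := T_rip_cvg (s := s - b) hz hw.
 apply/cvgrPdist_lt => e e0.
have /cvgrPdist_lt /(_ _ e0) /nbhs_ballP [r /= r0 rP] := H.
apply/nbhs_ballP; exists r => //= t rstate.
have := rP (t - s); rewrite /ball/= sub0r normrN distrC => /(_ rstate).
by have -> : s - b + (t - s) = t - b by ring.
Qed.

Lemma rip_scale (u : R[i]) z w : X z -> X w ->
  rip (u *: z) w = Re u * rip z w + Im u * rip ('i *: z) w.
Proof.
move=> hz hw.
have -> : u *: z = (Re u)%:C *: z + (Im u)%:C *: ('i *: z).
  rewrite scalerA -scalerDl; congr (_ *: _).
  by apply: complexP; rewrite ?ReD ?ImD ?Re_mulc ?Im_mulc /=; ring.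
have hi : preX ('i *: z) by apply: pX; exact: X_Z.
by rewrite (ripDl (preXZ _ (pX hz)) (preXZ _ hi) (pX hw))
  (ripZl _ (pX hz) (pX hw)) (ripZl _ hi (pX hw)).
Qed.

Hypothesis gen : generated_by_A p T.

Lemma gen_rip z w : spaceW p z -> X z -> X (opA p z) -> X w ->
  h^-1 * (rip (T h z) w - rip z w) @[h --> (0 : R)^'] --> rip (opA p z) w.
Proof.
move=> Wz hz hA hw.
have H : N ((h^-1)%:C *: (T h z - z) - opA p z) @[h --> (0 : R)^'] --> (0 : R).
  by apply/(gen hz hA); split => //; exact: eq_state_refl.
apply: (@squeeze_norm _ _ _ _ (fun h => N ((h^-1)%:C *: (T h z - z) - opA p z) * N w)).
- move=> h.
  have hT := T_X h hz; have hd := X_Sub hT hz; have hs := X_Z (h^-1)%:C hd.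
  rewrite -(ripBl (pX hT) (pX hz) (pX hw)) -(ripZl _ (pX hd) (pX hw))
    -(ripBl (pX hs) (pX hA) (pX hw)).
  exact: (rip_CS adm (pX (X_Sub hs hA)) (pX hw)).
- by rewrite -[X in _ --> X](mul0r (N w)); apply: cvgM => //; exact: cvg_cst.
Qed.

Lemma cvg_oppr_dnbhs (f : R -> R) (l : R) : f h @[h --> (0 : R)^'] --> l ->
  f (- h) @[h --> (0 : R)^'] --> l.
Proof.
move=> H; apply/cvgrPdist_lt => e e0.
have /cvgrPdist_lt /(_ _ e0) /nbhs_ballP [r /= r0 rP] := H.
apply/nbhs_ballP; exists r => //= t rstate t0.
by apply: rP; rewrite ?oppr_eq0//; move: rstate; rewrite /ball/= !sub0r !normrN.
Qed.

(** The product rule for difference quotients, with the increment of the group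
    moved to the first argument by [T_adj]. *)
Lemma curve_split (z : R -> state R) b s h w : X w -> (forall s, X (z s)) ->
  h^-1 * (rip (z (s + h)) (T (s + h - b) w) - rip (z s) (T (s - b) w)) =
  rip ((h^-1)%:C *: (z (s + h) - z s)) (T (s - b + h) w) +
  h^-1 * (rip (T (- h) (z s)) (T (s - b) w) - rip (z s) (T (s - b) w)).
Proof.
move=> hw hz; have -> : s + h - b = s - b + h by ring.
have hT : X (T (s - b + h) w) by exact: T_X.
have hW : X (T (s - b) w) by exact: T_X.
have hQ : X (z (s + h) - z s) by exact: X_Sub.
have -> : rip (T (- h) (z s)) (T (s - b) w) = rip (z s) (T (s - b + h) w).
  rewrite (T_adj _ (hz s) hW) opprK; apply: rip_eqr.
  - exact: pX (hz s).
  - exact: pX (T_X h hW).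
  - exact: pX hT.
  - by apply: eq_state_sym; rewrite addrC; exact: T_add.
rewrite (ripZl _ (pX hQ) (pX hT)) (ripBl (pX (hz _)) (pX (hz _)) (pX hT)).
ring.
Qed.

Lemma curve_cvg (z : R -> state R) (y w : state R) b s :
  X w -> (forall s, X (z s)) -> X y ->
  N ((h^-1)%:C *: (z (s + h) - z s) - y) @[h --> (0 : R)^'] --> (0 : R) ->
  rip ((h^-1)%:C *: (z (s + h) - z s)) (T (b + h) w) @[h --> (0 : R)^'] --> rip y (T b w).
Proof.
move=> hw hz hy zd.
have c0 : rip y (T (b + h) w) @[h --> (0 : R)^'] --> rip y (T b w).
  by apply: cvg_within_filter; exact: T_rip_cvg.
pose f1 h := rip ((h^-1)%:C *: (z (s + h) - z s)) (T (b + h) w).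
have c1 : f1 h - rip y (T (b + h) w) @[h --> (0 : R)^'] --> (0 : R).
  apply: (@squeeze_norm _ _ _ _ (fun h =>
    N ((h^-1)%:C *: (z (s + h) - z s) - y) * N w)).
  + move=> h; rewrite subr0 /f1.
    have hT : X (T (b + h) w) by exact: T_X.
    have hQ : X ((h^-1)%:C *: (z (s + h) - z s)) by apply: X_Z; exact: X_Sub.
    rewrite -(ripBl (pX hQ) (pX hy) (pX hT)) -(T_norm (b + h) hw).
    exact: (rip_CS adm (pX (X_Sub hQ hy)) (pX hT)).
  + by rewrite -[X in _ --> X](mul0r (N w)); apply: cvgM => //; exact: cvg_cst.
have -> : rip y (T b w) = 0 + rip y (T b w) by rewrite add0r.
by apply: cvg_ext (cvgD c1 c0) => h; rewrite /= subrK.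
Qed.

Lemma gen_rip_opp z w : spaceW p z -> X z -> X (opA p z) -> X w ->
  h^-1 * (rip (T (- h) z) w - rip z w) @[h --> (0 : R)^'] --> - rip (opA p z) w.
Proof.
move=> Wz hz hA hw.
apply: cvg_ext (cvgN (cvg_oppr_dnbhs (gen_rip Wz hz hA hw))) => h.
by rewrite -[LHS]/(- ((- h)^-1 * _)) invrN mulNr opprK.
Qed.

(** The two contributions of the unbounded operator cancel, one coming from the
    curve and one from the group, and only the control term is left. *)
Lemma rip_curve_der (z dz : R -> state R) (u : R[i]) b s w :
  X w -> (forall s, X (z s)) -> X (dz s) -> spaceW p (z s) -> X (opA p (z s)) ->
  N ((h^-1)%:C *: (z (s + h) - z s) - dz s) @[h --> (0 : R)^'] --> (0 : R) ->
  eq_state p (dz s) (opA p (z s) + u *: opB p) ->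
  is_derive s 1 (fun s => rip (z s) (T (s - b) w)) (rip (u *: opB p) (T (s - b) w)).
Proof.
move=> hw hz hdz Wz hA zd e; apply: is_derive_cvg.
have hW : X (T (s - b) w) by exact: T_X.
have hB : X (u *: opB p) by apply: X_Z; exact: X_B.
have -> : rip (u *: opB p) (T (s - b) w) =
    rip (dz s) (T (s - b) w) + - rip (opA p (z s)) (T (s - b) w).
  rewrite (rip_eql (pX hdz) (pX (X_D hA hB)) (pX hW) e).
  by rewrite (ripDl (pX hA) (pX hB) (pX hW)); ring.
have c := curve_cvg (b := s - b) hw hz hdz zd.
apply: cvg_ext (cvgD c (gen_rip_opp Wz (hz s) hA hW)) => h.
by rewrite (curve_split b s h hw hz).
Qed.

(** Variation of constants, tested against [w]: integrate [rip_curve_der]. *)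
Lemma duhamel (z dz : R -> state R) (u : R -> R[i]) b w : 0 < b ->
  X w -> (forall s, X (z s)) -> (forall s, X (dz s)) -> (forall s, spaceW p (z s)) ->
  (forall s, X (opA p (z s))) ->
  (forall s, N ((h^-1)%:C *: (z (s + h) - z s) - dz s) @[h --> (0 : R)^'] --> (0 : R)) ->
  (forall s, eq_state p (dz s) (opA p (z s) + u s *: opB p)) ->
  continuous (fun s => Re (u s)) -> continuous (fun s => Im (u s)) ->
  (forall y, X y -> rip (z 0) y = 0) ->
  rip (z b) w = \int[leb]_(s in `[0, b]) rip (u s *: opB p) (T (s - b) w).
Proof.
move=> b0 hw hz hdz Wz hA zd e cu ci z0.
have der s := rip_curve_der b hw hz (hdz s) (Wz s) (hA s) (zd s) (e s).
have hB := X_B.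
have cd : continuous (fun s => rip (u s *: opB p) (T (s - b) w)).
  have -> : (fun s => rip (u s *: opB p) (T (s - b) w)) = (fun s =>
     Re (u s) * rip (opB p) (T (s - b) w) + Im (u s) * rip ('i *: opB p) (T (s - b) w)).
    by apply/funext => s; rewrite rip_scale//; exact: T_X.
  apply: cts_add; apply: cts_mul => //; apply: T_rip_cts => //; exact: X_Z.
have [_ ->] := FTC b0 (fun s _ => der s) (fun s _ => cd s).
rewrite subrr z0 ?subr0; last exact: T_X.
apply: rip_eqr; [exact: pX|exact: pX|apply: pX; exact: T_X|].
exact: eq_state_sym (T_zero hw).
Qed.

Section InputMap.
Variable tau : R.
Hypothesis tau0 : 0 < tau.
Implicit Types (u v : R -> R[i]).

Local Notation D := `[0, tau]%classic.
Local Notation K1 w := (fun s => rip (opB p) (T (s - tau) w)).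
Local Notation K2 w := (fun s => rip ('i *: opB p) (T (s - tau) w)).

Definition sqnorm (D : set R) (u : R -> R[i]) : R :=
  n2 D (fun s => Re (u s)) + n2 D (fun s => Im (u s)).

Lemma sqnorm_ge0 (A : set R) u : 0 <= sqnorm A u.
Proof. by rewrite addr_ge0// n2_ge0. Qed.

Lemma sqrL2normE (A : set R) u : mble A -> cL2 A u -> sqrL2norm A u = sqnorm A u.
Proof.
move=> mA [u1 u2]; rewrite /sqrL2norm Re_L2inner RintegralD//; exact: L2_int_mul.
Qed.

(** The integral in the definition of the input map, tested against [w], with
    the group moved to [w]. *)
Definition pairing u w : R :=
  \int[leb]_(s in D) (Re (u s) * K1 w s + Im (u s) * K2 w s).

Let mD : mble D. Proof. exact: mble_itv. Qed.
Let X_iB : X ('i *: opB p). Proof. by apply: X_Z; exact: X_B. Qed.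

Lemma rip_bound s z w : X z -> X w -> `|rip z (T s w)| <= N z * N w.
Proof.
move=> hz hw; rewrite -(T_norm s hw); apply: rip_CS => //; apply: pX => //.
exact: T_X.
Qed.

Lemma L2_K z w : X z -> X w -> L2 D (fun s => rip z (T (s - tau) w)) /\
  n2 D (fun s => rip z (T (s - tau) w)) <= (N z * N w) ^+ 2 * tau.
Proof.
move=> hz hw; have ck := T_rip_cts (b := tau) hz hw.
have mk := cts_meas mD ck.
split; first exact: (L2_cts (a := 0) (b := tau) mD _ ck).
have lD : fine (leb D) = tau.
  by rewrite lebesgue_measure_itv/= lte_fin tau0 -EFinB subr0.
rewrite -[X in _ <= _ * X]lD.
by apply: n2_bounded => //; [exact: leb_itv_fin|move=> s _; exact: rip_bound].
Qed.

Lemma pairing_int u w : cL2 D u -> X w ->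
  intg D (fun s => Re (u s) * K1 w s + Im (u s) * K2 w s).
Proof.
move=> [u1 u2] hw; have [k1 _] := L2_K X_B hw; have [k2 _] := L2_K X_iB hw.
by apply: integrableD' => //; exact: L2_int_mul.
Qed.

Lemma pairingB u v w : cL2 D u -> cL2 D v -> X w ->
  pairing (fun s => u s - v s) w = pairing u w - pairing v w.
Proof.
move=> hu hv hw; rewrite /pairing -RintegralB//; [|exact: pairing_int|exact: pairing_int].
by apply: eq_Rintegral => s _; rewrite ReD ImD ReN ImN; ring.
Qed.

Definition input_const : R := 2 * tau * (N (opB p) ^+ 2 + N ('i *: opB p) ^+ 2).

Lemma input_const_ge0 : 0 <= input_const.
Proof. by rewrite /input_const mulr_ge0 ?addr_ge0 ?sqr_ge0// mulr_ge0// ltW. Qed.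

Lemma pairing_bound u w : cL2 D u -> X w ->
  pairing u w ^+ 2 <= input_const * sqnorm D u * N w ^+ 2.
Proof.
move=> [u1 u2] hw; have [k1 n1] := L2_K X_B hw; have [k2 n2'] := L2_K X_iB hw.
rewrite /pairing RintegralD//; [|exact: L2_int_mul|exact: L2_int_mul].
have c1 := cauchy_schwarz mD u1 k1; have c2 := cauchy_schwarz mD u2 k2.
move: c1 c2; set A := \int[_]_(_ in _) _; set B := \int[_]_(_ in _) _ => c1 c2.
have p1 := n2_ge0 D (fun s => Re (u s)); have p2 := n2_ge0 D (fun s => Im (u s)).
have d1 := le_trans c1 (ler_wpM2l p1 n1); have d2 := le_trans c2 (ler_wpM2l p2 n2').
rewrite /input_const /sqnorm; move: d1 d2 p1 p2.
set a := n2 _ _; set b := n2 _ _; set x := N (opB p); set y := N ('i *: opB p).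
set n := N w => d1 d2 p1 p2.
have t0 := ltW tau0.
have e1 : 0 <= a * ((y * n) ^+ 2 * tau) by apply: mulr_ge0 => //; apply: mulr_ge0 => //; exact: sqr_ge0.
have e2 : 0 <= b * ((x * n) ^+ 2 * tau) by apply: mulr_ge0 => //; apply: mulr_ge0 => //; exact: sqr_ge0.
apply: (@le_trans _ _ (2 * (A ^+ 2 + B ^+ 2))).
  by have := sqr_ge0 (A - B); nra.
have -> : 2 * tau * (x ^+ 2 + y ^+ 2) * (a + b) * n ^+ 2 =
  2 * (a * ((x * n) ^+ 2 * tau) + a * ((y * n) ^+ 2 * tau) +
       b * ((x * n) ^+ 2 * tau) + b * ((y * n) ^+ 2 * tau)) by ring.
lra.
Qed.

Lemma input_rip u s w : X w -> rip (T (tau - s) (u s *: opB p)) w =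
  Re (u s) * K1 w s + Im (u s) * K2 w s.
Proof.
move=> hw; have hB := X_B.
by rewrite (T_adj _ (X_Z _ hB) hw) opprB (rip_scale _ hB (T_X _ hw)).
Qed.

Lemma input_mapP u z : cL2 D u ->
  input_map p T tau u z <-> X z /\ forall w, X w -> rip z w = pairing u w.
Proof.
move=> hu; split=> [[hz H]|[hz H]]; split => // w hw.
- have [_ /(congr1 (@complex.Re R))] := H w hw.
  rewrite -/(rip z w) => ->; apply: eq_Rintegral => s _.
  exact: input_rip.
- have hiw : X ('i *: w) by exact: X_Z.
  split.
    split.
      have := pairing_int hu hw; apply: eq_integrable => // s _ /=.
      by rewrite -input_rip.
    have := pairing_int hu hiw; apply: eq_integrable => // s _ /=.
    by rewrite -input_rip// -Im_innerX.
  apply: complexP; rewrite /=.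
    rewrite -/(rip z w) H//; apply: eq_Rintegral => s _.
    by rewrite -input_rip.
  rewrite Im_innerX H//; apply: eq_Rintegral => s _.
  by rewrite -input_rip// -Im_innerX.
Qed.

(** Admissibility of the control operator: the reached state is tested against
    itself. *)
Lemma input_norm u z : cL2 D u -> input_map p T tau u z ->
  N z ^+ 2 <= input_const * sqnorm D u.
Proof.
move=> hu /(input_mapP _ hu)[hz H].
have := pairing_bound hu hz; rewrite -H// -normX_sqr//; last exact: pX.
have [->|n0] := eqVneq (N z) 0.
  by move=> _; rewrite expr0n mulr_ge0 ?sqnorm_ge0 ?input_const_ge0.
have np : 0 < N z ^+ 2 by rewrite exprn_even_gt0.
by rewrite [leLHS]expr2 ler_pM2r.
Qed.

Lemma cL2_sub u v : cL2 D u -> cL2 D v -> cL2 D (fun s => u s - v s).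
Proof.
move=> hu hv; have := cL2D mD hu (cL2Z (-1) mD hv).
by congr cL2; apply/funext => s; rewrite mulN1r.
Qed.

Lemma input_sub u v z w : cL2 D u -> cL2 D v -> input_map p T tau u z ->
  input_map p T tau v w -> input_map p T tau (fun s => u s - v s) (z - w).
Proof.
move=> hu hv /(input_mapP _ hu)[hz Hz] /(input_mapP _ hv)[hw Hw].
apply/input_mapP; first exact: cL2_sub.
split; first exact: X_Sub.
move=> y hy; rewrite (ripBl (pX hz) (pX hw) (pX hy)) Hz// Hw// pairingB//.
Qed.

(** The graph of the input map is closed, since both sides of [input_mapP] are
    continuous in the input and in the state. *)
Lemma input_limit u z : cL2 D u -> X z ->
  (forall e, 0 < e -> exists v w, [/\ cL2 D v, input_map p T tau v w,
     sqnorm D (fun s => u s - v s) < e & N (z - w) ^+ 2 < e]) ->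
  input_map p T tau u z.
Proof.
move=> hu hz H; apply/input_mapP => //; split => // y hy.
apply/eqP; rewrite -subr_eq0; set d := (X in X == 0).
apply/negPn/negP => d0.
have d2 : 0 < d ^+ 2 by rewrite exprn_even_gt0.
pose C := 2 * (input_const + 1) * N y ^+ 2 + 1.
have C0 : 0 < C.
  have : 0 <= 2 * (input_const + 1) * N y ^+ 2.
    by rewrite mulr_ge0 ?sqr_ge0// mulr_ge0// addr_ge0// input_const_ge0.
  by rewrite /C; lra.
have [v [w [hv iv uv zw]]] := H (d ^+ 2 / C) (divr_gt0 d2 C0).
have /(input_mapP _ hv)[hw Hw] := iv.
have hzw := X_Sub hz hw; have huv := cL2_sub hu hv.
have dE : d = rip (z - w) y - pairing (fun s => u s - v s) y.
  by rewrite (ripBl (pX hz) (pX hw) (pX hy)) pairingB// Hw// /d; ring.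
have b1 := rip_CS adm (pX hzw) (pX hy).
have b2 := pairing_bound huv hy.
have b3 : rip (z - w) y ^+ 2 <= N (z - w) ^+ 2 * N y ^+ 2.
  rewrite -exprMn -[leLHS]real_normK ?num_real//.
  by rewrite lerXn2r ?nnegrE// mulr_ge0// normX_ge0.
have ny := sqr_ge0 (N y).
have c0 := input_const_ge0.
have b4 : N (z - w) ^+ 2 * N y ^+ 2 <= d ^+ 2 / C * N y ^+ 2.
  by rewrite ler_wpM2r// ltW.
have b5 : input_const * sqnorm D (fun s => u s - v s) * N y ^+ 2 <= input_const * (d ^+ 2 / C) * N y ^+ 2.
  by rewrite ler_wpM2r// ler_wpM2l// ltW.
have : d ^+ 2 <= (C - 1) * (d ^+ 2 / C).
  apply: (@le_trans _ _ (2 * (rip (z - w) y ^+ 2 + pairing (fun s => u s - v s) y ^+ 2))).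
    by rewrite dE; have := sqr_ge0 (rip (z - w) y + pairing (fun s => u s - v s) y); nra.
  have -> : (C - 1) * (d ^+ 2 / C) =
     2 * (d ^+ 2 / C * N y ^+ 2 + input_const * (d ^+ 2 / C) * N y ^+ 2) by rewrite /C; ring.
  lra.
have -> : (C - 1) * (d ^+ 2 / C) = d ^+ 2 - d ^+ 2 / C by field; rewrite gt_eqF.
by have := divr_gt0 d2 C0; lra.
Qed.

End InputMap.

End Group.

(** * Waves generated by a signal *)

Section PrimL2.
Context {R : realType}.
Implicit Types (f g v w : R -> R) (x y a b t s : R).

Variable tau : R.
Hypothesis tau0 : 0 < tau.

(** Signals live on the whole line so that delayed signals need no restriction
    of their domain. *)
Definition signal v := L2 setT v /\ supp_in 0 tau v.

Lemma sigB v w : signal v -> signal w -> signal (fun t => v t - w t).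
Proof.
move=> [v1 v2] [w1 w2]; split; first exact: L2B.
by move=> t ht; rewrite v2// w2// subrr.
Qed.

Lemma sigD v w : signal v -> signal w -> signal (fun t => v t + w t).
Proof.
move=> [v1 v2] [w1 w2]; split; first exact: L2D.
by move=> t ht; rewrite v2// w2// addr0.
Qed.

Lemma sigZ k v : signal v -> signal (fun t => k * v t).
Proof.
move=> [v1 v2]; split; first exact: L2Z.
by move=> t ht; rewrite v2// mulr0.
Qed.

Lemma sig_left v t : signal v -> t < 0 -> v t = 0.
Proof. by move=> [_ h] t0; apply: h => /andP[+ _]; rewrite leNgt t0. Qed.

Lemma sig_int v : signal v -> intg setT v.
Proof.
move=> [v1 v2].
have : intg `[0, tau] v.
  apply: L2_integrable; [exact: mble_itv|exact: leb_itv_fin|].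
  by apply: L2S v1 => //; exact: mble_itv.
apply: (eq_patch_int _ _ _).1; [exact: mble_itv|by []|].
move=> x; rewrite /patch mem_setT; case: ifPn => // /negP xn.
by rewrite v2// => h; apply: xn; apply/mem_set; rewrite /= in_itv.
Qed.

Lemma sig_intD v (D : set R) : mble D -> signal v -> intg D v.
Proof. by move=> mD /sig_int; apply: integrableS. Qed.

Lemma Prim_sigB v w t : signal v -> signal w ->
  Prim (fun t => v t - w t) t = Prim v t - Prim w t.
Proof.
by move=> hv hw; rewrite /Prim RintegralB//; apply: sig_intD => //; exact: mble_itv.
Qed.

Lemma Prim_neg v t : (forall t, t < 0 -> v t = 0) -> t < 0 -> Prim v t = 0.
Proof. by move=> v0; apply: Prim_left. Qed.

Lemma Prim_int v t b : (forall t, t < 0 -> v t = 0) -> 0 <= t -> 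
  Prim v t = \int[leb]_(x in `[0, t]) v x.
Proof.
move=> v0 t0; apply: Rint_shrink; [exact: mble_itv|exact: mble_itv| |].
  by move=> x /=; rewrite !in_itv/= => /andP[].
move=> x /=; rewrite !in_itv/= => xt xn; apply: v0; rewrite ltNge; apply/negP => x0.
by apply: xn; rewrite x0.
Qed.

Lemma Prim_dist v s t : signal v -> s <= t ->
  (Prim v t - Prim v s) ^+ 2 <= (t - s) * n2 setT v.
Proof.
move=> hv rstate; rewrite Prim_sub//; last by move=> u; apply: sig_intD => //; exact: mble_itv.
have mI : mble `]s, t] by exact: mble_itv.
have v1 : L2 `]s, t] v by apply: L2S hv.1.
apply: le_trans (int_sqr_le mI (leb_itv_fin _ _ _ _) v1) _.
have -> : fine (leb `]s, t]%classic) = t - s.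
  rewrite lebesgue_measure_itv/= lte_fin; case: ltP => [|ts]; first by rewrite -EFinB.
  by have -> : t = s by [apply/eqP; rewrite eq_le ts]; rewrite subrr.
rewrite ler_wpM2l ?subr_ge0//; apply: n2S => //; exact: hv.1.
Qed.

Lemma Prim_bound v t : signal v -> Prim v t ^+ 2 <= tau * n2 setT v.
Proof.
move=> hv; have [t0|t0] := ltP t 0.
  rewrite Prim_neg// ?expr0n ?mulr_ge0 ?n2_ge0 ?(ltW tau0)//.
  by move=> x; exact: sig_left.
rewrite (Prim_int t)//; last by move=> x; exact: sig_left.
have mI (i : interval R) : mble [set` i] by exact: mble_itv.
have -> : \int[leb]_(x in `[0, t]) v x = \int[leb]_(x in `[0, Num.min t tau]) v x.
  apply: Rint_shrink => //.
    by move=> x /=; rewrite !in_itv/= le_min => /andP[-> /andP[->]].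
  move=> x /=; rewrite !in_itv/= le_min => /andP[-> ->] /= xt; apply: hv.2.
  by move=> /andP[_ xt']; apply: xt.
have v1 : L2 `[0, Num.min t tau] v by apply: L2S hv.1.
apply: le_trans (int_sqr_le _ (leb_itv_fin _ _ _ _) v1) _ => //.
have m0 : 0 <= Num.min t tau by rewrite le_min t0 ltW.
have -> : fine (leb `[0, Num.min t tau]%classic) = Num.min t tau.
  rewrite lebesgue_measure_itv/= lte_fin; case: ltP => [|ts].
    by rewrite -EFinB subr0.
  by have -> : Num.min t tau = 0 by [apply/eqP; rewrite eq_le ts].
apply: ler_pM; rewrite ?n2_ge0//; first by rewrite ge_min lexx orbT.
by apply: n2S => //; exact: hv.1.
Qed.

Lemma Prim_cts v : signal v -> continuous (Prim v).
Proof.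
move=> hv s; apply/cvgrPdist_lt => e e0.
pose n := n2 setT v + 1.
have n0 : 0 < n by rewrite /n ltr_wpDl// n2_ge0.
have d0 : 0 < e ^+ 2 / n by rewrite divr_gt0// exprn_gt0.
apply/nbhs_ballP; exists (e ^+ 2 / n) => //= t; rewrite /ball/= => rstate.
have H : (Prim v s - Prim v t) ^+ 2 <= `|s - t| * n2 setT v.
  have [ts|ts] := leP t s; first by rewrite ger0_norm ?subr_ge0// Prim_dist.
  rewrite ltr0_norm ?subr_lt0// opprB -sqrrN opprB Prim_dist// ltW//.
have H2 : (Prim v s - Prim v t) ^+ 2 < e ^+ 2.
  apply: le_lt_trans H _; apply: (@le_lt_trans _ _ (`|s - t| * n)).
    by rewrite ler_wpM2l// /n; lra.
  by rewrite -ltr_pdivlMr.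
rewrite -(@ltr_pXn2r _ 2)// ?nnegrE ?(ltW e0)//.
by rewrite real_normK// num_real.
Qed.

Lemma n2_sig v : signal v -> n2 setT v = n2 `]0, tau[ v.
Proof.
move=> [v1 v2]; have mI (i : interval R) : mble [set` i] by exact: mble_itv.
rewrite /n2 (@Rint_shrink _ setT `[0, tau] (fun t => v t ^+ 2))//.
  rewrite Rint_oo_cc//; apply: integrableS v1.2 => //.
by move=> t _ /= tn; rewrite v2 ?expr0n// => h; apply: tn; rewrite in_itv.
Qed.

Lemma sig_Cc v (h : R) : 0 < h -> continuous v -> supp_in (0 + h) (tau - h) v -> signal v.
Proof.
move=> h0 cv sv.
have s0 : supp_in 0 tau v.
  by move=> t tn; apply: sv => /andP[? ?]; apply: tn; apply/andP; split; lra.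
split => //.
have mI (i : interval R) : mble [set` i] by exact: mble_itv.
have := L2_patch (mI _) (L2_cts (mI _) (fun x h => h) cv : L2 `[0, tau] v).
congr L2; apply/funext => t; rewrite /patch; case: ifPn => // /negP tn.
by rewrite s0// => h'; apply: tn; apply/mem_set; rewrite /= in_itv.
Qed.

Lemma sig_dense v eps : signal v -> 0 < eps -> exists w h,
  [/\ 0 < h, continuous w, supp_in (0 + h) (tau - h) w, signal w &
      n2 setT (fun t => v t - w t) < eps].
Proof.
move=> hv e0.
have Lv : L2 `]0, tau[ v by apply: L2S hv.1 => //; exact: mble_itv.
have [w [h h0 [cw sw nw]]] := dense_Cc tau0 Lv e0.
have hw := sig_Cc h0 cw sw.
exists w, h; split => //.
by rewrite n2_sig//; exact: sigB.
Qed.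

End PrimL2.

Lemma cts_shift (R : realType) (P : R -> R) (h : R) : continuous P ->
  continuous (fun x => P (x + h)).
Proof.
move=> cP x; apply: (continuous_comp (f := fun y : R => y + h) (g := P)); last exact: cP.
by have := @cts_add _ id (cst h) (fun x => cvg_id) (@cts_cst _ h) x.
Qed.

Section Wave.
Context {R : realType}.
Implicit Types (f g v w P : R -> R) (x y t s : R).

Variables (l L c : R).
Hypotheses (l0 : 0 < l) (lL : l < L) (c0 : 0 < c).

Local Ltac wlra := have := l0; have := lL; have := c0; lra.

(** The time that a wave needs to reach the wall and come back. *)
Definition round_trip := 2 * (L - l) / c.

Lemma round_trip_gt0 : 0 < round_trip.
Proof. by rewrite divr_gt0// mulr_gt0// subr_gt0. Qed.

(** The time at which the outgoing wave found at [x] at time [s] left the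
    object. *)
Definition out_phase s x := s - (`|x| - l) / c.
(** The same for the wave that comes back from the wall. *)
Definition back_phase s x := s - (2 * L - l - `|x|) / c.
(** The outward direction: the discharge is odd. *)
Definition side x : R := if 0 < x then 1 else -1.
(** D'Alembert's formula for [P]: the sum of the outgoing and of the reflected
    wave. The difference gives the discharge [wave_q]. *)
Definition wave_zeta P s x := (P (out_phase s x) + P (back_phase s x)) / (2 * c).
Definition wave_q P s x := side x * ((P (out_phase s x) - P (back_phase s x)) / 2).
(** The velocity of the object for which the jump of [wave_q] is right. *)
Definition wave_eta P s := (P (s - round_trip) - P s) / (2 * l).
(** The displacement has the velocity [wave_eta P], and the primitive that
    starts from rest is obtained by integrating the profile. *)
Definition wave_delta P s := wave_eta (Prim P) s.

Let E := two_sided l L.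
Let mE : mble E. Proof. exact: mble_two_sided. Qed.
Let ELL : E `<=` `[- L, L]. Proof. exact: two_sided_sub. Qed.
Let fE : (leb E < +oo)%E. Proof. exact: fin_sub ELL. Qed.

Lemma side_sqr x : side x * side x = 1.
Proof. by rewrite /side; case: ifP => _; rewrite ?mulr1// mulrNN mulr1. Qed.

Lemma sideN x : x != 0 -> side (- x) = - side x.
Proof.
rewrite /side oppr_gt0 neq_lt => /orP[x0|x0]; rewrite x0.
  by rewrite ltNge (ltW x0) /= opprK.
by rewrite ltNge (ltW x0).
Qed.

Lemma two_sidedP x : E x <-> l < `|x| < L.
Proof.
rewrite /E /two_sided /= !in_itv/=; split.
  by case=> /andP[h1 h2]; [rewrite ltr0_norm; last wlra|rewrite gtr0_norm; last wlra];
    apply/andP; split; lra.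
by case: (ger0P x) => x0 /andP[h1 h2]; [right|left]; apply/andP; split; lra.
Qed.

Lemma two_sided_neq0 x : E x -> x != 0.
Proof. by move=> /two_sidedP /andP[h _]; rewrite -normr_gt0; wlra. Qed.

Lemma phases_in s x : E x -> s - round_trip <= out_phase s x <= s /\ s - round_trip <= back_phase s x <= s.
Proof.
move=> /two_sidedP /andP[h1 h2]; rewrite /out_phase /back_phase /round_trip.
have ci : 0 < c^-1 by rewrite invr_gt0.
by split; apply/andP; split; nra.
Qed.

Lemma out_phase_l s : out_phase s l = s. Proof. by rewrite /out_phase gtr0_norm// subrr mul0r subr0. Qed.
Lemma back_phase_l s : back_phase s l = s - round_trip.
Proof. by rewrite /back_phase /round_trip gtr0_norm//; congr (_ - _ / _); ring. Qed.
Lemma phases_L s : back_phase s L = out_phase s L.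
Proof. by rewrite /out_phase /back_phase gtr0_norm; [congr (_ - _ / _); ring|wlra]. Qed.
Lemma out_phaseN s x : out_phase s (- x) = out_phase s x. Proof. by rewrite /out_phase normrN. Qed.
Lemma back_phaseN s x : back_phase s (- x) = back_phase s x. Proof. by rewrite /back_phase normrN. Qed.
Lemma out_phaseD s h x : out_phase (s + h) x = out_phase s x + h. Proof. by rewrite /out_phase; ring. Qed.
Lemma back_phaseD s h x : back_phase (s + h) x = back_phase s x + h. Proof. by rewrite /back_phase; ring. Qed.

Lemma wave_zeta_even P s x : wave_zeta P s (- x) = wave_zeta P s x.
Proof. by rewrite /wave_zeta out_phaseN back_phaseN. Qed.

Lemma wave_q_odd P s x : E x -> wave_q P s (- x) = - wave_q P s x.
Proof. by move=> /two_sided_neq0 x0; rewrite /wave_q out_phaseN back_phaseN sideN// mulNr. Qed.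

Lemma out_phaseE s x : out_phase s x = - c^-1 * `|x| + (s + l / c).
Proof. by rewrite /out_phase; field; rewrite gt_eqF. Qed.
Lemma back_phaseE s x : back_phase s x = c^-1 * `|x| + (s - (2 * L - l) / c).
Proof. by rewrite /back_phase; field; rewrite gt_eqF. Qed.

Lemma phases_L2 f s : L2 setT f ->
  [/\ L2 setT (fun x => f (out_phase s x)), L2 setT (fun x => f (back_phase s x)),
   n2 setT (fun x => f (out_phase s x)) <= 2 * c * n2 setT f &
   n2 setT (fun x => f (back_phase s x)) <= 2 * c * n2 setT f].
Proof.
move=> hf.
have ci : c^-1 != 0 by rewrite invr_eq0 gt_eqF.
have cm : - c^-1 != 0 by rewrite oppr_eq0.
have [f1 n1] := L2_affine (s + l / c) cm hf.
have [f2 n2'] := L2_affine (s - (2 * L - l) / c) ci hf.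
have [g1 m1] := L2_abs f1; have [g2 m2] := L2_abs f2.
move: m1 m2; rewrite n1 n2' normrN normfV invrK gtr0_norm// mulrA => m1 m2.
have -> : (fun x => f (out_phase s x)) = (fun x => f (- c^-1 * `|x| + (s + l / c))).
  by apply/funext => x; rewrite out_phaseE.
have -> : (fun x => f (back_phase s x)) = (fun x => f (c^-1 * `|x| + (s - (2 * L - l) / c))).
  by apply/funext => x; rewrite back_phaseE.
by [].
Qed.

Lemma side_meas (D : set R) : mble D -> mblefun D side.
Proof.
move=> mD; have : mblefun setT side.
  have -> : side = (fun x => \1_(`]0, +oo[%classic : set R) x - \1_(`]-oo, 0]%classic : set R) x).
    apply/funext => x; rewrite /side !indicE !mem_setE !in_itv/= andbT.
    by case: ltP => x0; rewrite ?subr0// sub0r.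
  by apply: measurable_funB; apply: measurable_indic; exact: mble_itv.
by apply: measurable_funS.
Qed.

Lemma side_L2 (D : set R) f : mble D -> L2 D f -> L2 D (fun x => side x * f x) /\
  n2 D (fun x => side x * f x) = n2 D f.
Proof.
move=> mD hf.
have e x : (side x * f x) ^+ 2 = f x ^+ 2.
  by rewrite exprMn [side x ^+ 2]expr2 side_sqr mul1r.
split; last by apply: eq_Rintegral => x _; rewrite e.
split; first by apply: measurable_funM; [exact: side_meas|exact: hf.1].
by have := hf.2; apply: eq_integrable => // x _; rewrite e.
Qed.

Definition wave_const : R := 2 * c + 2 / c.

Lemma wave_const_gt0 : 0 < wave_const.
Proof. by rewrite /wave_const addr_gt0 ?mulr_gt0 ?invr_gt0. Qed.

(** The phases are affine on each side of the object and stay within the last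
    round trip: change variables. *)
Lemma wave_L2 f s : L2 `[s - round_trip, s] f ->
  [/\ L2 E (wave_zeta f s), L2 E (wave_q f s), n2 E (wave_zeta f s) <= wave_const * n2 `[s - round_trip, s] f &
      n2 E (wave_q f s) <= wave_const * n2 `[s - round_trip, s] f].
Proof.
move=> hf; have mI : mble `[s - round_trip, s] by exact: mble_itv.
pose g := f \_ `[s - round_trip, s].
have hg : L2 setT g by exact: L2_patch.
have ng : n2 setT g = n2 `[s - round_trip, s] f by exact: n2_patch.
have gf t : s - round_trip <= t <= s -> f t = g t.
  by move=> tI; rewrite /g patchE mem_set//= in_itv.
have [a1 a2 a3 a4] := phases_L2 s hg.
have mT : mble (setT : set R) by exact: measurableT.
have b1 := L2S mT mE (@subsetT _ _) a1; have b2 := L2S mT mE (@subsetT _ _) a2.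
have m1 := n2S mT mE (@subsetT _ _) a1; have m2 := n2S mT mE (@subsetT _ _) a2.
have ez x : E x -> wave_zeta f s x = (2 * c)^-1 * (g (out_phase s x) + g (back_phase s x)).
  by move=> /(phases_in s)[/gf e1 /gf e2]; rewrite /wave_zeta e1 e2 mulrC.
have eq x : E x -> wave_q f s x = side x * (2^-1 * (g (out_phase s x) - g (back_phase s x))).
  by move=> /(phases_in s)[/gf e1 /gf e2]; rewrite /wave_q e1 e2 [2^-1 * _]mulrC.
have congL (u w : R -> R) : (forall x, E x -> u x = w x) -> L2 E w -> L2 E u.
  move=> uw [w1 w2]; split.
    by apply: (eq_measurable_fun w) => // x /set_mem xE; rewrite uw.
  by apply: eq_integrable w2 => // x /set_mem xE; rewrite uw.
have congn (u w : R -> R) : (forall x, E x -> u x = w x) -> n2 E u = n2 E w.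
  by move=> uw; apply: eq_Rintegral => x /set_mem xE; rewrite uw.
have bs := L2D mE b1 b2; have bd := L2B mE b1 b2.
have ns := n2D_le mE b1 b2; have nd := n2B_le mE b1 b2.
have [h1 h2] := side_L2 mE (L2Z 2^-1 mE bd).
have n0 := n2_ge0 (setT : set R) g.
split.
- by apply: (congL _ _ ez); exact: L2Z.
- exact: (congL _ _ eq).
- rewrite (congn _ _ ez) n2Z// -ng.
  have cc : 0 < c^-1 by rewrite invr_gt0.
  apply: (@le_trans _ _ ((2 * c)^-1 ^+ 2 * (8 * c * n2 setT g))).
    by rewrite ler_wpM2l ?sqr_ge0//; lra.
  have -> : (2 * c)^-1 ^+ 2 * (8 * c * n2 setT g) = 2 / c * n2 setT g.
    by field; rewrite gt_eqF.
  by rewrite ler_wpM2r// /wave_const lerDr mulr_ge0// ltW.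
- rewrite (congn _ _ eq) h2 n2Z// -ng.
  apply: (@le_trans _ _ (2^-1 ^+ 2 * (8 * c * n2 setT g))).
    by rewrite ler_wpM2l ?sqr_ge0//; lra.
  have -> : 2^-1 ^+ 2 * (8 * c * n2 setT g) = 2 * c * n2 setT g by field.
  by rewrite ler_wpM2r// /wave_const lerDl divr_ge0// ltW.
Qed.

Lemma wave_zetaB f g s x : wave_zeta (fun t => f t - g t) s x = wave_zeta f s x - wave_zeta g s x.
Proof. by rewrite /wave_zeta; ring. Qed.
Lemma wave_qB f g s x : wave_q (fun t => f t - g t) s x = wave_q f s x - wave_q g s x.
Proof. by rewrite /wave_q; ring. Qed.
Lemma wave_etaB f g s : wave_eta (fun t => f t - g t) s = wave_eta f s - wave_eta g s.
Proof. by rewrite /wave_eta; ring. Qed.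

Lemma near_lt0 x : x < 0 -> \forall y \near x, y < 0.
Proof.
move=> x0; apply/nbhs_ballP; exists (- x); first by rewrite /= oppr_gt0.
by move=> y; rewrite /ball/= ltr_norml => /andP[]; lra.
Qed.

Lemma near_gt0 x : 0 < x -> \forall y \near x, 0 < y.
Proof.
move=> x0; apply/nbhs_ballP; exists x => //.
by move=> y; rewrite /ball/= ltr_norml => /andP[]; lra.
Qed.

Lemma abs_der x : x != 0 -> is_derive x 1 (fun y : R => `|y|) (side x).
Proof.
rewrite neq_lt /side => /orP[x0|x0].
- rewrite ltNge (ltW x0) /=.
  have nd : is_derive x (1 : R) (-%R : R -> R) (- 1) := is_deriveNid x (1 : R).
  apply: near_eq_is_derive nd.
  by have := near_lt0 x0; apply: filterS => y y0; rewrite ltr0_norm.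
- rewrite x0.
  have nd : is_derive x (1 : R) (id : R -> R) 1 := is_derive_id x (1 : R).
  apply: near_eq_is_derive nd.
  by have := near_gt0 x0; apply: filterS => y y0; rewrite gtr0_norm.
Qed.

Lemma der_ph (P : R -> R) (d k m x : R) : x != 0 -> is_derive (k * `|x| + m) 1 P d ->
  is_derive x 1 (fun y => P (k * `|y| + m)) (side x * (k * d)).
Proof.
move=> x0 Pd.
have h := is_derive_aff Pd.
apply: (is_derive_eq (is_derive1_comp (f := fun y => P (k * y + m))
   (g := fun y : R => `|y|) h (abs_der x0))).
by rewrite mulrC.
Qed.

Lemma wave_zeta_der P v s x : (forall t, is_derive t 1 P (v t)) -> x != 0 ->
  is_derive x 1 (wave_zeta P s) (- c^-1 ^+ 2 * wave_q v s x).
Proof.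
move=> Pv x0.
have d1 := der_ph x0 (Pv (- c^-1 * `|x| + (s + l / c))).
have d2 := der_ph x0 (Pv (c^-1 * `|x| + (s - (2 * L - l) / c))).
have := is_deriveZ (2 * c)^-1 (is_deriveD d1 d2).
rewrite /GRing.scale /=; set g := (X in is_derive _ _ X _ -> _).
have -> : g = wave_zeta P s.
  by apply/funext => y; rewrite /wave_zeta out_phaseE back_phaseE mulrC.
have -> : (2 * c)^-1 * (side x * (- c^-1 * v (- c^-1 * `|x| + (s + l / c))) +
   side x * (c^-1 * v (c^-1 * `|x| + (s - (2 * L - l) / c)))) = - c^-1 ^+ 2 * wave_q v s x.
  by rewrite /wave_q out_phaseE back_phaseE; field; rewrite gt_eqF.
by [].
Qed.

Lemma wave_q_der P v s x : (forall t, is_derive t 1 P (v t)) -> x != 0 ->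
  is_derive x 1 (wave_q P s) (- wave_zeta v s x).
Proof.
move=> Pv x0.
have d1 := der_ph x0 (Pv (- c^-1 * `|x| + (s + l / c))).
have d2 := der_ph x0 (Pv (c^-1 * `|x| + (s - (2 * L - l) / c))).
have := is_deriveZ (side x / 2) (is_deriveB d1 d2).
rewrite /GRing.scale /=; set g := (X in is_derive _ _ X _ -> _).
have -> : side x / 2 * (side x * (- c^-1 * v (- c^-1 * `|x| + (s + l / c)))
   - side x * (c^-1 * v (c^-1 * `|x| + (s - (2 * L - l) / c)))) = - wave_zeta v s x.
  rewrite /wave_zeta out_phaseE back_phaseE; set A := v _; set B := v _.
  transitivity (side x * side x * - ((A + B) / (2 * c))); last by rewrite side_sqr mul1r.
  by field; rewrite gt_eqF.
move=> gd; apply: near_eq_is_derive gd.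
have : \forall y \near x, side y = side x.
  rewrite /side; move: x0; rewrite neq_lt => /orP[x0|x0].
    rewrite [0 < x]ltNge (ltW x0) /=.
    by have := near_lt0 x0; apply: filterS => y y0; rewrite ltNge (ltW y0).
  by rewrite x0; have := near_gt0 x0; apply: filterS => y ->.
apply: filterS => y ye.
rewrite /g -[LHS]/(side x / 2 * (_ - _)) /wave_q out_phaseE back_phaseE ye; ring.
Qed.

Lemma aff_abs_cts P k m : continuous P -> continuous (fun x : R => P (k * `|x| + m)).
Proof.
move=> cP x; apply: (continuous_comp (f := fun y : R => k * `|y| + m) (g := P)); last exact: cP.
apply: (@cts_add _ (fun y : R => k * `|y|) (fun=> m)); last exact: cts_cst.
by apply: cts_mul; [exact: cts_cst|move=> y; exact: norm_continuous].
Qed.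

Lemma wave_zeta_cts P s : continuous P -> continuous (wave_zeta P s).
Proof.
move=> cP; have -> : wave_zeta P s = (fun x => (P (- c^-1 * `|x| + (s + l / c)) +
    P (c^-1 * `|x| + (s - (2 * L - l) / c))) * (2 * c)^-1).
  by apply/funext => x; rewrite /wave_zeta out_phaseE back_phaseE.
apply: cts_mul; last exact: cts_cst.
by apply: cts_add; exact: aff_abs_cts.
Qed.

Lemma side_cts x : x != 0 -> {for x, continuous side}.
Proof.
move=> x0; apply/cvgrPdist_lt => e e0.
have : \forall y \near x, side y = side x.
  rewrite /side; move: x0; rewrite neq_lt => /orP[x0|x0].
    rewrite [0 < x]ltNge (ltW x0) /=.
    by have := near_lt0 x0; apply: filterS => y y0; rewrite ltNge (ltW y0).
  by rewrite x0; have := near_gt0 x0; apply: filterS => y ->.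
by apply: filterS => y ->; rewrite subrr normr0.
Qed.

Lemma wave_q_cts P s x : continuous P -> x != 0 -> {for x, continuous (wave_q P s)}.
Proof.
move=> cP x0; apply: cvgM; first exact: side_cts.
have H : continuous (fun y => (P (out_phase s y) - P (back_phase s y)) / 2).
  have -> : (fun y => (P (out_phase s y) - P (back_phase s y)) / 2) =
     (fun y => (P (- c^-1 * `|y| + (s + l / c)) -
      P (c^-1 * `|y| + (s - (2 * L - l) / c))) * 2^-1).
    by apply/funext => y; rewrite out_phaseE back_phaseE.
  by apply: cts_mul; [apply: cts_sub; exact: aff_abs_cts|exact: cts_cst].
exact: H.
Qed.

Let oE : open E. Proof. exact: open_two_sided. Qed.

Lemma trace_wave f g x : `|x| = l \/ `|x| = L -> (forall y, y != 0 -> {for y, continuous g}) ->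
  f = g %[ae leb in E] -> trace E f x = g x.
Proof.
move=> xE cg fg.
have x0 : x != 0 by rewrite -normr_gt0; case: xE => ->; wlra.
apply: trace_cts => //.
- by move=> y /set_mem /two_sided_neq0; exact: cg.
- exact: cg.
- exact: within_two_sided.
Qed.

Lemma wave_q_l P s : wave_q P s l = (P s - P (s - round_trip)) / 2.
Proof. by rewrite /wave_q out_phase_l back_phase_l /side l0 mul1r. Qed.

Lemma wave_q_Nl P s : wave_q P s (- l) = - ((P s - P (s - round_trip)) / 2).
Proof. by rewrite /wave_q out_phaseN back_phaseN out_phase_l back_phase_l sideN ?gt_eqF// /side l0 mulN1r. Qed.

Lemma wave_q_L P s : wave_q P s L = 0 /\ wave_q P s (- L) = 0.
Proof. by rewrite /wave_q out_phaseN back_phaseN phases_L subrr mul0r !mulr0. Qed.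

Lemma wave_zeta_l P s : wave_zeta P s l = (P s + P (s - round_trip)) / (2 * c).
Proof. by rewrite /wave_zeta out_phase_l back_phase_l. Qed.

(** The wave [wave_q (Prim P) s] has derivative [- wave_zeta P s] and vanishes
    at both walls, so the integral reduces to its jump at the object. *)
Lemma wave_zeta_volume P s : continuous P -> (forall t, t < 0 -> P t = 0) ->
  \int[leb]_(x in E) wave_zeta P s x = - (2 * l) * wave_delta P s.
Proof.
move=> cP P0.
have Qd t : is_derive t 1 (Prim P) (P t).
  by apply: Prim_der; [exact: cP|move=> u; exact: (left_cts_int u cP P0)].
have nd x : x != 0 -> is_derive x 1 (wave_q (Prim P) s) (- wave_zeta P s x).
  by move=> x0; exact: wave_q_der.
have cz : continuous (wave_zeta P s) by exact: wave_zeta_cts.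
have czn : continuous (fun x => - wave_zeta P s x).
  have -> : (fun x => - wave_zeta P s x) = (fun x => (-1) * wave_zeta P s x).
    by apply/funext => x; rewrite mulN1r.
  by apply: cts_mul => //; exact: cts_cst.
have nab : - L < - l by rewrite ltrN2.
have n1 x : - L <= x <= - l -> x != 0 by move=> /andP[_ ?]; rewrite lt_eqF//; wlra.
have n2' x : l <= x <= L -> x != 0 by move=> /andP[? _]; rewrite gt_eqF//; wlra.
have [i1 e1] := FTC nab (fun x h => nd x (n1 x h)) (fun x _ => czn x).
have [i2 e2] := FTC lL (fun x h => nd x (n2' x h)) (fun x _ => czn x).
have zi : intg E (fun x => wave_zeta P s x).
  by apply: L2_integrable => //; exact: (L2_cts mE ELL).
have zni : intg E (fun x => - wave_zeta P s x) by exact: integrableN'.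
have mI (i : interval R) : mble [set` i] by exact: mble_itv.
have : \int[leb]_(x in E) (- wave_zeta P s x) = 2 * l * wave_delta P s.
  rewrite /E (Rintegral_setU (mI _) (mI _) zni (two_sided_disj L l0)).
  rewrite (Rint_oo_cc i1) (Rint_oo_cc i2) e1 e2.
  have [-> ->] := wave_q_L (Prim P) s.
  rewrite wave_q_l wave_q_Nl /wave_delta /wave_eta; field; rewrite gt_eqF//.
move=> H; rewrite mulNr -H.
under [X in - X]eq_Rintegral do rewrite -mulN1r.
by rewrite RintegralZl// mulN1r opprK.
Qed.

Lemma wave_cts_L2 P s : continuous P -> L2 E (wave_zeta P s) /\ L2 E (wave_q P s).
Proof.
move=> cP; have LI : L2 `[s - round_trip, s] P.
  by apply: (L2_cts (a := s - round_trip) (b := s)) => //; exact: mble_itv.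
by have [? ? _ _] := wave_L2 LI.
Qed.

Lemma wave_bound P s B : continuous P -> (forall t, t <= s -> `|P t| <= B) ->
  n2 E (wave_zeta P s) <= wave_const * (B ^+ 2 * round_trip) /\ n2 E (wave_q P s) <= wave_const * (B ^+ 2 * round_trip).
Proof.
move=> cP PB; have mI : mble `[s - round_trip, s] by exact: mble_itv.
have LI : L2 `[s - round_trip, s] P by exact: (L2_cts (a := s - round_trip) (b := s)).
have [_ _ n1 n2'] := wave_L2 LI.
have cw := ltW wave_const_gt0.
have H : n2 `[s - round_trip, s] P <= B ^+ 2 * round_trip.
  have lI : fine (leb (`[s - round_trip, s]%classic : set R)) = round_trip.
    have h : s - round_trip < s by rewrite ltrBlDr ltrDl round_trip_gt0.
    by rewrite lebesgue_measure_itv/= lte_fin h -EFinB/=; ring.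
  rewrite -[X in _ <= _ * X]lI.
  apply: n2_bounded => //; [exact: leb_itv_fin|exact: (cts_meas mI)|].
  by move=> t /=; rewrite in_itv/= => /andP[_]; exact: PB.
by split; [apply: le_trans n1 _|apply: le_trans n2' _]; rewrite ler_wpM2l.
Qed.

Lemma sig_L2I (tau : R) v s : signal tau v ->
  L2 `[s - round_trip, s] v /\ n2 `[s - round_trip, s] v <= n2 setT v.
Proof.
move=> [v1 _]; have mI : mble `[s - round_trip, s] by exact: mble_itv.
by split; [apply: L2S v1|apply: n2S].
Qed.

Lemma wave_sig (tau : R) v s : signal tau v ->
  [/\ L2 E (wave_zeta v s), L2 E (wave_q v s), n2 E (wave_zeta v s) <= wave_const * n2 setT v &
      n2 E (wave_q v s) <= wave_const * n2 setT v].
Proof.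
move=> /(sig_L2I s)[v1 vn]; have [? ? n1 n2'] := wave_L2 v1.
have cw := ltW wave_const_gt0.
by split => //; [apply: le_trans n1 _|apply: le_trans n2' _]; rewrite ler_wpM2l.
Qed.

Lemma wd_wave_cts v (a b : R) s : continuous v -> supp_in a b v ->
  is_weak_deriv E (wave_zeta (Prim v) s) (fun x => - c^-1 ^+ 2 * wave_q v s x) /\
  is_weak_deriv E (wave_q (Prim v) s) (fun x => - wave_zeta v s x).
Proof.
move=> cv sv; have Pd := Prim_Cc_der cv sv.
have cP : continuous (Prim v) by exact: derive_cts Pd.
have [z1 q1] := wave_cts_L2 s cP; have [z2 q2] := wave_cts_L2 s cv.
have n0 x : l <= `|x| <= L -> x != 0.
  by move=> /andP[h _]; rewrite -normr_gt0; wlra.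
split; apply: (wd_classic l0 lL).
- by move=> x /n0 x0; exact: wave_zeta_der.
- by move=> x /n0 x0; apply: cvgM; [exact: cvg_cst|exact: wave_q_cts].
- exact: z1.
- exact: L2Z.
- by move=> x /n0 x0; exact: wave_q_der.
- by move=> x /n0 x0; apply: cvgN; exact: wave_zeta_cts.
- exact: q1.
- exact: L2N.
Qed.

(** The weak form passes to the limit from continuous signals, by [sig_dense]
    and [wd_closed]. *)
Lemma wd_wave (tau : R) v s : 0 < tau -> signal tau v ->
  is_weak_deriv E (wave_zeta (Prim v) s) (fun x => - c^-1 ^+ 2 * wave_q v s x) /\
  is_weak_deriv E (wave_q (Prim v) s) (fun x => - wave_zeta v s x).
Proof.
move=> tau0 hv.
have cP := Prim_cts hv.
have [z1 q1] := wave_cts_L2 s cP; have [z2 q2 _ _] := wave_sig s hv.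
have CW0 := wave_const_gt0.
pose K := wave_const * (tau * round_trip) + (1 + (- c^-1 ^+ 2) ^+ 2) * wave_const.
have K0 : 0 < K.
  apply: ltr_wpDl; first exact: mulr_ge0 (ltW CW0) (mulr_ge0 (ltW tau0) (ltW round_trip_gt0)).
  by rewrite mulr_gt0// ltr_wpDr// sqr_ge0.
have app e : 0 < e -> exists w, [/\ continuous w, signal tau w,
    exists a b, supp_in a b w &
    [/\ n2 E (fun x => wave_zeta (Prim v) s x - wave_zeta (Prim w) s x) < e,
        n2 E (fun x => wave_q (Prim v) s x - wave_q (Prim w) s x) < e,
        n2 E (fun x => wave_zeta v s x - wave_zeta w s x) < e &
        (- c^-1 ^+ 2) ^+ 2 * n2 E (fun x => wave_q v s x - wave_q w s x) < e]].
  move=> e0; have [w [h [h0 cw sw hw nw]]] := sig_dense tau0 hv (divr_gt0 e0 K0).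
  exists w; split => //; first by exists (0 + h), (tau - h).
  have hd := sigB hv hw.
  have eP : Prim (fun t => v t - w t) = (fun t => Prim v t - Prim w t).
    by apply/funext => t; exact: (Prim_sigB t hv hw).
  have nv := n2_ge0 setT (fun t => v t - w t).
  have lt k : 0 <= k -> k <= K -> k * n2 setT (fun t => v t - w t) < e.
    move=> k0 kK; apply: (@le_lt_trans _ _ (K * n2 setT (fun t => v t - w t))).
      by rewrite ler_wpM2r.
    by rewrite mulrC -ltr_pdivlMr.
  have PB t : t <= s -> `|Prim v t - Prim w t| <=
      Num.sqrt (tau * n2 setT (fun t => v t - w t)).
    move=> _; rewrite -sqrtr_sqr ler_sqrt ?mulr_ge0 ?(ltW tau0)//.
    by have := Prim_bound tau0 t hd; rewrite eP.
  have cPd : continuous (fun t => Prim v t - Prim w t).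
    by rewrite -eP; exact: Prim_cts hd.
  have := wave_bound cPd PB; rewrite sqr_sqrtr ?mulr_ge0 ?(ltW tau0)//.
  have -> : wave_const * (tau * n2 setT (fun t => v t - w t) * round_trip) =
     wave_const * (tau * round_trip) * n2 setT (fun t => v t - w t) by ring.
  have k10 : 0 <= wave_const * (tau * round_trip) := mulr_ge0 (ltW CW0) (mulr_ge0 (ltW tau0) (ltW round_trip_gt0)).
  have k20 : 0 <= (- c^-1 ^+ 2) ^+ 2 * wave_const by rewrite mulr_ge0 ?sqr_ge0 ?ltW.
  have KE : K = wave_const * (tau * round_trip) + wave_const + (- c^-1 ^+ 2) ^+ 2 * wave_const by rewrite /K; ring.
  have CW0' := ltW CW0.
  move=> [b1 b2]; have [_ _ b3 b4] := wave_sig s hd.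
  have l1 := lt (wave_const * (tau * round_trip)) k10; have l2 := lt wave_const CW0'.
  have l3 := lt ((- c^-1 ^+ 2) ^+ 2 * wave_const) k20.
  have fz f g : n2 E (fun x => wave_zeta f s x - wave_zeta g s x) = n2 E (wave_zeta (fun t => f t - g t) s).
    by congr n2; apply/funext => x; rewrite wave_zetaB.
  have fq f g : n2 E (fun x => wave_q f s x - wave_q g s x) = n2 E (wave_q (fun t => f t - g t) s).
    by congr n2; apply/funext => x; rewrite wave_qB.
  rewrite !fz !fq; split.
  - by apply: le_lt_trans b1 _; apply: l1; rewrite KE; lra.
  - by apply: le_lt_trans b2 _; apply: l1; rewrite KE; lra.
  - by apply: le_lt_trans b3 _; apply: l2; rewrite KE; lra.
  - apply: le_lt_trans (ler_wpM2l (sqr_ge0 _) b4) _; rewrite mulrA.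
    by apply: l3; rewrite KE; lra.
split; apply: (wd_closed mE ELL) => //.
- exact: L2Z.
- move=> e e0; have [w [cw hw [a [b sw]] [h1 _ _ h4]]] := app e e0.
  have cPw := Prim_cts hw.
  have [y1 _] := wave_cts_L2 s cPw; have [_ y2 _ _] := wave_sig s hw.
  exists (wave_zeta (Prim w) s), (fun x => - c^-1 ^+ 2 * wave_q w s x); split => //.
  + exact: L2Z.
  + by have [] := wd_wave_cts s cw sw.
  + have -> : (fun x => - c^-1 ^+ 2 * wave_q v s x - - c^-1 ^+ 2 * wave_q w s x) =
      (fun x => - c^-1 ^+ 2 * (wave_q v s x - wave_q w s x)) by apply/funext => x; ring.
    by rewrite n2Z//; exact: L2B.
- exact: L2N.
- move=> e e0; have [w [cw hw [a [b sw]] [_ h2 h3 _]]] := app e e0.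
  have cPw := Prim_cts hw.
  have [_ y1] := wave_cts_L2 s cPw; have [y2 _ _ _] := wave_sig s hw.
  exists (wave_q (Prim w) s), (fun x => - wave_zeta w s x); split => //.
  + exact: L2N.
  + by have [] := wd_wave_cts s cw sw.
  + have -> : (fun x => - wave_zeta v s x - - wave_zeta w s x) =
      (fun x => - (wave_zeta v s x - wave_zeta w s x)) by apply/funext => x; ring.
    by rewrite n2N.
Qed.

(** Time shifts the phases, so the error of the quotient is again a wave; its
    profile tends to 0 uniformly by [unif_der]. *)
Lemma wave_dquot v (a b e : R) s : continuous v -> supp_in a b v -> 0 < e ->
  exists2 d : R, 0 < d & forall h, h != 0 -> `|h| < d ->
    n2 E (fun x => h^-1 * (wave_zeta (Prim v) (s + h) x - wave_zeta (Prim v) s x) - wave_zeta v s x) < e /\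
    n2 E (fun x => h^-1 * (wave_q (Prim v) (s + h) x - wave_q (Prim v) s x) - wave_q v s x) < e.
Proof.
move=> cv sv e0.
have CW0 := wave_const_gt0.
pose r := Num.sqrt (e / (wave_const * round_trip * 2)).
have KT : 0 < wave_const * round_trip * 2 := mulr_gt0 (mulr_gt0 CW0 round_trip_gt0) (ltr0Sn _ 1).
have r0 : 0 < r by rewrite sqrtr_gt0 divr_gt0.
have rE : wave_const * (r ^+ 2 * round_trip) = e / 2.
  rewrite sqr_sqrtr; last by rewrite divr_ge0// ltW.
  have T00 := round_trip_gt0; move: T00 CW0; set a1 := round_trip; set a2 := wave_const => T00 CW0.
  by field; rewrite !gt_eqF.
have [d d0 dP] := unif_der cv sv r0.
have Pd := Prim_Cc_der cv sv.
have cP : continuous (Prim v) by exact: derive_cts Pd.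
exists d => // h hn hd.
pose f t := h^-1 * (Prim v (t + h) - Prim v t) - v t.
have cf : continuous f.
  apply: cts_sub; last exact: cv.
  apply: cts_mul; first exact: cts_cst.
  by apply: cts_sub; [exact: cts_shift|exact: cP].
have fB t : t <= s -> `|f t| <= r by move=> _; exact: dP.
have := wave_bound cf fB; rewrite rE => -[b1 b2].
have -> : (fun x => h^-1 * (wave_zeta (Prim v) (s + h) x - wave_zeta (Prim v) s x) - wave_zeta v s x) = wave_zeta f s.
  by apply/funext => x; rewrite /wave_zeta out_phaseD back_phaseD /f; field; rewrite hn gt_eqF.
have -> : (fun x => h^-1 * (wave_q (Prim v) (s + h) x - wave_q (Prim v) s x) - wave_q v s x) = wave_q f s.
  by apply/funext => x; rewrite /wave_q out_phaseD back_phaseD /f; field.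
by split; lra.
Qed.

End Wave.

(** * Waves are trajectories of the floating body *)

Section Aux.
Context {R : realType}.

Lemma is_derive_quot (f : R -> R) (x d : R) : is_derive x 1 f d ->
  (h^-1 * (f (x + h) - f x)) @[h --> (0 : R)^'] --> d.
Proof.
move=> fd.
have e : (fun h : R => h^-1 *: (f (h *: (1 : R) + x) - f x)) =
    (fun h => h^-1 * (f (x + h) - f x)).
  apply/funext => h; congr (_ * (f _ - _)); rewrite addrC; congr (_ + _).
  exact: mulr1.
have [h1 h2] := fd; move: h1; rewrite /derivable e => h1.
by move: h2; rewrite /derive e => <-.
Qed.

Lemma near_dnbhs (A : set R) : (exists2 d : R, 0 < d &
    forall h, h != 0 -> `|h| < d -> A h) -> \forall h \near (0 : R)^', A h.
Proof.
move=> [d d0 dP]; apply/nbhs_ballP; exists d => //= h; rewrite /ball/= sub0r normrN => hd h0.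
exact: dP.
Qed.

Lemma quot_sqr (f : R -> R) (x d e : R) : is_derive x 1 f d -> 0 < e ->
  \forall h \near (0 : R)^', (h^-1 * (f (x + h) - f x) - d) ^+ 2 < e.
Proof.
move=> /is_derive_quot fd e0.
have s0 : 0 < Num.sqrt e by rewrite sqrtr_gt0.
have /cvgrPdist_lt /(_ _ s0) := fd; apply: filterS => h H.
have : `|d - h^-1 * (f (x + h) - f x)| ^+ 2 < Num.sqrt e ^+ 2.
  by rewrite ltrXn2r ?nnegrE// ltW.
by rewrite sqr_sqrtr ?ltW// real_normK ?num_real// -sqrrN opprB.
Qed.

Lemma sum3_ge (x y z : R) : 0 <= x -> 0 <= y -> 0 <= z ->
  [/\ x <= x + y + z, y <= x + y + z & z <= x + y + z].
Proof. by move=> ? ? ?; split; lra. Qed.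

Lemma scale_sum_le (k B a b : R) : 0 <= k -> k <= B -> 0 <= a -> 0 <= b ->
  k * a <= B * (a + b) /\ k * b <= B * (a + b).
Proof.
move=> k0 kB a0 b0; have B0 := le_trans k0 kB.
by split; rewrite ler_pM// ?lerDl ?lerDr.
Qed.

Lemma share_lt (C K e a b : R) : 0 < C -> 0 < K -> 0 < e ->
  a < e / (2 * (C + K)) -> b < e / (2 * (C + K)) -> C * (a + b) < e.
Proof.
move=> C0 K0 e0 a1 b1.
have : C * (a + b) < C * (2 * (e / (2 * (C + K)))) by rewrite ltr_pM2l//; lra.
move=> h; apply: lt_le_trans h _.
have CK : 0 < C + K by lra.
have -> : C * (2 * (e / (2 * (C + K)))) = e * (C / (C + K)) by field; rewrite gt_eqF.
by rewrite ger_pMr// ler_pdivrMr// mul1r lerDl ltW.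
Qed.

Lemma lin_uf (m k q a b x y x' y' d d' : R) :
  m * ((a - b) - k * ((x - y + (x' - y')) / q - (d - d'))) =
  m * (a - k * ((x + x') / q - d)) - m * (b - k * ((y + y') / q - d')).
Proof. by ring. Qed.

End Aux.

Section Traj.
Context {R : realType} (p : params R).
Hypotheses (adm : admissible p) (LL : Lright p = Lleft p).
Implicit Types (f g v w P : R -> R) (s t x : R).

Local Notation l := (halfl p).
Local Notation L := (Lright p).
Local Notation E := (Edom p).
Local Notation M := (M_ p).
Definition celerity : R := Num.sqrt (grav p * h0 p).
Local Notation c := celerity.
Local Notation T0 := (round_trip l L c).
Local Notation zf := (wave_zeta l L c).
Local Notation qf := (wave_q l L c).
Local Notation etaf := (wave_eta l L c).
Local Notation deltaf := (wave_delta l L c).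
Local Notation N := (normX p).
Local Notation X := (spaceX p).

Lemma EdomE : E = two_sided l L.
Proof. by rewrite /Edom -LL. Qed.

Lemma celerity_gt0 : 0 < c.
Proof. by rewrite sqrtr_gt0 mulr_gt0 ?(g_gt0 adm) ?(h0_gt0 adm). Qed.

Lemma celerity_sqr : c ^+ 2 = grav p * h0 p.
Proof. by rewrite sqr_sqrtr// mulr_ge0 ?ltW ?(g_gt0 adm) ?(h0_gt0 adm). Qed.

Lemma halfl_lt_L : l < L.
Proof.
by have [_ [_ _ _ +] _ _ _] := adm; rewrite lt_min => /andP[].
Qed.

Let l0 := l_gt0 adm.
Let c0 := celerity_gt0.
Let lL_ := halfl_lt_L.
Let mE : mble E := mble_E p.

(** A state with mean discharge 0, given by its real and imaginary parts. *)
Definition rstate (z1 z2 q1 q2 : R -> R) (d1 d2 e1 e2 : R) : state R :=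
  mkstate (fun x => z1 x +i* z2 x) (fun x => q1 x +i* q2 x) 0 (d1 +i* d2) (e1 +i* e2).

Lemma rstateB z1 z2 q1 q2 d1 d2 e1 e2 z1' z2' q1' q2' d1' d2' e1' e2' :
  rstate z1 z2 q1 q2 d1 d2 e1 e2 - rstate z1' z2' q1' q2' d1' d2' e1' e2' =
  rstate (fun x => z1 x - z1' x) (fun x => z2 x - z2' x) (fun x => q1 x - q1' x)
     (fun x => q2 x - q2' x) (d1 - d1') (d2 - d2') (e1 - e1') (e2 - e2').
Proof.
by apply: stateP; rewrite !stE //=; exact: subr0.
Qed.

Lemma rstateZ (k : R) z1 z2 q1 q2 d1 d2 e1 e2 :
  k%:C *: rstate z1 z2 q1 q2 d1 d2 e1 e2 =
  rstate (fun x => k * z1 x) (fun x => k * z2 x) (fun x => k * q1 x)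
     (fun x => k * q2 x) (k * d1) (k * d2) (k * e1) (k * e2).
Proof.
have e (a b : R) : k%:C * (a +i* b) = (k * a) +i* (k * b).
  by apply: complexP; rewrite ?Re_realM ?Im_realM.
by apply: stateP; rewrite !stE /=; [apply/funext => x|apply/funext => x|exact: mulr0| |];
  exact: e.
Qed.

Lemma rstate_preX z1 z2 q1 q2 d1 d2 e1 e2 : L2 E z1 -> L2 E z2 -> L2 E q1 -> L2 E q2 ->
  preX p (rstate z1 z2 q1 q2 d1 d2 e1 e2).
Proof. by move=> ? ? ? ?; split; split. Qed.

Lemma rstate_norm z1 z2 q1 q2 d1 d2 e1 e2 : L2 E z1 -> L2 E z2 -> L2 E q1 -> L2 E q2 ->
  N (rstate z1 z2 q1 q2 d1 d2 e1 e2) ^+ 2 =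
  rho p * grav p / 2 * (n2 E z1 + n2 E z2) + rho p / (2 * h0 p) * (n2 E q1 + n2 E q2) +
  rho p * grav p * l * (d1 ^+ 2 + d2 ^+ 2) + M / 2 * (e1 ^+ 2 + e2 ^+ 2).
Proof.
move=> h1 h2 h3 h4; have hp := rstate_preX d1 d2 e1 e2 h1 h2 h3 h4.
rewrite normX_sqr// rip_self//.
by rewrite /rstate /qi /= expr0n /= addr0 mulr0 addr0.
Qed.

Definition wave_state P1 P2 s : state R :=
  rstate (zf P1 s) (zf P2 s) (qf P1 s) (qf P2 s) (deltaf P1 s) (deltaf P2 s)
     (etaf P1 s) (etaf P2 s).

Definition wave_state_dt v1 v2 s : state R :=
  rstate (zf v1 s) (zf v2 s) (qf v1 s) (qf v2 s) (etaf (Prim v1) s) (etaf (Prim v2) s)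
     (etaf v1 s) (etaf v2 s).

Definition buoyancy : R := 2 * rho p * grav p * l / M.

(** The input that the last equation of the system prescribes for the wave of
    profile [Prim v]. *)
Definition force v s : R :=
  M * (etaf v s - buoyancy * ((Prim v s + Prim v (s - T0)) / (2 * c) - deltaf (Prim v) s)).

Definition cforce v1 v2 s : R[i] := force v1 s +i* force v2 s.

Variable tau : R.
Hypothesis tau0 : 0 < tau.
Local Notation sig := (signal tau).

Lemma rstate_X z1 z2 q1 q2 d1 d2 e1 e2 : L2 E z1 -> L2 E z2 -> L2 E q1 -> L2 E q2 ->
  \int[leb]_(x in E) z1 x = - (2 * l) * d1 -> \int[leb]_(x in E) z2 x = - (2 * l) * d2 ->
  X (rstate z1 z2 q1 q2 d1 d2 e1 e2).
Proof.
move=> h1 h2 h3 h4 v1 v2; have [p1 p2] := rstate_preX d1 d2 e1 e2 h1 h2 h3 h4.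
split => //; apply: complexP; rewrite ?ReD ?ImD ?Re_realM ?Im_realM /=.
  by rewrite v1 mulNr addNr.
by rewrite v2 mulNr addNr.
Qed.

Lemma Prim_sig_neg v t : sig v -> t < 0 -> Prim v t = 0.
Proof. by move=> hv; apply: Prim_left => x; exact: (sig_left hv). Qed.

Lemma wave_state_X v1 v2 s : sig v1 -> sig v2 -> X (wave_state (Prim v1) (Prim v2) s).
Proof.
move=> h1 h2.
have [c1 c2] := (Prim_cts h1, Prim_cts h2).
have := wave_cts_L2 l0 lL_ c0 s c1; have := wave_cts_L2 l0 lL_ c0 s c2; rewrite -EdomE.
move=> [z1 q1] [z2 q2]; apply: rstate_X => //; rewrite EdomE;
  by rewrite (wave_zeta_volume l0 lL_ c0)// => t; exact: Prim_sig_neg.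
Qed.

Lemma wave_state_dt_X v1 v2 s : sig v1 -> sig v2 -> continuous v1 -> continuous v2 ->
  X (wave_state_dt v1 v2 s).
Proof.
move=> h1 h2 c1 c2.
have := wave_cts_L2 l0 lL_ c0 s c1; have := wave_cts_L2 l0 lL_ c0 s c2; rewrite -EdomE.
move=> [z1 q1] [z2 q2]; apply: rstate_X => //; rewrite EdomE.
  by rewrite (wave_zeta_volume l0 lL_ c0)// => t; exact: (sig_left h1).
by rewrite (wave_zeta_volume l0 lL_ c0)// => t; exact: (sig_left h2).
Qed.

Lemma ctrace_z P1 P2 s x : `|x| = l \/ `|x| = L -> continuous P1 -> continuous P2 ->
  ctrace E (fun y => zf P1 s y +i* zf P2 s y) x = zf P1 s x +i* zf P2 s x.
Proof.
move=> xE c1 c2; rewrite /ctrace EdomE.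
rewrite (@trace_wave _ l L c l0 lL_ c0 _ (zf P1 s) x xE); first last.
- exact: ae_of_eq.
- by move=> y _; exact: wave_zeta_cts.
rewrite (@trace_wave _ l L c l0 lL_ c0 _ (zf P2 s) x xE) //.
- by move=> y _; exact: wave_zeta_cts.
- exact: ae_of_eq.
Qed.

Lemma ctrace_q P1 P2 s x : `|x| = l \/ `|x| = L -> continuous P1 -> continuous P2 ->
  ctrace E (fun y => qf P1 s y +i* qf P2 s y) x = qf P1 s x +i* qf P2 s x.
Proof.
move=> xE c1 c2; rewrite /ctrace EdomE.
rewrite (@trace_wave _ l L c l0 lL_ c0 _ (qf P1 s) x xE); first last.
- exact: ae_of_eq.
- by move=> y y0; exact: wave_q_cts.
rewrite (@trace_wave _ l L c l0 lL_ c0 _ (qf P2 s) x xE) //.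
- by move=> y y0; exact: wave_q_cts.
- exact: ae_of_eq.
Qed.

Let nl : `|l| = l \/ `|l| = L. Proof. by left; rewrite gtr0_norm. Qed.
Let nNl : `|- l| = l \/ `|- l| = L. Proof. by left; rewrite normrN gtr0_norm. Qed.
Let L0 : 0 < L. Proof. exact: lt_trans halfl_lt_L. Qed.
Let nL : `|L| = l \/ `|L| = L. Proof. by right; rewrite gtr0_norm. Qed.
Let nNL : `|- L| = l \/ `|- L| = L. Proof. by right; rewrite normrN gtr0_norm. Qed.

Lemma wave_state_W v1 v2 s : sig v1 -> sig v2 -> spaceW p (wave_state (Prim v1) (Prim v2) s).
Proof.
move=> h1 h2.
have [c1 c2] := (Prim_cts h1, Prim_cts h2).
have [_ _ vol] := wave_state_X s h1 h2.
have [z1 q1] := wave_cts_L2 l0 lL_ c0 s c1; have [z2 q2] := wave_cts_L2 l0 lL_ c0 s c2.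
have [a1 a2 _ _] := wave_sig l0 lL_ c0 s h1; have [b1 b2 _ _] := wave_sig l0 lL_ c0 s h2.
have [w1 w2] := wd_wave l0 lL_ c0 s tau0 h1; have [y1 y2] := wd_wave l0 lL_ c0 s tau0 h2.
have mEE := @mble_two_sided _ l L.
split => //.
- rewrite EdomE; split; split.
  + split => //; exists (fun x => - c^-1 ^+ 2 * qf v1 s x); split => //; exact: L2Z.
  + split => //; exists (fun x => - c^-1 ^+ 2 * qf v2 s x); split => //; exact: L2Z.
  + split => //; exists (fun x => - zf v1 s x); split => //; exact: L2N.
  + split => //; exists (fun x => - zf v2 s x); split => //; exact: L2N.
- rewrite /jump [ctrace _ _ l]ctrace_q// [ctrace _ _ (- l)]ctrace_q//.
  rewrite !wave_q_l// !wave_q_Nl//; apply: complexP; rewrite -?rmorphN ?Re_realM ?Im_realM /=.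
  + by rewrite /etaf; field; rewrite gt_eqF.
  + by rewrite /etaf; field; rewrite gt_eqF.
- rewrite /average [ctrace _ _ l]ctrace_q// [ctrace _ _ (- l)]ctrace_q//.
  rewrite !wave_q_l// !wave_q_Nl//; apply: complexP; rewrite ?Re_realM ?Im_realM /=;
  by rewrite subrr mulr0.
- rewrite -LL [ctrace _ _ (- L)]ctrace_q// [ctrace _ _ L]ctrace_q//.
  by have [-> ->] := wave_q_L l0 lL_ c0 (Prim v1) s; have [-> ->] := wave_q_L l0 lL_ c0 (Prim v2) s.
Qed.

Lemma wave_state_S v1 v2 s : sig v1 -> sig v2 -> spaceS p (wave_state (Prim v1) (Prim v2) s).
Proof.
move=> h1 h2; have [p1 p2 _] := wave_state_X s h1 h2; split => //.
- by apply: ae_of_eq => x _; rewrite /zeta/= !wave_zeta_even.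
- by apply: ae_of_eq => x; rewrite EdomE => Ex; rewrite /q_/= !(wave_q_odd l0 lL_).
Qed.

Lemma wd_weak (D : set R) f : H1 D f ->
  L2 D (weak_deriv D f) /\ is_weak_deriv D f (weak_deriv D f).
Proof.
move=> [_ [df hdf]]; rewrite /weak_deriv.
by case: xgetP => [y -> //|/(_ df)]; case.
Qed.

Lemma weak_deriv_ae f df : H1 E f -> L2 E df -> is_weak_deriv E f df ->
  weak_deriv E f = df %[ae leb in E].
Proof.
move=> /wd_weak[]; rewrite EdomE => l1 w1 l2 w2.
exact: (wd_unique_two_sided lL_ l1 l2 w1 w2).
Qed.

Lemma cae_pair (D : set R) (f1 f2 g1 g2 : R -> R) : f1 = g1 %[ae leb in D] ->
  f2 = g2 %[ae leb in D] ->
  (fun x => f1 x +i* f2 x) = (fun x => g1 x +i* g2 x) %[ae leb in D].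
Proof. by move=> h1 h2; apply: cae_conj. Qed.

Lemma Re_realNM (k : R) (w : R[i]) : Re (- k%:C * w) = - k * Re w.
Proof. by rewrite !mulNr ReN Re_realM. Qed.

Lemma Im_realNM (k : R) (w : R[i]) : Im (- k%:C * w) = - k * Im w.
Proof. by rewrite !mulNr ImN Im_realM. Qed.

(** The first two components are the wave equations in weak form, the other
    ones follow from the traces at the object. *)
Lemma opA_wave_state v1 v2 s : sig v1 -> sig v2 ->
  [/\ preX p (opA p (wave_state (Prim v1) (Prim v2) s)) &
  eq_state p (opA p (wave_state (Prim v1) (Prim v2) s))
   (rstate (zf v1 s) (zf v2 s) (qf v1 s) (qf v2 s) (etaf (Prim v1) s) (etaf (Prim v2) s)
     (buoyancy * ((Prim v1 s + Prim v1 (s - T0)) / (2 * c) - deltaf (Prim v1) s))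
     (buoyancy * ((Prim v2 s + Prim v2 (s - T0)) / (2 * c) - deltaf (Prim v2) s)))].
Proof.
move=> h1 h2.
have [[[z1 z2] [q1 q2]] _ _ _ _] := wave_state_W s h1 h2.
have [c1 c2] := (Prim_cts h1, Prim_cts h2).
have := wave_sig l0 lL_ c0 s h1; have := wave_sig l0 lL_ c0 s h2.
have := wd_wave l0 lL_ c0 s tau0 h1; have := wd_wave l0 lL_ c0 s tau0 h2.
rewrite -EdomE => -[y1 y2] [w1 w2] [b1 b2 _ _] [a1 a2 _ _].
have e1 := weak_deriv_ae z1 (L2Z _ mE a2) w1.
have e2 := weak_deriv_ae z2 (L2Z _ mE b2) y1.
have e3 := weak_deriv_ae q1 (L2N mE a1) w2.
have e4 := weak_deriv_ae q2 (L2N mE b1) y2.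
have [[m1 _] [m2 _]] := (wd_weak z1, wd_weak z2).
have [[m3 _] [m4 _]] := (wd_weak q1, wd_weak q2).
split.
- split.
    split; first exact: (L2N mE m3).
    exact: (L2N mE m4).
  split.
    have := L2Z (- (grav p * h0 p)) mE m1; congr L2; apply/funext => x.
    by symmetry; exact: Re_realNM.
  have := L2Z (- (grav p * h0 p)) mE m2; congr L2; apply/funext => x.
  by symmetry; exact: Im_realNM.
split.
- apply: (ae_eq_imp _ (cae_pair e3 e4)) => x Ex h.
  move: h; rewrite /opA /zeta /= /cweak_deriv /= => ->.
  by apply: complexP; rewrite /= opprK.
- apply: (ae_eq_imp _ (cae_pair e1 e2)) => x Ex h.
  move: h; rewrite /opA /q_ /= /cweak_deriv /= => ->.
  have cn : c ^+ 2 != 0 by rewrite expf_neq0// gt_eqF.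
  rewrite mulNr; apply: complexP; rewrite ?ReN ?ImN ?Re_realM ?Im_realM /= -celerity_sqr; field; rewrite gt_eqF//.
- rewrite /opA /qi /= /jump [ctrace _ _ l]ctrace_z// [ctrace _ _ (- l)]ctrace_z//.
  by rewrite !wave_zeta_even subrr mulr0.
- by [].
- rewrite /opA /delta /eta /= /average [ctrace _ _ l]ctrace_z// [ctrace _ _ (- l)]ctrace_z//.
  rewrite !wave_zeta_even !wave_zeta_l//.
  apply: complexP; rewrite ?Re_realM ?Im_realM /= -/buoyancy.
    by congr (_ * _); congr (_ - _); rewrite /=; field; rewrite gt_eqF.
  by congr (_ * _); congr (_ - _); rewrite /=; field; rewrite gt_eqF.
Qed.

Lemma Prim0 f : (forall t, t < 0 -> f t = 0) -> Prim f 0 = 0.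
Proof. by move=> f0; rewrite (Prim_int 0 f0)// set_itv1 Rintegral_set1. Qed.

Lemma P_nonpos v t : sig v -> t <= 0 -> Prim v t = 0.
Proof.
move=> hv; rewrite le_eqVlt => /orP[/eqP ->|t0]; last exact: Prim_sig_neg.
by apply: Prim0 => u; exact: (sig_left hv).
Qed.

Lemma PP_nonpos v t : sig v -> t <= 0 -> Prim (Prim v) t = 0.
Proof.
move=> hv; have pn u : u < 0 -> Prim v u = 0 by exact: Prim_sig_neg.
rewrite le_eqVlt => /orP[/eqP ->|t0]; first exact: Prim0.
exact: (Prim_left pn t0).
Qed.

Lemma PP_der v t : sig v -> is_derive t 1 (Prim (Prim v)) (Prim v t).
Proof.
move=> hv; have cP := Prim_cts hv; apply: Prim_der; first exact: cP.
by move=> u; apply: (left_cts_int u cP (fun y y0 => Prim_sig_neg hv y0)).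
Qed.

Lemma wave_eta_der P v s : (forall t, is_derive t 1 P (v t)) ->
  is_derive s 1 (etaf P) (etaf v s).
Proof.
move=> Pv.
have d1 : is_derive s 1 (fun x => P (x - T0)) (v (s - T0)).
  have := @is_derive_aff R P (v (1 * s + - T0)) 1 (- T0) s (Pv _).
  by rewrite !mul1r; congr is_derive; apply/funext => y; rewrite mul1r.
have := is_deriveZ (2 * l)^-1 (is_deriveB d1 (Pv s)).
rewrite /GRing.scale /= /etaf; set g := (X in is_derive _ _ X _ -> _).
have -> : g = (fun s0 => (P (s0 - T0) - P s0) / (2 * l)).
  by apply/funext => y; rewrite mulrC.
by rewrite [X in is_derive _ _ _ X -> _]mulrC.
Qed.

Lemma wave_state_quot P1 P2 v1 v2 s h :
  (h^-1)%:C *: (wave_state P1 P2 (s + h) - wave_state P1 P2 s) -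
    rstate (zf v1 s) (zf v2 s) (qf v1 s) (qf v2 s) (etaf P1 s) (etaf P2 s)
     (etaf v1 s) (etaf v2 s) =
  rstate (fun x => h^-1 * (zf P1 (s + h) x - zf P1 s x) - zf v1 s x)
     (fun x => h^-1 * (zf P2 (s + h) x - zf P2 s x) - zf v2 s x)
     (fun x => h^-1 * (qf P1 (s + h) x - qf P1 s x) - qf v1 s x)
     (fun x => h^-1 * (qf P2 (s + h) x - qf P2 s x) - qf v2 s x)
     (h^-1 * (deltaf P1 (s + h) - deltaf P1 s) - etaf P1 s)
     (h^-1 * (deltaf P2 (s + h) - deltaf P2 s) - etaf P2 s)
     (h^-1 * (etaf P1 (s + h) - etaf P1 s) - etaf v1 s)
     (h^-1 * (etaf P2 (s + h) - etaf P2 s) - etaf v2 s).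
Proof. by rewrite /wave_state rstateB rstateZ rstateB. Qed.

Definition norm_const : R := rho p * grav p + rho p / h0 p + 2 * (rho p * grav p * l) + M.

Lemma norm_const_gt0 : 0 < norm_const.
Proof.
have g0 := g_gt0 adm; have r0 := rho_gt0 adm; have hh := h0_gt0 adm.
have m0 := M_gt0 adm.
have a : 0 < rho p * grav p by exact: mulr_gt0.
have b : 0 < rho p / h0 p by exact: divr_gt0.
have d : 0 < rho p * grav p * l by exact: mulr_gt0.
by rewrite /norm_const; lra.
Qed.

(** One bound for all components is enough for the limits below. *)
Lemma rstate_norm_le (e : R) z1 z2 q1 q2 d1 d2 e1 e2 :
  L2 E z1 -> L2 E z2 -> L2 E q1 -> L2 E q2 ->
  n2 E z1 <= e -> n2 E z2 <= e -> n2 E q1 <= e -> n2 E q2 <= e ->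
  d1 ^+ 2 <= e -> d2 ^+ 2 <= e -> e1 ^+ 2 <= e -> e2 ^+ 2 <= e ->
  N (rstate z1 z2 q1 q2 d1 d2 e1 e2) ^+ 2 <= norm_const * e.
Proof.
move=> h1 h2 h3 h4 a1 a2 a3 a4 a5 a6 a7 a8.
rewrite rstate_norm//.
have g0 := g_gt0 adm; have r0 := rho_gt0 adm; have hh := h0_gt0 adm.
have m0 := M_gt0 adm.
have b1 : 0 < rho p * grav p by exact: mulr_gt0.
have b2 : 0 < rho p / h0 p by exact: divr_gt0.
have b3 : 0 < rho p * grav p * l by exact: mulr_gt0.
have -> : rho p / (2 * h0 p) = rho p / h0 p / 2 by field; rewrite gt_eqF.
have key (k a b : R) : 0 < k -> a <= e -> b <= e -> k * (a + b) <= k * (2 * e).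
  by move=> k0 ? ?; rewrite ler_pM2l//; lra.
have c1 := key _ _ _ (divr_gt0 b1 (ltr0Sn _ 1)) a1 a2.
have c2 := key _ _ _ (divr_gt0 b2 (ltr0Sn _ 1)) a3 a4.
have c3 := key _ _ _ b3 a5 a6.
have c4 := key _ _ _ (divr_gt0 m0 (ltr0Sn _ 1)) a7 a8.
have -> : norm_const * e = rho p * grav p / 2 * (2 * e) + rho p / h0 p / 2 * (2 * e) +
  rho p * grav p * l * (2 * e) + M / 2 * (2 * e) by rewrite /norm_const; field; rewrite gt_eqF.
by apply: lerD c4; apply: lerD c3; apply: lerD c2.
Qed.

(** By [wave_dquot] for the fluid, and by the differentiability of primitives
    for the object. *)
Lemma wave_state_der v1 v2 (a b a' b' : R) s : sig v1 -> sig v2 -> continuous v1 -> continuous v2 ->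
  supp_in a b v1 -> supp_in a' b' v2 ->
  N ((h^-1)%:C *: (wave_state (Prim v1) (Prim v2) (s + h) - wave_state (Prim v1) (Prim v2) s)
     - wave_state_dt v1 v2 s) @[h --> (0 : R)^'] --> (0 : R).
Proof.
move=> h1 h2 c1 c2 s1 s2.
have K0 := norm_const_gt0.
have [cP1 cP2] := (Prim_cts h1, Prim_cts h2).
have L2q P v r h : continuous P -> continuous v ->
    L2 E (fun x => h^-1 * (zf P r x - zf P s x) - zf v s x) /\
    L2 E (fun x => h^-1 * (qf P r x - qf P s x) - qf v s x).
  move=> cP cv; have [u1 u2] := wave_cts_L2 l0 lL_ c0 r cP.
  have [u3 u4] := wave_cts_L2 l0 lL_ c0 s cP.
  have [u5 u6] := wave_cts_L2 l0 lL_ c0 s cv.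
  rewrite -EdomE in u1 u2 u3 u4 u5 u6.
  split; apply: (L2B mE) => //; apply: (L2Z _ mE); exact: (L2B mE).
apply/cvgrPdist_lt => e e0.
pose e' := e ^+ 2 / (2 * norm_const).
have e'0 : 0 < e' by rewrite divr_gt0 ?exprn_gt0// mulr_gt0.
have n1 := near_dnbhs (wave_dquot l0 lL_ c0 s c1 s1 e'0).
have n2 := near_dnbhs (wave_dquot l0 lL_ c0 s c2 s2 e'0).
rewrite -EdomE in n1 n2.
have n3 := quot_sqr (wave_eta_der s (fun t => PP_der t h1)) e'0.
have n4 := quot_sqr (wave_eta_der s (fun t => PP_der t h2)) e'0.
have n5 := quot_sqr (wave_eta_der s (fun t => Prim_Cc_der c1 s1 t)) e'0.
have n6 := quot_sqr (wave_eta_der s (fun t => Prim_Cc_der c2 s2 t)) e'0.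
have F : Filter (nbhs (0 : R)^') by exact: filter_filter.
have I := @filterI _ _ F.
have := I _ _ n1 (I _ _ n2 (I _ _ n3 (I _ _ n4 (I _ _ n5 n6)))).
apply: (@filterS _ _ F) => h [[y1 y2] [[y3 y4] [y5 [y6 [y7 y8]]]]].
rewrite sub0r normrN ger0_norm ?normX_ge0// -(@ltr_pXn2r _ 2)// ?nnegrE ?normX_ge0 ?(ltW e0)//.
rewrite wave_state_quot.
have [l1 l2] := L2q (Prim v1) v1 (s + h) h cP1 c1.
have [l3 l4] := L2q (Prim v2) v2 (s + h) h cP2 c2.
apply: (@le_lt_trans _ _ (norm_const * e')).
  exact: (rstate_norm_le l1 l3 l2 l4 (ltW y1) (ltW y3) (ltW y2) (ltW y4)
    (ltW y5) (ltW y6) (ltW y7) (ltW y8)).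
rewrite /e'; have -> : norm_const * (e ^+ 2 / (2 * norm_const)) = e ^+ 2 / 2 by field; rewrite gt_eqF.
by rewrite ltr_pdivrMr// ltr_pMr ?exprn_gt0// ltr1n.
Qed.

Lemma force_cts v : sig v -> continuous v -> continuous (force v).
Proof.
move=> hv cv; have cP := Prim_cts hv.
have cPP : continuous (Prim (Prim v)) := derive_cts (fun t => PP_der t hv).
have ce P : continuous P -> continuous (etaf P).
  move=> cp; apply: cts_mul; last exact: cts_cst.
  by apply: cts_sub => //; exact: cts_shift.
apply: cts_mul; first exact: cts_cst.
apply: cts_sub; first exact: ce.
apply: cts_mul; first exact: cts_cst.
apply: cts_sub; last exact: ce.
apply: cts_mul; last exact: cts_cst.
by apply: cts_add => //; exact: cts_shift.
Qed.

Lemma X_eq (z w : state R) : preX p z -> X w -> eq_state p z w -> X z.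
Proof.
move=> [p1 p2] [[a1 a2] _ vol] [h _ _ h4 _]; split => //.
rewrite h4 -vol; congr (_ + _); apply: complexP => /=;
  apply: Rint_ae => //; first [exact: p1.1.1|exact: p1.2.1|exact: a1.1|exact: a2.1|idtac];
  by apply: (ae_eq_imp _ h) => x _ ->.
Qed.

Lemma opA_wave_state_X v1 v2 s : sig v1 -> sig v2 -> continuous v1 -> continuous v2 ->
  X (opA p (wave_state (Prim v1) (Prim v2) s)).
Proof.
move=> h1 h2 c1 c2; have [pA eA] := opA_wave_state s h1 h2.
by have [q1 q2 q3] := wave_state_dt_X s h1 h2 c1 c2; apply: X_eq pA _ eA.
Qed.

(** The definition of [force] cancels everything but [wave_eta v] in the last
    component. *)
Lemma wave_state_dt_eq v1 v2 s : sig v1 -> sig v2 ->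
  eq_state p (wave_state_dt v1 v2 s) (opA p (wave_state (Prim v1) (Prim v2) s) + cforce v1 v2 s *: opB p).
Proof.
move=> h1 h2; have [_ [e1 e2 e3 e4 e5]] := opA_wave_state s h1 h2.
split; rewrite !stE.
- apply: (ae_eq_imp _ e1) => x Ex h.
  by rewrite h// /opB /= mulr0 addr0.
- apply: (ae_eq_imp _ e2) => x Ex h.
  by rewrite h// /opB /= mulr0 addr0.
- by rewrite e3 /opB /= /qi/= mulr0 addr0.
- by rewrite e4 /opB /= /delta/= mulr0 addr0.
- have mn : M != 0 by rewrite gt_eqF// (M_gt0 adm).
  rewrite e5 /opB /= /eta/= [cforce _ _ _ * _]mulrC; apply: complexP;
    rewrite ?ReD ?ImD ?Re_realM ?Im_realM /= /force mulKf//; ring.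
Qed.

Lemma n2_eq0_on (D : set R) f : (forall x, D x -> f x = 0) -> n2 D f = 0.
Proof.
move=> f0; rewrite /n2 /Rintegral integral0_eq// => x Dx.
by rewrite f0// expr0n.
Qed.

Lemma wave_state0_norm v1 v2 : sig v1 -> sig v2 -> N (wave_state (Prim v1) (Prim v2) 0) = 0.
Proof.
move=> h1 h2; have [c1 c2] := (Prim_cts h1, Prim_cts h2).
have [z1 q1] := wave_cts_L2 l0 lL_ c0 0 c1; have [z2 q2] := wave_cts_L2 l0 lL_ c0 0 c2.
rewrite -EdomE in z1 q1 z2 q2.
have t0 : 0 - T0 <= 0 by rewrite sub0r oppr_le0 ltW// (round_trip_gt0 lL_ c0).
have zz v : sig v -> n2 E (zf (Prim v) 0) = 0 /\ n2 E (qf (Prim v) 0) = 0 /\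
    deltaf (Prim v) 0 = 0 /\ etaf (Prim v) 0 = 0.
  move=> hv; rewrite EdomE; split.
    apply: n2_eq0_on => x /(phases_in l0 lL_ c0 0)[/andP[_ a1] /andP[_ a2]].
    by rewrite /wave_zeta !P_nonpos// addr0 mul0r.
  split.
    apply: n2_eq0_on => x /(phases_in l0 lL_ c0 0)[/andP[_ a1] /andP[_ a2]].
    by rewrite /wave_q !P_nonpos// subr0 mul0r mulr0.
  by rewrite /wave_delta /wave_eta !PP_nonpos// !P_nonpos// subr0 mul0r.
have [a1 [a2 [a3 a4]]] := zz _ h1; have [b1 [b2 [b3 b4]]] := zz _ h2.
apply/eqP; rewrite -sqrf_eq0; apply/eqP; rewrite rstate_norm//.
by rewrite a1 a2 a3 a4 b1 b2 b3 b4 expr0n /= addr0 !mulr0 !addr0.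
Qed.

Variable T : R -> state R -> state R.
Hypotheses (ug : unitary_group p T) (gen : generated_by_A p T).
Local Notation I := (`[0, tau]%classic : set R).
Let mI : mble I. Proof. exact: mble_itv. Qed.
Let IS : I `<=` `[0, tau]. Proof. by []. Qed.

(** The wave is a differentiable solution starting from rest, and [duhamel]
    applies. *)
Lemma input_smooth v1 v2 (h1 h2 : R) : 0 < h1 -> 0 < h2 ->
  continuous v1 -> continuous v2 ->
  supp_in (0 + h1) (tau - h1) v1 -> supp_in (0 + h2) (tau - h2) v2 ->
  input_map p T tau (cforce v1 v2) (wave_state (Prim v1) (Prim v2) tau).
Proof.
move=> p1 p2 c1 c2 s1 s2.
have hv1 := sig_Cc p1 c1 s1; have hv2 := sig_Cc p2 c2 s2.
have u1 := force_cts hv1 c1; have u2 := force_cts hv2 c2.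
have hu : cL2 I (cforce v1 v2).
  by split; [exact: (L2_cts mI IS u1)|exact: (L2_cts mI IS u2)].
apply/(input_mapP adm ug tau0 _ hu); split; first exact: wave_state_X.
move=> w hw.
have ZX s := wave_state_X s hv1 hv2.
rewrite (duhamel adm ug gen tau0 hw ZX (fun s => wave_state_dt_X s hv1 hv2 c1 c2)
  (fun s => wave_state_W s hv1 hv2) (fun s => opA_wave_state_X s hv1 hv2 c1 c2)
  (fun s => wave_state_der s hv1 hv2 c1 c2 s1 s2) (fun s => wave_state_dt_eq s hv1 hv2) u1 u2).
  rewrite /pairing; apply: eq_Rintegral => s _.
  by rewrite (rip_scale adm (cforce v1 v2 s) (X_B p) (T_X ug _ hw)).
move=> y hy; apply/eqP; rewrite -normr_le0.
have := rip_CS adm (X_preX (ZX 0)) (X_preX hy).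
by rewrite wave_state0_norm// mul0r.
Qed.

Lemma le_of_eq (x y : R) : x = y -> x <= y. Proof. by move=> ->. Qed.

Lemma sqrD_le (a b x y : R) : a ^+ 2 <= x -> b ^+ 2 <= y -> (a + b) ^+ 2 <= 2 * (x + y).
Proof. by move=> ? ?; have := sqr_ge0 (a - b); nra. Qed.

Lemma sqrB_le (a b x y : R) : a ^+ 2 <= x -> b ^+ 2 <= y -> (a - b) ^+ 2 <= 2 * (x + y).
Proof. by move=> ? ?; have := sqr_ge0 (a + b); nra. Qed.

Lemma wave_Prim_bound : exists2 C : R, 0 <= C & forall v s, sig v ->
  n2 E (zf (Prim v) s) <= C * n2 setT v /\ n2 E (qf (Prim v) s) <= C * n2 setT v.
Proof.
have CW0 := ltW (wave_const_gt0 c0); have T00 := ltW (round_trip_gt0 lL_ c0).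
exists (wave_const c * (tau * T0)); first exact: mulr_ge0 CW0 (mulr_ge0 (ltW tau0) T00).
move=> v s hv; rewrite EdomE.
have nv := n2_ge0 setT v.
have PB t : t <= s -> `|Prim v t| <= Num.sqrt (tau * n2 setT v).
  move=> _; rewrite -sqrtr_sqr ler_sqrt ?(mulr_ge0 (ltW tau0) nv)//.
  exact: (Prim_bound tau0 t hv).
have := wave_bound l0 lL_ c0 (Prim_cts hv) PB.
rewrite sqr_sqrtr ?(mulr_ge0 (ltW tau0) nv)//.
by have -> : wave_const c * (tau * n2 setT v * T0) = wave_const c * (tau * T0) * n2 setT v by ring.
Qed.

(** The volume constraint gives a bound that does not grow with time, unlike
    integration of the velocity. *)
Lemma wave_delta_bound : exists2 C : R, 0 <= C & forall v s, sig v ->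
  deltaf (Prim v) s ^+ 2 <= C * n2 setT v.
Proof.
have [C C0 H] := wave_Prim_bound.
have fE : (leb (two_sided l L) < +oo)%E := fin_sub (@mble_two_sided _ _ _) (two_sided_sub l0).
have mEE := @mble_two_sided _ l L.
have l2 : 0 < 2 * l by rewrite mulr_gt0.
have mf : 0 <= fine (leb (two_sided l L)) by rewrite fine_ge0.
exists (fine (leb (two_sided l L)) * C / (2 * l) ^+ 2).
  by rewrite divr_ge0 ?exprn_ge0 ?(ltW l2)// mulr_ge0.
move=> v s hv; have [z1 _] := H v s hv.
have [y1 _] := wave_cts_L2 l0 lL_ c0 s (Prim_cts hv).
have := int_sqr_le mEE fE y1.
rewrite (wave_zeta_volume l0 lL_ c0 s (Prim_cts hv) (fun t => @Prim_sig_neg v t hv)).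
rewrite -EdomE in mf *.
rewrite mulNr sqrrN exprMn => h.
have -> : fine (leb E) * C / (2 * l) ^+ 2 * n2 setT v = fine (leb E) * (C * n2 setT v) / (2 * l) ^+ 2.
  by ring.
rewrite ler_pdivlMr ?exprn_gt0// mulrC; apply: le_trans h _.
by rewrite ler_wpM2l.
Qed.

Lemma wave_state_bound : exists2 C : R, 0 < C & forall v1 v2 s, sig v1 -> sig v2 ->
  N (wave_state (Prim v1) (Prim v2) s) ^+ 2 <= C * (n2 setT v1 + n2 setT v2).
Proof.
have [C C0 H] := wave_Prim_bound; have [D D0 G] := wave_delta_bound.
have K0 := norm_const_gt0.
have tl : 0 <= tau / l ^+ 2 by rewrite divr_ge0 ?exprn_ge0 ?ltW.
have et v s : sig v -> etaf (Prim v) s ^+ 2 <= tau / l ^+ 2 * n2 setT v.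
  move=> hv; rewrite /wave_eta expr_div_n.
  rewrite ler_pdivrMr ?exprn_gt0 ?mulr_gt0//.
  apply: le_trans (sqrB_le (Prim_bound tau0 _ hv) (Prim_bound tau0 _ hv)) _.
  apply: le_of_eq; field; rewrite gt_eqF//.
pose B := C + D + tau / l ^+ 2.
exists (norm_const * B + 1); first by rewrite ltr_wpDl// mulr_ge0 ?(ltW K0)// /B; lra.
move=> v1 v2 s h1 h2.
have n1 := n2_ge0 setT v1; have n2' := n2_ge0 setT v2.
have [a1 a2] := H v1 s h1; have [b1 b2] := H v2 s h2.
have a3 := G v1 s h1; have b3 := G v2 s h2.
have a4 := et v1 s h1; have b4 := et v2 s h2.
have [z1 q1] := wave_cts_L2 l0 lL_ c0 s (Prim_cts h1).
have [z2 q2] := wave_cts_L2 l0 lL_ c0 s (Prim_cts h2).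
rewrite -EdomE in z1 q1 z2 q2.
have [B1 B2 B3] := sum3_ge C0 D0 tl.
have [c1 d1] := scale_sum_le C0 B1 n1 n2'.
have [c2 d2] := scale_sum_le D0 B2 n1 n2'.
have [c3 d3] := scale_sum_le tl B3 n1 n2'.
apply: le_trans (rstate_norm_le z1 z2 q1 q2 (le_trans a1 c1) (le_trans b1 d1)
  (le_trans a2 c1) (le_trans b2 d1) (le_trans a3 c2) (le_trans b3 d2)
  (le_trans a4 c3) (le_trans b4 d3)) _.
by rewrite mulrA ler_wpM2r ?addr_ge0// lerDl.
Qed.

Lemma wave_eta_L2 v : sig v -> L2 I (etaf v) /\ n2 I (etaf v) <= (l ^+ 2)^-1 * n2 setT v.
Proof.
move=> hv; have mT : mble (setT : set R) by exact: measurableT.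
have [a1 a2] := L2_affine (- T0) (oner_neq0 R) hv.1.
rewrite normr1 invr1 mul1r in a2.
have e : (fun x => v (1 * x + - T0)) = (fun x => v (x - T0)).
  by apply/funext => x; rewrite mul1r.
rewrite e in a1 a2.
have d1 := L2B mT a1 hv.1; have n1 := n2B_le mT a1 hv.1.
have ee : etaf v = (fun x => (2 * l)^-1 * (v (x - T0) - v x)).
  by apply/funext => x; rewrite /wave_eta mulrC.
have LT : L2 setT (etaf v) by rewrite ee; exact: L2Z.
split; first exact: L2S LT.
apply: le_trans (n2S mT mI (@subsetT _ _) LT) _.
rewrite ee n2Z//.
apply: le_trans (ler_wpM2l (sqr_ge0 _) n1) _; rewrite a2.
by apply: le_of_eq; field; rewrite gt_eqF.
Qed.

Lemma force_bound : exists2 C : R, 0 < C & forall v, sig v ->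
  L2 I (force v) /\ n2 I (force v) <= C * n2 setT v.
Proof.
have [D D0 G] := wave_delta_bound.
have lI : fine (leb I) = tau.
  by rewrite lebesgue_measure_itv/= lte_fin tau0 -EFinB subr0.
pose B := 2 * (tau / c ^+ 2 + D).
have B0 : 0 <= B.
  by rewrite mulr_ge0// addr_ge0// divr_ge0 ?exprn_ge0 ?ltW.
pose C := M ^+ 2 * (2 * ((l ^+ 2)^-1 + buoyancy ^+ 2 * (B * tau))).
have C0 : 0 <= C.
  apply: mulr_ge0; first exact: sqr_ge0.
  rewrite mulr_ge0// addr_ge0 ?invr_ge0 ?sqr_ge0//.
  by rewrite mulr_ge0 ?sqr_ge0// mulr_ge0// ltW.
exists (C + 1); first by rewrite ltr_wpDl.
move=> v hv; have nv := n2_ge0 setT v.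
have cP := Prim_cts hv.
pose W s := (Prim v s + Prim v (s - T0)) / (2 * c) - deltaf (Prim v) s.
have cPP : continuous (Prim (Prim v)) := derive_cts (fun t => PP_der t hv).
have cW : continuous W.
  apply: cts_sub.
    apply: cts_mul; last exact: cts_cst.
    by apply: cts_add => //; exact: cts_shift.
  apply: cts_mul; last exact: cts_cst.
  by apply: cts_sub => //; exact: cts_shift.
have WB s : W s ^+ 2 <= B * n2 setT v.
  have : ((Prim v s + Prim v (s - T0)) / (2 * c)) ^+ 2 <= tau / c ^+ 2 * n2 setT v.
    rewrite expr_div_n ler_pdivrMr ?exprn_gt0 ?mulr_gt0//.
    apply: le_trans (sqrD_le (Prim_bound tau0 _ hv) (Prim_bound tau0 _ hv)) _.
    by apply: le_of_eq; field; rewrite gt_eqF.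
  move=> h; apply: le_trans (sqrB_le h (G v s hv)) _.
  by apply: le_of_eq; rewrite /B; ring.
have LW : L2 I W := L2_cts mI IS cW.
have nW : n2 I W <= B * tau * n2 setT v.
  have -> : B * tau * n2 setT v = Num.sqrt (B * n2 setT v) ^+ 2 * fine (leb I).
    rewrite lI.
    by rewrite sqr_sqrtr ?(mulr_ge0 B0 nv)//; ring.
  apply: n2_bounded; [exact: mI|exact: leb_itv_fin|exact: cts_meas|].
  by move=> x _; rewrite -sqrtr_sqr ler_sqrt ?(mulr_ge0 B0 nv)//; exact: WB.
have [Le ne] := wave_eta_L2 hv.
have LkW := L2Z buoyancy mI LW.
split; first exact: (L2Z _ mI (L2B mI Le LkW)).
have -> : n2 I (force v) = M ^+ 2 * n2 I (fun s => etaf v s - buoyancy * W s).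
  exact: (n2Z _ mI (L2B mI Le LkW)).
apply: (@le_trans _ _ (C * n2 setT v)); last by rewrite ler_wpM2r// lerDl.
rewrite /C -mulrA ler_wpM2l ?sqr_ge0//.
apply: le_trans (n2B_le mI Le LkW) _.
rewrite n2Z//.
have := ler_wpM2l (sqr_ge0 buoyancy) nW; lra.
Qed.

Lemma PrimB_sig v w : sig v -> sig w ->
  Prim (fun t => v t - w t) = (fun t => Prim v t - Prim w t).
Proof. by move=> hv hw; apply/funext => t; exact: (Prim_sigB t hv hw). Qed.

Lemma wave_deltaB v w s : sig v -> sig w ->
  deltaf (Prim (fun t => v t - w t)) s = deltaf (Prim v) s - deltaf (Prim w) s.
Proof.
move=> hv hw; rewrite PrimB_sig//.
have iP f t : sig f -> intg `]-oo, t] (Prim f).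
  by move=> hf; apply: left_cts_int (Prim_cts hf) _ => y; exact: Prim_sig_neg.
have e : Prim (fun t => Prim v t - Prim w t) = (fun t => Prim (Prim v) t - Prim (Prim w) t).
  apply/funext => t; rewrite /Prim RintegralB//; [exact: iP|exact: iP].
by rewrite /wave_delta e wave_etaB.
Qed.

Lemma forceB v w s : sig v -> sig w -> force (fun t => v t - w t) s = force v s - force w s.
Proof.
by move=> hv hw; rewrite /force wave_deltaB// PrimB_sig// wave_etaB; exact: lin_uf.
Qed.

Lemma cforceB v1 v2 w1 w2 : sig v1 -> sig v2 -> sig w1 -> sig w2 ->
  (fun s => cforce v1 v2 s - cforce w1 w2 s) =
  cforce (fun t => v1 t - w1 t) (fun t => v2 t - w2 t).
Proof. by move=> ? ? ? ?; apply/funext => s; rewrite /cforce !forceB. Qed.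

Lemma wave_stateB v1 v2 w1 w2 s : sig v1 -> sig v2 -> sig w1 -> sig w2 ->
  wave_state (Prim (fun t => v1 t - w1 t)) (Prim (fun t => v2 t - w2 t)) s =
  wave_state (Prim v1) (Prim v2) s - wave_state (Prim w1) (Prim w2) s.
Proof.
move=> h1 h2 k1 k2; rewrite rstateB /wave_state !wave_deltaB//.
by rewrite !PrimB_sig// !wave_etaB; congr rstate; apply/funext => x; rewrite ?wave_zetaB ?wave_qB.
Qed.

Lemma cforce_cL2 v1 v2 : sig v1 -> sig v2 -> cL2 I (cforce v1 v2).
Proof.
by have [C _ H] := force_bound => h1 h2; split; [have [] := H v1 h1|have [] := H v2 h2].
Qed.

(** Smooth signals are dense, and the force and the final state depend
    continuously on the signal. *)
Lemma input_sig v1 v2 : sig v1 -> sig v2 ->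
  input_map p T tau (cforce v1 v2) (wave_state (Prim v1) (Prim v2) tau).
Proof.
move=> h1 h2.
have [C C0 HC] := force_bound; have [K K0 HK] := wave_state_bound.
apply: (input_limit adm ug tau0 (cforce_cL2 h1 h2) (wave_state_X tau h1 h2)) => e e0.
have CK : 0 < 2 * (C + K) by rewrite mulr_gt0// addr_gt0.
have d0 : 0 < e / (2 * (C + K)) by rewrite divr_gt0.
have [w1 [r1 [r10 cw1 sw1 hw1 n1]]] := sig_dense tau0 h1 d0.
have [w2 [r2 [r20 cw2 sw2 hw2 n2']]] := sig_dense tau0 h2 d0.
exists (cforce w1 w2), (wave_state (Prim w1) (Prim w2) tau); split.
- exact: cforce_cL2.
- exact: input_smooth r10 r20 cw1 cw2 sw1 sw2.
- have [_ b1] := HC _ (sigB h1 hw1); have [_ b2] := HC _ (sigB h2 hw2).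
  rewrite cforceB//; apply: le_lt_trans (share_lt C0 K0 e0 n1 n2').
  by rewrite /sqnorm mulrDr; exact: lerD b1 b2.
- rewrite -wave_stateB//.
  have := HK _ _ tau (sigB h1 hw1) (sigB h2 hw2).
  move=> h; apply: le_lt_trans h _.
  by have := share_lt K0 C0 e0; rewrite addrC; exact.
Qed.

Lemma cforce_bound : exists2 C : R, 0 < C & forall v1 v2, sig v1 -> sig v2 ->
  sqnorm I (cforce v1 v2) <= C * (n2 setT v1 + n2 setT v2).
Proof.
have [C C0 HC] := force_bound; exists C => // v1 v2 h1 h2.
have [_ b1] := HC _ h1; have [_ b2] := HC _ h2.
by rewrite /sqnorm mulrDr; exact: lerD b1 b2.
Qed.

(** The input map sees the input on [[0, tau]] only, whereas [Ran] asks for an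
    input on the half-line: extend by 0. *)
Lemma input_ext u z : cL2 I u -> input_map p T tau u z ->
  exists u', [/\ cL2 `[0, +oo[ u', input_map p T tau u' z &
    L2norm `[0, tau] u' = Num.sqrt (sqnorm I u)].
Proof.
move=> hu iz.
pose u' s : R[i] := if s \in I then u s else 0.
have uE s : I s -> u' s = u s by move=> Is; rewrite /u' mem_set.
have hu' : cL2 I u'.
  have [[m1 i1] [m2 i2]] := hu.
  split; split.
  - by apply: (eq_measurable_fun (fun x => Re (u x))) => // x /set_mem Ix; rewrite uE.
  - by apply: eq_integrable i1 => // x /set_mem Ix; rewrite uE.
  - by apply: (eq_measurable_fun (fun x => Im (u x))) => // x /set_mem Ix; rewrite uE.
  - by apply: eq_integrable i2 => // x /set_mem Ix; rewrite uE.
exists u'; split.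
- have [r1 r2] := hu; have t1 := L2_patch mI r1; have t2 := L2_patch mI r2.
  have e1 : (fun x => Re (u' x)) = (fun x => Re (u x)) \_ I.
    by apply/funext => x; rewrite /patch /u'; case: ifP.
  have e2 : (fun x => Im (u' x)) = (fun x => Im (u x)) \_ I.
    by apply/funext => x; rewrite /patch /u'; case: ifP.
  split; rewrite ?e1 ?e2; [apply: L2S t1 => //; exact: mble_itv|].
  by apply: L2S t2 => //; exact: mble_itv.
- apply/(input_mapP adm ug tau0 _ hu'); have /(input_mapP adm ug tau0 _ hu)[zX zE] := iz.
  split => // w hw; rewrite zE//; apply: eq_Rintegral => s /set_mem Is.
  by rewrite uE.
- rewrite /L2norm (sqrL2normE mI hu'); congr (Num.sqrt (_ + _));
  by apply: eq_Rintegral => s /set_mem Is; rewrite uE.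
Qed.

Lemma cL2_Rp u : cL2 `[0, +oo[ u -> cL2 I u.
Proof.
have mR : mble (`[0, +oo[%classic : set R) by exact: mble_itv.
have sI : I `<=` `[0, +oo[ by move=> x /=; rewrite !in_itv/= => /andP[-> _].
by move=> [r1 r2]; split; [exact: L2S mR mI sI r1|exact: L2S mR mI sI r2].
Qed.

Lemma Ran_input u z : cL2 I u -> input_map p T tau u z -> Ran p T tau z.
Proof. by move=> hu iz; have [u' [h1 h2 _]] := input_ext hu iz; exists u'. Qed.

Lemma normRan_le u z : cL2 I u -> input_map p T tau u z ->
  normRan p T tau z <= Num.sqrt (sqnorm I u).
Proof.
move=> hu iz; have [u' [h1 h2 <-]] := input_ext hu iz.
apply: ge_inf; last by exists u'.
by exists 0 => _ [v _ <-]; exact: sqrtr_ge0.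
Qed.

Lemma Ran_X z : Ran p T tau z -> X z.
Proof. by move=> [u [hu /(input_mapP adm ug tau0 _ (cL2_Rp hu))[]]]. Qed.

(** [input_norm] for every input that reaches the state, hence for the infimum. *)
Lemma normX_Ran z : Ran p T tau z ->
  N z <= Num.sqrt (input_const p tau) * normRan p T tau z.
Proof.
move=> [u0 [hu0 iz0]].
rewrite /normRan; set S := (X in inf X).
have S0 : S !=set0 by exists (L2norm `[0, tau] u0); exists u0.
have key : forall y, S y -> N z <= Num.sqrt (input_const p tau) * y.
  move=> _ [u [hu iz] <-]; have hI := cL2_Rp hu.
  have := input_norm adm ug tau0 hI iz.
  rewrite /L2norm (sqrL2normE mI hI) -sqrtrM ?(input_const_ge0 p tau0)// => h.
  rewrite -[N z]ger0_norm ?normX_ge0// -sqrtr_sqr ler_sqrt// mulr_ge0 ?sqnorm_ge0//.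
  exact: input_const_ge0.
have [k0|k0] := eqVneq (Num.sqrt (input_const p tau)) 0.
  have [y Sy] := S0; have := key y Sy; by rewrite k0 !mul0r.
have kp : 0 < Num.sqrt (input_const p tau) by rewrite lt_neqAle eq_sym k0 sqrtr_ge0.
rewrite mulrC -ler_pdivrMr//; apply: lb_le_inf => // y Sy.
by rewrite ler_pdivrMr// mulrC; exact: key.
Qed.

End Traj.

(** * Density of the forces generated by signals *)

Section Causal.
Context {R : realType}.
Implicit Types (f g v w P : R -> R) (s t x a b : R).

Definition causal g := continuous g /\ forall t, t < 0 -> g t = 0.

Lemma causal_int g u : causal g -> intg `]-oo, u] g.
Proof. by move=> [cg g0]; exact: (left_cts_int u cg g0). Qed.

Lemma causal_Prim_der g t : causal g -> is_derive t 1 (Prim g) (g t).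
Proof. by move=> cg; apply: Prim_der; [exact: cg.1|move=> u; exact: causal_int]. Qed.

Lemma causal_Prim g : causal g -> causal (Prim g).
Proof.
move=> cg; split; first exact: derive_cts (fun t => causal_Prim_der t cg).
by move=> t t0; exact: (Prim_left cg.2).
Qed.

Lemma causalD g h : causal g -> causal h -> causal (fun t => g t + h t).
Proof.
move=> cg ch; split; first exact: cts_add cg.1 ch.1.
by move=> t t0; rewrite cg.2// ch.2// addr0.
Qed.

Lemma causalZ k g : causal g -> causal (fun t => k * g t).
Proof.
move=> cg; split; first exact: cts_mul (@cts_cst _ k) cg.1.
by move=> t t0; rewrite cg.2// mulr0.
Qed.

Lemma causal_shift a g : 0 <= a -> causal g -> causal (fun t => g (t - a)).
Proof.
move=> a0 cg; split; first exact: cts_shift cg.1.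
by move=> t t0; rewrite cg.2//; lra.
Qed.

Lemma PrimD g h t : causal g -> causal h ->
  Prim (fun t => g t + h t) t = Prim g t + Prim h t.
Proof. by move=> cg ch; rewrite /Prim RintegralD//; exact: causal_int. Qed.

Variable la : R.
Hypothesis la0 : 0 < la.

Lemma exp_der t : is_derive t 1 (fun y : R => expR (la * y)) (la * expR (la * t)).
Proof.
have := @is_derive_aff R expR (expR (la * t + 0)) la 0 t (is_derive_expR _).
by rewrite addr0; congr is_derive; apply/funext => y; rewrite addr0.
Qed.

Definition exp_bounded A g := forall t, `|g t| <= A * expR (la * t).

(** Integration gains a factor [la]: this makes Volterra operators small for a
    weight that grows fast. *)
Lemma exp_bounded_Prim A g : 0 <= A -> causal g -> exp_bounded A g -> exp_bounded (A / la) (Prim g).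
Proof.
move=> A0 cg bg t.
have e0 : 0 <= A / la * expR (la * t) by rewrite mulr_ge0 ?divr_ge0 ?expR_ge0 ?(ltW la0).
have [t0|t0] := ltP t 0; first by rewrite (Prim_left cg.2)// normr0.
(* both bounds at once: the sum with either sign is nondecreasing in time *)
suff key k : `|k| = 1 -> 0 <= A / la * expR (la * t) + k * Prim g t.
  have := key 1 (normr1 _); have := key (-1) ltac:(by rewrite normrN normr1).
  by rewrite mulN1r mul1r ler_norml => h1 h2; apply/andP; split; lra.
move=> k1.
pose h s := A / la * expR (la * s) + k * Prim g s.
have hd s : is_derive s 1 h (A * expR (la * s) + k * g s).
  have d1 := is_deriveZ (A / la) (exp_der s).
  have d2 := is_deriveZ k (causal_Prim_der s cg).
  have := is_deriveD d1 d2; rewrite /GRing.scale/=.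
  by have -> : A / la * (la * expR (la * s)) = A * expR (la * s) by field; rewrite gt_eqF.
have hd0 s : 0 <= A * expR (la * s) + k * g s.
  have : `|k * g s| <= A * expR (la * s) by rewrite normrM k1 mul1r.
  by rewrite ler_norml => /andP[h1 h2]; lra.
have h0 : 0 <= h 0.
  have [e|e] : Prim g 0 = 0 \/ Prim g 0 != 0 by case: eqVneq; [left|right].
    by rewrite /h e (mulr0 k) addr0 mulr_ge0 ?expR_ge0// divr_ge0// ltW.
  by case/eqP: e; rewrite (Prim_int 0 cg.2)// set_itv1 Rintegral_set1.
move: t0; rewrite le_eqVlt => /orP[/eqP <-//|t0].
have ch : {within `[0, t], continuous h}.
  by apply: continuous_subspaceT; exact: derive_cts hd.
have [c cI E] := @MVT R h (fun s => A * expR (la * s) + k * g s) 0 t t0 (fun y _ => hd y) ch.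
rewrite -/(h t) -[h t](subrK (h 0)) E; apply: addr_ge0 => //.
by rewrite mulr_ge0// subr0 ltW.
Qed.

Lemma exp_bounded_shift A a g : 0 <= A -> 0 <= a -> exp_bounded A g -> exp_bounded A (fun t => g (t - a)).
Proof.
move=> A0 a0 bg t; apply: le_trans (bg _) _; rewrite ler_wpM2l// ler_expR.
by rewrite ler_pM2l//; lra.
Qed.

Lemma exp_boundedD A B g h : exp_bounded A g -> exp_bounded B h -> exp_bounded (A + B) (fun t => g t + h t).
Proof.
move=> bg bh t; apply: le_trans (ler_normD _ _) _.
by rewrite mulrDl lerD.
Qed.

Lemma exp_boundedZ A k g : exp_bounded A g -> exp_bounded (`|k| * A) (fun t => k * g t).
Proof. by move=> bg t; rewrite normrM -mulrA ler_wpM2l. Qed.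

Lemma lin_K (k q r a b a' b' x y x' y' : R) :
  k * ((a + b + (a' + b')) / q - (x + y - (x' + y')) / r) =
  k * ((a + a') / q - (x - x') / r) + k * ((b + b') / q - (y - y') / r).
Proof. by ring. Qed.

Lemma lin_G (a b d e f : R) : a - b = d - e -> a + e - (b + f) = d - f.
Proof. by lra. Qed.

End Causal.

Section Neumann.
Context {R : realType} (p : params R).
Hypotheses (adm : admissible p) (LL : Lright p = Lleft p).
Implicit Types (f g v w P : R -> R) (s t x : R).

Local Notation l := (halfl p).
Local Notation L := (Lright p).
Local Notation E := (Edom p).
Local Notation M := (M_ p).
Local Notation c := (celerity p).
Local Notation T0 := (round_trip l L c).
Local Notation etaf := (wave_eta l L c).
Local Notation deltaf := (wave_delta l L c).
Local Notation buoyancy := (buoyancy p).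
Local Notation force := (force p).

Let l0 := l_gt0 adm.
Let c0 := celerity_gt0 adm.
Let lL_ := halfl_lt_L adm.
Let T00 : 0 < T0 := round_trip_gt0 lL_ c0.

(** The part of the force that depends on the signal through primitives only. *)
Definition memory v s : R :=
  buoyancy * ((Prim v s + Prim v (s - T0)) / (2 * c) - deltaf (Prim v) s).

Lemma forceE v s : force v s = M * (etaf v s - memory v s). Proof. by []. Qed.

Lemma force_local v w s : (forall t, t <= s -> v t = w t) -> force v s = force w s.
Proof.
move=> vw.
have e t : t <= s -> Prim v t = Prim w t.
  move=> ts; apply: eq_Rintegral => x /set_mem /=; rewrite in_itv/= => xt.
  by apply: vw; exact: le_trans ts.
have e2 t : t <= s -> Prim (Prim v) t = Prim (Prim w) t.
  move=> ts; apply: eq_Rintegral => x /set_mem /=; rewrite in_itv/= => xt.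
  by apply: e; exact: le_trans ts.
have sT : s - T0 <= s by have := T00; lra.
have ss := lexx s.
by rewrite /force /wave_delta /wave_eta (vw _ ss) (vw _ sT) (e _ ss) (e _ sT)
  (e2 _ ss) (e2 _ sT).
Qed.

Variable n : nat.

(** A signal for which the velocity of the object is [g]; see
    [wave_eta_delay_sum]. *)
Definition delay_sum g t : R := - (2 * l) * \sum_(k < n) g (t - k%:R * T0).

Lemma causal_sum m g : causal g -> causal (fun t => \sum_(k < m) g (t - k%:R * T0)).
Proof.
move=> cg; elim: m => [|m IH].
  have -> : (fun t => \sum_(k < 0) g (t - k%:R * T0)) = (fun=> 0).
    by apply/funext => t; rewrite big_ord0.
  by split => //; exact: cts_cst.
have -> : (fun t => \sum_(k < m.+1) g (t - k%:R * T0)) =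
  (fun t => (\sum_(k < m) g (t - k%:R * T0)) + g (t - m%:R * T0)).
  by apply/funext => t; rewrite big_ord_recr.
by apply: causalD => //; apply: causal_shift => //; rewrite mulr_ge0// ltW.
Qed.

Lemma causal_delay_sum g : causal g -> causal (delay_sum g).
Proof. by move=> /(causal_sum n); exact: causalZ. Qed.

Lemma delay_sumD g h : delay_sum (fun t => g t + h t) = (fun t => delay_sum g t + delay_sum h t).
Proof. by apply/funext => t; rewrite /delay_sum big_split mulrDr. Qed.

(** The sum telescopes, and its last term vanishes until time [n * T0]. *)
Lemma wave_eta_delay_sum g t : causal g -> t < n%:R * T0 -> etaf (delay_sum g) t = g t.
Proof.
move=> cg tn; rewrite /wave_eta /delay_sum.
have e m : (\sum_(k < m) g (t - T0 - k%:R * T0)) + g t =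
    (\sum_(k < m) g (t - k%:R * T0)) + g (t - m%:R * T0).
  elim: m => [|m IH]; first by rewrite !big_ord0 !add0r mul0r subr0.
  rewrite !big_ord_recr /= addrAC IH.
  by rewrite -!addrA [m.+1%:R]mulrSr mulrDl mul1r opprD addrA [- T0 - _]addrC addrA.
have := e n; rewrite [g (t - n%:R * T0)]cg.2 ?subr_lt0// addr0 => <-.
by field; rewrite gt_eqF.
Qed.

Definition memory_of g := memory (delay_sum g).

Lemma causal_memory v : causal v -> causal (memory v).
Proof.
move=> cv; have cP := causal_Prim cv; have cPP := causal_Prim cP.
have T0' := ltW T00.
have -> : memory v = (fun s => buoyancy * ((2 * c)^-1 * (Prim v s + Prim v (s - T0)) +
   - (2 * l)^-1 * (Prim (Prim v) (s - T0) + (-1) * Prim (Prim v) s))).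
  by apply/funext => s; rewrite /memory /wave_delta /wave_eta; ring.
apply: causalZ; apply: causalD; apply: causalZ; apply: causalD => //.
- exact: causal_shift.
- exact: causal_shift.
- exact: causalZ.
Qed.

Lemma memoryD v w s : causal v -> causal w ->
  memory (fun t => v t + w t) s = memory v s + memory w s.
Proof.
move=> cv cw; have [cP cQ] := (causal_Prim cv, causal_Prim cw).
have e : Prim (fun t => v t + w t) = (fun t => Prim v t + Prim w t).
  by apply/funext => t; exact: PrimD.
have e2 : Prim (fun t => Prim v t + Prim w t) = (fun t => Prim (Prim v) t + Prim (Prim w) t).
  by apply/funext => t; exact: PrimD.
by rewrite /memory /wave_delta /wave_eta e e2; exact: lin_K.
Qed.

(** The exponential weight for which [memory_of] contracts by one half. *)
Definition growth_rate : R := 1 + 2 * (buoyancy * (2 * l * n%:R * (c^-1 + l^-1))).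

Lemma buoyancy_gt0 : 0 < buoyancy.
Proof.
have h := mulr_gt0 (mulr_gt0 (mulr_gt0 (ltr0Sn R 1) (rho_gt0 adm)) (g_gt0 adm)) l0.
exact: (divr_gt0 h (M_gt0 adm)).
Qed.

Lemma growth_rate_ge1 : 1 <= growth_rate.
Proof.
rewrite /growth_rate lerDl mulr_ge0// mulr_ge0 ?(ltW buoyancy_gt0)//.
have c1 : 0 < c^-1 + l^-1 by rewrite addr_gt0 ?invr_gt0.
by rewrite mulr_ge0 ?(ltW c1)// mulr_ge0// mulr_ge0// ltW.
Qed.

Lemma exp_bounded_memory A g : 0 <= A -> causal g -> exp_bounded growth_rate A g -> exp_bounded growth_rate (A / 2) (memory_of g).
Proof.
move=> A0 cg bg.
have la1 := growth_rate_ge1; have la0 : 0 < growth_rate := lt_le_trans ltr01 la1.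
have cv := causal_delay_sum cg; have cP := causal_Prim cv.
have T0' := ltW T00.
have bs m : exp_bounded growth_rate (m%:R * A) (fun t => \sum_(k < m) g (t - k%:R * T0)).
  elim: m => [|m IH] t; first by rewrite big_ord0 normr0 !mul0r.
  rewrite big_ord_recr /= mulrSr mulrDl mul1r.
  have m0 : 0 <= m%:R * T0 by rewrite mulr_ge0.
  exact: (exp_boundedD IH (exp_bounded_shift la0 A0 m0 bg)).
pose B := 2 * l * (n%:R * A).
have B0 : 0 <= B by rewrite /B !mulr_ge0// ltW.
have bv : exp_bounded growth_rate B (delay_sum g).
  have := exp_boundedZ (- (2 * l)) (bs n).
  by rewrite normrN gtr0_norm// mulr_gt0.
have bP := exp_bounded_Prim la0 B0 cv bv.
have B1 : 0 <= B / growth_rate by rewrite divr_ge0// ltW.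
have bPP := exp_bounded_Prim la0 B1 cP bP.
have B2 : 0 <= B / growth_rate / growth_rate by rewrite divr_ge0// ltW.
have b1 := exp_boundedZ (2 * c)^-1 (exp_boundedD bP (exp_bounded_shift la0 B1 T0' bP)).
have b2 := exp_boundedZ (- (2 * l)^-1) (exp_boundedD (exp_bounded_shift la0 B2 T0' bPP) (exp_boundedZ (-1) bPP)).
have b3 := exp_boundedZ buoyancy (exp_boundedD b1 b2).
have e : memory_of g = (fun s => buoyancy * ((2 * c)^-1 * (Prim (delay_sum g) s + Prim (delay_sum g) (s - T0)) +
   - (2 * l)^-1 * (Prim (Prim (delay_sum g)) (s - T0) + (-1) * Prim (Prim (delay_sum g)) s))).
  by apply/funext => s; rewrite /memory_of /memory /wave_delta /wave_eta; ring.
rewrite e => t; apply: le_trans (b3 t) _; rewrite ler_wpM2r ?expR_ge0//.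
rewrite !normrN normr1 mul1r (gtr0_norm buoyancy_gt0).
rewrite !gtr0_norm ?invr_gt0 ?mulr_gt0//.
have D : B / growth_rate / growth_rate <= B / growth_rate by rewrite ler_pdivrMr// ler_peMr.
apply: (@le_trans _ _ (buoyancy * ((2 * c)^-1 * (B / growth_rate + B / growth_rate) + (2 * l)^-1 * (B / growth_rate + B / growth_rate)))).
  rewrite ler_pM2l ?buoyancy_gt0// lerD2l ler_pM2l ?invr_gt0 ?mulr_gt0//.
  exact: lerD.
have -> : buoyancy * ((2 * c)^-1 * (B / growth_rate + B / growth_rate) + (2 * l)^-1 * (B / growth_rate + B / growth_rate)) =
   (buoyancy * (2 * l * n%:R * (c^-1 + l^-1))) / growth_rate * A.
  by rewrite /B; field; rewrite !gt_eqF.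
rewrite mulrC ler_wpM2l// ler_pdivrMr// /growth_rate; lra.
Qed.

Fixpoint memory_iter k g := if k is k'.+1 then memory_of (memory_iter k' g) else g.
Fixpoint neumann_sum k g := if k is k'.+1 then (fun t => neumann_sum k' g t + memory_iter k'.+1 g t) else g.

Lemma memory_iter_bound k g A : 0 <= A -> causal g -> exp_bounded growth_rate A g ->
  causal (memory_iter k g) /\ exp_bounded growth_rate (A / 2 ^+ k) (memory_iter k g).
Proof.
move=> A0 cg bg; elim: k => [|k [IH1 IH2]].
  by split => //; rewrite expr0 divr1.
split; first by apply: causal_memory; exact: causal_delay_sum.
rewrite exprS invfM mulrCA mulrC.
by apply: exp_bounded_memory => //; rewrite divr_ge0// exprn_ge0.
Qed.

(** Partial sums of the Neumann series for the inverse of the identity minus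
    [memory_of] leave the next term as error. *)
Lemma neumann_sumP k g A : 0 <= A -> causal g -> exp_bounded growth_rate A g ->
  causal (neumann_sum k g) /\ forall s, neumann_sum k g s - memory_of (neumann_sum k g) s = g s - memory_iter k.+1 g s.
Proof.
move=> A0 cg bg; elim: k => [|k [IH1 IH2]]; first by split.
have [k1 _] := memory_iter_bound k.+1 A0 cg bg.
split; first exact: causalD.
move=> s; rewrite /memory_of/= delay_sumD memoryD; [|exact: causal_delay_sum|exact: causal_delay_sum].
have := IH2 s; rewrite /memory_of /= => h.
exact: lin_G h.
Qed.

End Neumann.

Section Density.
Context {R : realType} (p : params R).
Hypotheses (adm : admissible p) (LL : Lright p = Lleft p).
Implicit Types (f g v w P : R -> R) (s t x : R).

Local Notation l := (halfl p).
Local Notation L := (Lright p).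
Local Notation M := (M_ p).
Local Notation c := (celerity p).
Local Notation T0 := (round_trip l L c).
Local Notation force := (force p).
Variable tau : R.
Hypothesis tau0 : 0 < tau.
Local Notation sig := (signal tau).
Local Notation I := (`[0, tau]%classic : set R).
Let mI : mble I. Proof. exact: mble_itv. Qed.

(** Signals vanish after [tau]; by [force_local] this does not change the force
    before [tau]. *)
Definition cut v t : R := if t \in I then v t else 0.

Lemma cut_causal v : causal v -> sig (cut v) /\ forall t, t <= tau -> cut v t = v t.
Proof.
move=> [cv v0]; split.
  split; last first.
    by move=> t tn; rewrite /cut; case: ifP => // /set_mem; rewrite /= in_itv.
  exact: (L2_patch mI (L2_cts mI (fun x h => h) cv : L2 I v)).
move=> t tt; rewrite /cut; case: ifP => // /negP tn.
by rewrite v0// ltNge; apply/negP => t0; apply: tn; apply/mem_set; rewrite /= in_itv/= t0.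
Qed.

Lemma pow2_large (x e : R) : 0 <= x -> 0 < e -> exists k : nat, x / 2 ^+ k < e.
Proof.
move=> x0 e0; have h := archi_boundP (divr_ge0 x0 (ltW e0)).
exists (Num.bound (x / e)); set k := Num.bound _ in h *.
rewrite ltr_pdivrMr ?exprn_gt0// mulrC -ltr_pdivrMr//.
apply: lt_le_trans h _; rewrite -natrX ler_nat ltnW//; exact: ltn_expl.
Qed.

(** Before time [n * T0] the force of [delay_sum g] is [M * (g - memory_of g)],
    so the Neumann series solves [force v = M * w] up to a geometrically small
    error. *)
Lemma force_small w eps h : 0 < h -> 0 < eps -> continuous w -> supp_in (0 + h) (tau - h) w ->
  exists2 v, sig v & n2 I (fun s => M * w s - force v s) < eps.
Proof.
move=> h0 e0 cw sw.
have M0 := M_gt0 adm.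
have T00 : 0 < T0 := round_trip_gt0 (halfl_lt_L adm) (celerity_gt0 adm).
have w0 t : t < 0 -> w t = 0.
  by move=> t0; apply: sw => /andP[]; lra.
have cw' : causal w by [].
have [B BP] := cts_bounded 0 tau cw.
have B0 : 0 <= B by apply: le_trans (BP 0 _); rewrite ?lexx ?(ltW tau0).
(* enough delayed copies to cover [0, tau] *)
pose n := Num.bound (tau / T0).
have nT : tau < n%:R * T0.
  by rewrite -ltr_pdivrMr//; apply: archi_boundP; rewrite divr_ge0// ltW.
have la1 : 1 <= growth_rate p n := growth_rate_ge1 adm n.
have la0 : 0 < growth_rate p n := lt_le_trans ltr01 la1.
have bw : exp_bounded (growth_rate p n) B w.
  move=> t; have [t0|t0] := ltP t 0; first by rewrite w0// normr0 mulr_ge0 ?expR_ge0.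
  apply: (@le_trans _ _ B).
    have [tt|tt] := leP t tau; first by rewrite BP// t0.
    rewrite sw ?normr0// => /andP[_]; lra.
  by rewrite ler_peMr// -expR0 ler_expR mulr_ge0// ltW.
pose Q := B * expR (growth_rate p n * tau).
have Q0 : 0 <= Q by rewrite mulr_ge0 ?expR_ge0.
have MQ0 : 0 <= M ^+ 2 * Q ^+ 2 * tau by rewrite mulr_ge0 ?(ltW tau0)// mulr_ge0 ?sqr_ge0.
have [k kP] := pow2_large MQ0 e0.
have [ck bk] := memory_iter_bound adm (n := n) k.+1 B0 cw' bw.
have [cg gP] := neumann_sumP adm (n := n) k B0 cw' bw.
have cv := causal_delay_sum adm n cg.
have [sv vP] := cut_causal cv.
exists (cut (delay_sum p n (neumann_sum p n k w))) => //.
have E s : I s -> M * w s - force (cut (delay_sum p n (neumann_sum p n k w))) s = M * memory_iter p n k.+1 w s.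
  rewrite /= in_itv/= => /andP[s0 rstate].
  rewrite (@force_local _ _ adm _ (delay_sum p n (neumann_sum p n k w))); last first.
    by move=> t ts; apply: vP; exact: le_trans ts rstate.
  rewrite forceE wave_eta_delay_sum//; last exact: le_lt_trans rstate nT.
  by rewrite gP -mulrBr opprB addrC subrK.
have -> : n2 I (fun s => M * w s - force (cut (delay_sum p n (neumann_sum p n k w))) s) =
   n2 I (fun s => M * memory_iter p n k.+1 w s).
  by apply: eq_Rintegral => s /set_mem Is; rewrite E.
have LK : L2 I (memory_iter p n k.+1 w) := L2_cts mI (fun x h => h) ck.1.
rewrite n2Z//.
have lI : fine (leb I) = tau.
  by rewrite lebesgue_measure_itv/= lte_fin tau0 -EFinB subr0.
have nK : n2 I (memory_iter p n k.+1 w) <= (Q / 2 ^+ k.+1) ^+ 2 * fine (leb I).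
  apply: n2_bounded; [exact: mI|exact: leb_itv_fin|exact: cts_meas ck.1|].
  move=> s; rewrite /= in_itv/= => /andP[s0 rstate]; apply: le_trans (bk s) _.
  rewrite /Q mulrAC ler_wpM2r ?invr_ge0 ?exprn_ge0// ler_wpM2l// ler_expR.
  by rewrite ler_pM2l.
rewrite lI in nK.
apply: le_lt_trans (ler_wpM2l (sqr_ge0 M) nK) _; apply: le_lt_trans kP.
have -> : M ^+ 2 * ((Q / 2 ^+ k.+1) ^+ 2 * tau) = M ^+ 2 * Q ^+ 2 * tau * (2 ^+ k.+1 ^+ 2)^-1.
  by rewrite expr_div_n; ring.
rewrite ler_wpM2l// lef_pV2 ?posrE ?exprn_gt0//.
rewrite -exprM; apply: ler_weXn2l; first by rewrite ler1n.
by rewrite muln2 -addnn; apply: leq_trans (leq_addr _ _).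
Qed.

Lemma force_dense u eps : L2 I u -> 0 < eps ->
  exists2 v, sig v & n2 I (fun s => u s - force v s) < eps.
Proof.
move=> Lu e0; have M0 := M_gt0 adm.
have Mi : M != 0 by rewrite gt_eqF.
have LuM := L2Z M^-1 mI Lu.
have mO : mble (`]0, tau[%classic : set R) by exact: mble_itv.
have OI : `]0, tau[ `<=` I by exact: subset_itv_oo_cc.
have d0 : 0 < eps / (4 * M ^+ 2) by rewrite divr_gt0// mulr_gt0// exprn_gt0.
have [w [h h0 [cw sw nw]]] := dense_Cc tau0 (L2S mI mO OI LuM) d0.
have e4 : 0 < eps / 4 by rewrite divr_gt0.
have [v hv nv] := force_small h0 e4 cw sw.
exists v => //.
have Lw : L2 I w := L2_cts mI (fun x h => h) cw.
have [C _ /(_ v hv)[Lv _]] := force_bound adm LL tau0.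
have L1 := L2B mI LuM Lw.
have LMw := L2Z M mI Lw.
have n1 : n2 I (fun x => M * (M^-1 * u x - w x)) < eps / 4.
  rewrite n2Z// mulrC -ltr_pdivlMr ?exprn_gt0//.
  have -> : eps / 4 / M ^+ 2 = eps / (4 * M ^+ 2) by field; rewrite gt_eqF.
  by rewrite /n2 -Rint_oo_cc//; exact: L1.2.
have -> : (fun s => u s - force v s) = (fun s => M * (M^-1 * u s - w s) + (M * w s - force v s)).
  by apply/funext => s; rewrite mulrBr mulVKf//; ring.
apply: le_lt_trans (n2D_le mI (L2Z M mI L1) (L2B mI LMw Lv)) _.
lra.
Qed.

Lemma cforce_dense (u : R -> R[i]) eps : cL2 I u -> 0 < eps ->
  exists v1 v2, [/\ sig v1, sig v2 & sqnorm I (fun s => u s - cforce p v1 v2 s) < eps].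
Proof.
move=> [u1 u2] e0; have e2 : 0 < eps / 2 by rewrite divr_gt0.
have [v1 h1 n1] := force_dense u1 e2; have [v2 h2 n2'] := force_dense u2 e2.
exists v1, v2; split => //; rewrite /sqnorm.
have -> : (fun s => Re (u s - cforce p v1 v2 s)) = (fun s => Re (u s) - force v1 s).
  by apply/funext => s; rewrite ReD ReN.
have -> : (fun s => Im (u s - cforce p v1 v2 s)) = (fun s => Im (u s) - force v2 s).
  by apply/funext => s; rewrite ImD ImN.
by have := ltrD n1 n2'; rewrite -splitr.
Qed.

End Density.

(** * Recovering a signal from a symmetric state *)

Section Fold.
Context {R : realType}.
Implicit Types (f g v w P a b : R -> R) (s t x : R).

Variables (l L c tau : R).
Hypotheses (l0 : 0 < l) (lL : l < L) (c0 : 0 < c).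
Local Notation T0 := (round_trip l L c).
Hypothesis tau0 : T0 < tau.
Local Notation zf := (wave_zeta l L c).
Local Notation qf := (wave_q l L c).
Local Notation ph1 := (out_phase l c).
Local Notation ph2 := (back_phase l L c).
Local Notation sig := (signal tau).
Local Notation E := (two_sided l L).
Local Notation H := (`]l, L[%classic : set R).
Let mE : mble E. Proof. exact: mble_two_sided. Qed.
Let mH : mble H. Proof. exact: mble_itv. Qed.
Let HE : H `<=` E. Proof. by move=> x; right. Qed.
Let T00 : 0 < T0 := round_trip_gt0 lL c0.

Lemma refl_null (A : set R) : mble A -> leb A = 0%E ->
  mble (fun x => A (- x)) /\ leb (fun x => A (- x)) = 0%E.
Proof.
move=> mA A0; have a1 : (-1 : R) != 0 by rewrite oppr_eq0 oner_neq0.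
have := null_affine 0 a1 mA A0.
by have -> : (fun x : R => A (-1 * x + 0)) = (fun x => A (- x))
  by apply/funext => x; rewrite mulN1r addr0.
Qed.

(** [k] is 1 for even functions and -1 for odd ones. *)
Lemma sym_ext k f g : k * k = 1 ->
  (fun x => f (- x)) = (fun x => k * f x) %[ae leb in E] ->
  (fun x => g (- x)) = (fun x => k * g x) %[ae leb in E] ->
  f = g %[ae leb in H] -> f = g %[ae leb in E].
Proof.
move=> k1 /ae_eq_lebP[A [mA A0] hA] /ae_eq_lebP[B [mB B0] hB] /ae_eq_lebP[C [mC C0] hC].
have [mC' C0'] := refl_null mC C0.
apply/ae_eq_lebP; exists (A `|` B `|` (C `|` (fun x => C (- x)))).
  split; first by apply: measurableU; apply: measurableU.
  by apply: null_set_setU; [exact: measurableU|exact: measurableU|apply: null_set_setU|apply: null_set_setU].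
move=> x Ex n.
have nA : ~ A x by move=> ?; apply: n; left; left.
have nB : ~ B x by move=> ?; apply: n; left; right.
have nC : ~ C x by move=> ?; apply: n; right; left.
have nC' : ~ C (- x) by move=> ?; apply: n; right; right.
case: (Ex) => Hx; last exact: hC.
have Hx' : H (- x) by move: Hx; rewrite /= !in_itv/= => /andP[? ?]; apply/andP; split; lra.
have := hC _ Hx' nC'; rewrite hA// hB// => /(congr1 ( *%R k)).
by rewrite !mulrA k1 !mul1r.
Qed.

(** The phases map [(l, L)] onto the two halves of [[tau - T0, tau]]: [a] is
    carried by the outgoing wave and [b] by the reflected one, whence
    [glue_out] and [glue_back]. *)
Definition glue a b t : R :=
  (a \_ H) (- c * t + (l + c * tau)) + (b \_ H) (c * t + (2 * L - l - c * tau)).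

Lemma glue_out a b x : H x -> glue a b (ph1 tau x) = a x.
Proof.
move=> Hx; have := Hx; rewrite /= in_itv/= => /andP[h1 h2].
have x0 : 0 < x by have := l0; lra.
rewrite /glue /out_phase gtr0_norm//.
have -> : - c * (tau - (x - l) / c) + (l + c * tau) = x by field; rewrite gt_eqF.
have -> : c * (tau - (x - l) / c) + (2 * L - l - c * tau) = 2 * L - x by field; rewrite gt_eqF.
rewrite !patchE mem_set// memNset ?addr0//= in_itv/= => /andP[_]; lra.
Qed.

Lemma glue_back a b x : H x -> glue a b (ph2 tau x) = b x.
Proof.
move=> Hx; have := Hx; rewrite /= in_itv/= => /andP[h1 h2].
have x0 : 0 < x by have := l0; lra.
rewrite /glue /back_phase gtr0_norm//.
have -> : - c * (tau - (2 * L - l - x) / c) + (l + c * tau) = 2 * L - x by field; rewrite gt_eqF.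
have -> : c * (tau - (2 * L - l - x) / c) + (2 * L - l - c * tau) = x by field; rewrite gt_eqF.
rewrite !patchE memNset ?add0r ?mem_set//= in_itv/= => /andP[_]; lra.
Qed.

Lemma glue_zf a b x : H x -> zf (glue a b) tau x = (a x + b x) / (2 * c).
Proof. by move=> Hx; rewrite /wave_zeta glue_out// glue_back. Qed.

Lemma glue_qf a b x : H x -> qf (glue a b) tau x = (a x - b x) / 2.
Proof.
move=> Hx; rewrite /wave_q glue_out// glue_back// /side.
have := Hx; rewrite /= in_itv/= => /andP[h1 h2].
by rewrite (lt_trans l0 h1) mul1r.
Qed.

Lemma glue_supp a b : supp_in 0 tau (glue a b).
Proof.
move=> t tn; have cn : c != 0 by rewrite gt_eqF.
have cT : c * T0 = 2 * (L - l) by rewrite /round_trip; field.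
have ct : c * T0 < c * tau by rewrite ltr_pM2l.
have key : c * t < 0 \/ c * tau < c * t.
  case: (ltP t 0) => t0; [left|right]; first by rewrite pmulr_rlt0.
  by rewrite ltr_pM2l// ltNge; apply/negP => tt; apply: tn; rewrite t0.
have n1 : ~ H (- c * t + (l + c * tau)).
  by rewrite /= in_itv/= mulNr => /andP[h1 h2]; case: key => k; lra.
have n2 : ~ H (c * t + (2 * L - l - c * tau)).
  by rewrite /= in_itv/= => /andP[h1 h2]; case: key => k; lra.
by rewrite /glue !patchE !memNset// addr0.
Qed.

Lemma glue_sig a b : L2 H a -> L2 H b -> sig (glue a b) /\
  n2 setT (glue a b) <= 2 / c * (n2 H a + n2 H b).
Proof.
move=> ha hb; have mT : mble (setT : set R) by exact: measurableT.
have cn : c != 0 by rewrite gt_eqF.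
have cm : - c != 0 by rewrite oppr_eq0.
have [a1 e1] := L2_affine (l + c * tau) cm (L2_patch mH ha).
have [b1 e2] := L2_affine (2 * L - l - c * tau) cn (L2_patch mH hb).
split; first by split; [exact: L2D|exact: glue_supp].
apply: le_trans (n2D_le mT a1 b1) _.
rewrite e1 e2 !n2_patch normrN gtr0_norm//; lra.
Qed.

Definition pulse (a b : R) : R -> R := \1_(`[a, b]%classic : set R).

Lemma pulse1 (a b t : R) : a <= t <= b -> pulse a b t = 1.
Proof. by move=> tI; rewrite /pulse indicE mem_set//= in_itv. Qed.

Lemma pulse0 (a b t : R) : ~ (a <= t <= b) -> pulse a b t = 0.
Proof. by move=> tI; rewrite /pulse indicE memNset//= in_itv. Qed.

(** Pulses adjust the primitive of a signal, on the last round trip or at time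
    [tau]. *)
Lemma pulse_sig (a b : R) : 0 <= a -> b <= tau -> sig (pulse a b).
Proof.
move=> a0 bt; have mI : mble (`[a, b]%classic : set R) by exact: mble_itv.
split; last first.
  by move=> t tn; apply: pulse0 => /andP[h1 h2]; apply: tn; rewrite (le_trans a0 h1) (le_trans h2).
have := L2_patch mI (L2_cts mI (fun x h => h) (@cts_cst _ 1) : L2 `[a, b] (fun=> 1)).
by congr L2; apply/funext => t; rewrite patchE /pulse indicE; case: (_ \in _).
Qed.

Lemma Prim_pulse0 (a b s : R) : s < a -> Prim (pulse a b) s = 0.
Proof.
by apply: Prim_left => t ta; apply: pulse0 => /andP[]; rewrite leNgt ta.
Qed.

Lemma Prim_pulse (a b s : R) : a <= s <= b -> Prim (pulse a b) s = s - a.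
Proof.
move=> /andP[s1 s2]; have mI (i : interval R) : mble [set` i] by exact: mble_itv.
have lI : fine (leb (`[a, s]%classic : set R)) = s - a.
  rewrite lebesgue_measure_itv/= lte_fin; case: ltP => [|k]; first by rewrite -EFinB.
  by have -> : s = a by [apply/eqP; rewrite eq_le k s1]; rewrite subrr.
rewrite /Prim (@Rint_shrink _ `]-oo, s] `[a, s])//; first last.
- move=> t /=; rewrite !in_itv/= => t2 tn; apply: pulse0 => /andP[t3 _].
  by apply: tn; rewrite t3.
- by move=> t /=; rewrite !in_itv/= => /andP[].
rewrite (@eq_Rintegral _ _ _ _ _ (fun=> 1)) ?Rintegral_cst ?mul1r//.
move=> t /set_mem /=; rewrite in_itv/= => /andP[m1 m2]; apply: pulse1.
by rewrite m1 (le_trans m2).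
Qed.

Lemma Prim_pulse1 (a b s : R) : a <= b -> b <= s -> Prim (pulse a b) s = b - a.
Proof.
move=> ab bs; rewrite -(@Prim_pulse a b b) ?ab ?lexx// /Prim.
apply: Rint_shrink; [exact: mble_itv|exact: mble_itv| |].
  by move=> t /=; rewrite !in_itv/= => tb; exact: le_trans bs.
move=> t _ /=; rewrite in_itv/= => tn; apply: pulse0 => /andP[_ tb]; exact: tn.
Qed.

Lemma Prim_sigD v w t : sig v -> sig w ->
  Prim (fun t => v t + w t) t = Prim v t + Prim w t.
Proof.
by move=> hv hw; rewrite /Prim RintegralD//; [exact: (sig_intD (mble_itv _) hv)|exact: (sig_intD (mble_itv _) hw)].
Qed.

Lemma Prim_sigZ k v t : sig v -> Prim (fun t => k * v t) t = k * Prim v t.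
Proof.
by move=> hv; rewrite /Prim RintegralZl//; exact: (sig_intD (mble_itv _) hv).
Qed.

Lemma wd_ext (D : set R) f df dg : (forall x, D x -> df x = dg x) ->
  is_weak_deriv D f df -> is_weak_deriv D f dg.
Proof.
move=> e w phi tp; rewrite w//; congr (- _).
by apply: eq_Rintegral => x /set_mem Dx; rewrite e.
Qed.

Lemma wd_sub_const f df g dg : L2 E f -> L2 E df -> L2 E g -> L2 E dg ->
  is_weak_deriv E f df -> is_weak_deriv E g dg -> (forall x, H x -> df x = dg x) ->
  exists C, f = (fun x => g x + C) %[ae leb in H].
Proof.
move=> f1 f2 g1 g2 w1 w2 e.
have r := wdB mH (@subset_itv_oo_cc _ _ l L) (L2S mE mH HE f1) (L2S mE mH HE f2)
  (L2S mE mH HE g1) (L2S mE mH HE g2) (wd_restrict mE mH HE w1) (wd_restrict mE mH HE w2).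
have r0 : is_weak_deriv H (fun x => f x - g x) (fun=> 0).
  by apply: wd_ext r => x Hx; rewrite e// subrr.
have [C e0] := wd0_const lL (L2B mH (L2S mE mH HE f1) (L2S mE mH HE g1)) r0.
by exists C; apply: (ae_eq_imp _ e0) => x _ <-; rewrite addrC subrK.
Qed.

Lemma even_refl f : (forall x, f (- x) = f x) ->
  (fun x => f (- x)) = (fun x => 1 * f x) %[ae leb in E].
Proof.
by move=> h; apply: ae_of_eq => x _; rewrite h mul1r.
Qed.

Lemma odd_refl f : (forall x, E x -> f (- x) = - f x) ->
  (fun x => f (- x)) = (fun x => -1 * f x) %[ae leb in E].
Proof.
by move=> h; apply: ae_of_eq => x Ex; rewrite h// mulN1r.
Qed.

Lemma n2_cst C : n2 H (fun=> C) = C ^+ 2 * (L - l).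
Proof.
have lI : fine (leb H) = L - l by rewrite lebesgue_measure_itv/= lte_fin lL -EFinB.
by rewrite /n2 Rintegral_cst//; congr (_ * _).
Qed.

Lemma bound_combine (k1 k2 nr q d C nw nz na nb : R) : 0 <= k1 -> 0 <= k2 -> 0 <= nr ->
  0 < q -> 0 <= nz -> 0 <= na -> 0 <= nb -> 0 < d ->
  nw <= k1 * (na + nb) -> C ^+ 2 * q <= 2 * nz + 2 * (k2 * nw) ->
  2 * nw + 2 * ((C * d) ^+ 2 * nr) <=
  (2 * k1 + 2 * d ^+ 2 * nr / q * (2 + 2 * k2 * k1)) * (nz + na + nb).
Proof.
move=> k10 k20 nr0 q0 z0 a0 b0 d0 w1 w2.
have S0 : na + nb <= nz + na + nb by lra.
have h1 : nw <= k1 * (nz + na + nb).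
  by apply: le_trans w1 _; rewrite ler_wpM2l.
have h2 : C ^+ 2 <= (2 + 2 * k2 * k1) / q * (nz + na + nb).
  rewrite mulrAC ler_pdivlMr//; apply: le_trans w2 _.
  have : k2 * nw <= k2 * (k1 * (nz + na + nb)) by rewrite ler_wpM2l.
  by move=> h; nra.
have h3 : 2 * d ^+ 2 * nr * C ^+ 2 <=
    2 * d ^+ 2 * nr * ((2 + 2 * k2 * k1) / q * (nz + na + nb)).
  by rewrite ler_wpM2l// mulr_ge0// mulr_ge0// sqr_ge0.
have -> : (2 * k1 + 2 * d ^+ 2 * nr / q * (2 + 2 * k2 * k1)) * (nz + na + nb) =
  2 * (k1 * (nz + na + nb)) + 2 * d ^+ 2 * nr * ((2 + 2 * k2 * k1) / q * (nz + na + nb)).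
  by field; rewrite gt_eqF.
have -> : 2 * ((C * d) ^+ 2 * nr) = 2 * d ^+ 2 * nr * C ^+ 2 by ring.
by lra.
Qed.

(** [glue] gives a signal [w] whose wave has the weak derivatives of [zt] and
    [q], up to their sign conventions, so only two constants remain. The one
    for [q] vanishes by the condition at the wall. The one for [zt] is added
    to [Prim w] on the last round trip by a pulse on [[0, tau - T0]]. *)
Lemma preimage_signal : exists2 K : R, 0 <= K & forall zt q a b : R -> R,
  L2 E zt -> L2 E q -> L2 E a -> L2 E b ->
  is_weak_deriv E zt a -> is_weak_deriv E q b ->
  (fun x => zt (- x)) = (fun x => 1 * zt x) %[ae leb in E] ->
  (fun x => q (- x)) = (fun x => -1 * q x) %[ae leb in E] ->
  trace E q L = 0 ->
  exists v, [/\ sig v, zt = zf (Prim v) tau %[ae leb in E],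
     q = qf (Prim v) tau %[ae leb in E] &
     n2 setT v <= K * (n2 E zt + n2 E a + n2 E b)].
Proof.
have d0 : 0 < tau - T0 by rewrite subr_gt0.
have t0 : 0 < tau := lt_trans T00 tau0.
have cn : c != 0 by rewrite gt_eqF.
have k10 : 0 <= 8 * c * (1 + c ^+ 2).
  by rewrite mulr_ge0 ?mulr_ge0 ?addr_ge0 ?sqr_ge0 ?ltW.
have k20 : 0 <= wave_const c * (tau * T0).
  exact: mulr_ge0 (ltW (wave_const_gt0 c0)) (mulr_ge0 (ltW t0) (ltW T00)).
pose hp := pulse 0 (tau - T0).
have Prim_head s : tau - T0 <= s -> Prim hp s = tau - T0.
  by move=> hs; rewrite Prim_pulse1// ?subr0// ltW.
have nr0 := n2_ge0 setT hp.
have q0 : 0 < L - l by rewrite subr_gt0.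
have e0 : 0 < c / (tau - T0) by rewrite divr_gt0.
exists (2 * (8 * c * (1 + c ^+ 2)) + 2 * (c / (tau - T0)) ^+ 2 * n2 setT hp / (L - l) *
   (2 + 2 * (wave_const c * (tau * T0)) * (8 * c * (1 + c ^+ 2)))).
  apply: addr_ge0; first by rewrite mulr_ge0.
  apply: mulr_ge0; last by rewrite addr_ge0// mulr_ge0// mulr_ge0.
  by rewrite mulr_ge0 ?invr_ge0 ?(ltW q0)// mulr_ge0// mulr_ge0// sqr_ge0.
move=> zt q a b Lz Lq La Lb wz wq ez eq qL.
have LaH := L2S mE mH HE La; have LbH := L2S mE mH HE Lb.
(* the solution of the equations stated in [hC1] and [hC2] below *)
pose al x := - c * (b x + c * a x).
pose be x := c * (c * a x - b x).
have Lal : L2 H al by apply: (L2Z _ mH); apply: (L2D mH LbH); exact: L2Z.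
have Lbe : L2 H be by apply: (L2Z _ mH); apply: L2B mH _ LbH; exact: L2Z.
pose w := glue al be.
have [hw nw] := glue_sig Lal Lbe.
rewrite -/w in hw nw.
have mT : mble (setT : set R) by exact: measurableT.
have nw1 : n2 setT w <= 8 * c * (1 + c ^+ 2) * (n2 E a + n2 E b).
  apply: le_trans nw _.
  have na := n2S mE mH HE La; have nb := n2S mE mH HE Lb.
  have n1 : n2 H al <= c ^+ 2 * (2 * n2 H b + 2 * (c ^+ 2 * n2 H a)).
    rewrite n2Z; [|exact: mH|by apply: (L2D mH LbH); exact: L2Z].
    rewrite sqrrN ler_wpM2l ?sqr_ge0// -(n2Z c mH LaH).
    by apply: n2D_le mH LbH _; exact: L2Z.
  have n2' : n2 H be <= c ^+ 2 * (2 * (c ^+ 2 * n2 H a) + 2 * n2 H b).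
    rewrite n2Z; [|exact: mH|by apply: L2B mH _ LbH; exact: L2Z].
    rewrite ler_wpM2l ?sqr_ge0// -(n2Z c mH LaH).
    by apply: n2B_le mH _ LbH; exact: L2Z.
  have na0 := n2_ge0 H a; have nb0 := n2_ge0 H b.
  apply: (@le_trans _ _ (2 / c * (c ^+ 2 * (4 * n2 E b + 4 * (c ^+ 2 * n2 E a))))).
    rewrite ler_wpM2l ?divr_ge0 ?(ltW c0)//.
    apply: le_trans (lerD n1 n2') _; rewrite -mulrDr ler_wpM2l ?sqr_ge0//.
    have : c ^+ 2 * n2 H a <= c ^+ 2 * n2 E a by rewrite ler_wpM2l ?sqr_ge0.
    by move: na nb; lra.
  have -> : 2 / c * (c ^+ 2 * (4 * n2 E b + 4 * (c ^+ 2 * n2 E a))) =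
     8 * c * (n2 E b + c ^+ 2 * n2 E a) by field.
  rewrite -[leRHS]mulrA ler_wpM2l ?mulr_ge0 ?(ltW c0)//.
  have h1 := n2_ge0 E a; have h2 := n2_ge0 E b.
  by rewrite mulrDr !mulrDl !mul1r; have := mulr_ge0 (sqr_ge0 c) h2; lra.
have cPw := Prim_cts hw.
have [z1 q1] := wave_cts_L2 l0 lL c0 tau cPw.
have [z2 q2 _ _] := wave_sig l0 lL c0 tau hw.
have [w1 w2] := wd_wave l0 lL c0 tau t0 hw.
have [C1 hC1] : exists C, zt = (fun x => zf (Prim w) tau x + C) %[ae leb in H].
  apply: (wd_sub_const Lz La z1 (L2Z _ mE q2) wz w1) => x Hx.
  by rewrite /w glue_qf// /al /be; field.
have [C2 hC2] : exists C, q = (fun x => qf (Prim w) tau x + C) %[ae leb in H].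
  apply: (wd_sub_const Lq Lb q1 (L2N mE z2) wq w2) => x Hx.
  by rewrite /w glue_zf// /al /be; field.
have Lzw := L2B mE Lz z1.
have C1b : C1 ^+ 2 * (L - l) <= 2 * n2 E zt + 2 * (wave_const c * (tau * T0) * n2 setT w).
  rewrite -n2_cst.
  have -> : n2 H (fun=> C1) = n2 H (fun x => zt x - zf (Prim w) tau x).
    apply: n2_ae => //; first exact: (L2S mE mH HE Lzw).1.
    apply: (ae_eq_imp _ hC1) => x Hx hA.
    by rewrite hA// addrAC subrr add0r.
  apply: le_trans (n2S mE mH HE Lzw) _; apply: le_trans (n2B_le mE Lz z1) _.
  rewrite lerD2l ler_wpM2l//.
  have nv := n2_ge0 setT w.
  have PB t : t <= tau -> `|Prim w t| <= Num.sqrt (tau * n2 setT w).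
    move=> _; rewrite -sqrtr_sqr ler_sqrt ?(mulr_ge0 (ltW t0) nv)//.
    exact: (Prim_bound t0 t hw).
  have [] := wave_bound l0 lL c0 cPw PB.
  rewrite sqr_sqrtr ?(mulr_ge0 (ltW t0) nv)//.
  by have -> : wave_const c * (tau * n2 setT w * T0) = wave_const c * (tau * T0) * n2 setT w by ring.
(* the pulse adds [k * (tau - T0) = C1 * c] to the profile after [tau - T0] *)
pose k := C1 * (c / (tau - T0)).
have hr : sig hp by apply: pulse_sig => //; rewrite gerBl ltW.
have hkr := sigZ k hr.
pose v t := w t + k * hp t.
have hv : sig v := sigD hw hkr.
have Pv s : tau - T0 <= s -> Prim v s = Prim w s + C1 * c.
  move=> hs; rewrite (Prim_sigD s hw hkr) Prim_sigZ// Prim_head// /k.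
  by congr (_ + _); field; rewrite gt_eqF.
have zv x : E x -> zf (Prim v) tau x = zf (Prim w) tau x + C1.
  move=> /(phases_in l0 lL c0 tau)[/andP[h1 _] /andP[h2 _]].
  by rewrite /wave_zeta !Pv//; field.
have qv x : E x -> qf (Prim v) tau x = qf (Prim w) tau x.
  move=> /(phases_in l0 lL c0 tau)[/andP[h1 _] /andP[h2 _]].
  by rewrite /wave_q !Pv//; congr (_ * (_ / _)); ring.
have en0 x : E x -> x != 0 by move=> Ex; exact: (two_sided_neq0 l0 lL c0 Ex).
have qE : q = (fun x => qf (Prim v) tau x + C2 * side x) %[ae leb in E].
  apply: (@sym_ext (-1)); [by rewrite mulrNN mulr1|exact: eq| |].
    apply: odd_refl => x Ex; rewrite (wave_q_odd l0 lL)// sideN ?en0//; ring.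
  apply: (ae_eq_imp _ hC2) => x Hx hA.
  rewrite hA// qv; last exact: HE.
  by move: Hx; rewrite /= in_itv/= /side => /andP[h1 _]; rewrite (lt_trans l0 h1) mulr1.
have LN : `|L| = l \/ `|L| = L by right; rewrite gtr0_norm// (lt_trans l0).
have C20 : C2 = 0.
  have cPv := Prim_cts hv.
  have cg y : y != 0 -> {for y, continuous (fun x => qf (Prim v) tau x + C2 * side x)}.
    move=> y0; apply: cvgD; first exact: wave_q_cts.
    by apply: cvgM; [exact: cvg_cst|exact: side_cts].
  have := trace_wave l0 lL c0 LN cg qE.
  have [-> _] := wave_q_L l0 lL c0 (Prim v) tau.
  by rewrite qL /side (lt_trans l0 lL) mulr1 add0r.
exists v; split => //.
- apply: (@sym_ext 1); [by rewrite mulr1|exact: ez| |].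
    by apply: even_refl => x; rewrite wave_zeta_even.
  apply: (ae_eq_imp _ hC1) => x Hx hA.
  by rewrite hA// zv//; exact: HE.
- apply: (ae_eq_imp _ qE) => x Hx hA.
  by rewrite hA// C20 mul0r addr0.
- apply: le_trans (n2D_le mT hw.1 hkr.1) _; rewrite (n2Z _ mT hr.1).
  exact: bound_combine k10 k20 nr0 q0 (n2_ge0 _ _) (n2_ge0 _ _) (n2_ge0 _ _) e0 nw1 C1b.
Qed.

(** Here [glue] gives the profile itself, as a function of class L2. The velocity
    depends on its values at [tau] and [tau - T0], which an approximation in L2
    does not control; a ramp on a short interval [[tau - h, tau]] sets it. *)
Lemma dense_signal zt q et e : L2 E zt -> L2 E q ->
  (fun x => zt (- x)) = (fun x => 1 * zt x) %[ae leb in E] ->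
  (fun x => q (- x)) = (fun x => -1 * q x) %[ae leb in E] -> 0 < e ->
  exists v, [/\ sig v, n2 E (fun x => zt x - zf (Prim v) tau x) < e,
    n2 E (fun x => q x - qf (Prim v) tau x) < e & wave_eta l L c (Prim v) tau = et].
Proof.
move=> Lz Lq ez eq e0; have tT0 := tau0.
have t0 : 0 < tau := lt_trans T00 tau0.
have cn : c != 0 by rewrite gt_eqF.
have LzH := L2S mE mH HE Lz; have LqH := L2S mE mH HE Lq.
pose P0 := glue (fun x => c * zt x + q x) (fun x => c * zt x - q x).
have [hP0 _] : sig P0 /\ _ := glue_sig (L2D mH (L2Z c mH LzH) LqH) (L2B mH (L2Z c mH LzH) LqH).
have zE : zt = zf P0 tau %[ae leb in E].
  apply: (@sym_ext 1); [by rewrite mulr1|exact: ez| |].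
    by apply: even_refl => x; rewrite wave_zeta_even.
  by apply: ae_of_eq => x Hx; rewrite glue_zf//; field.
have qE : q = qf P0 tau %[ae leb in E].
  apply: (@sym_ext (-1)); [by rewrite mulrNN mulr1|exact: eq| |].
    by apply: odd_refl => x Ex; rewrite (wave_q_odd l0 lL).
  by apply: ae_of_eq => x Hx; rewrite glue_qf//; field.
have mI (i : interval R) : mble [set` i] by exact: mble_itv.
have CW0 := wave_const_gt0 c0.
have e1 : 0 < e / (8 * wave_const c) by rewrite divr_gt0// mulr_gt0.
have mT : mble (setT : set R) by exact: measurableT.
have LO : L2 `]0, tau[ P0 := L2S mT (mI _) (@subsetT _ _) hP0.1.
have [phi [dphi [a' [b' [[a0 b0] dp cdp sp np]]]]] := dense_C1c t0 LO e1.
have tp := supp_test dp cdp sp a0 b0.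
have out x : ~ (0 < x < tau) -> phi x = 0 /\ dphi x = 0.
  move=> xn; have [] := test_out (x := x) tp; first by rewrite /= in_itv.
  by rewrite (derive1_is (dp x)).
have cphi : continuous phi := derive_cts dp.
have hd : sig dphi.
  have sd : supp_in 0 tau dphi.
    move=> t tn; have [] // := out t _; move=> /andP[h1 h2]; apply: tn; by rewrite !ltW.
  split => //; have := L2_patch (mI _) (L2_cts (mI _) (fun x h => h) cdp : L2 `[0, tau] dphi).
  congr L2; apply/funext => t; rewrite /patch; case: ifPn => // /negP tn.
  by rewrite sd// => h'; apply: tn; apply/mem_set; rewrite /= in_itv.
have Pd s : 0 < s -> Prim dphi s = phi s.
  move=> s0; rewrite (Prim_int 0 (fun t => @sig_left _ _ _ t hd)) ?(ltW s0)//.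
  have [_ ->] := FTC s0 (fun x _ => dp x) (fun x _ => cdp x).
  by have [-> _] := out 0 ltac:(by rewrite ltxx); rewrite subr0.
(* the value of the profile at [tau] for which the velocity is [et] *)
pose ka := phi (tau - T0) - 2 * l * et.
have k1 : 0 < ka ^+ 2 + 1 by rewrite ltr_wpDl ?sqr_ge0.
have kp : 0 < 8 * wave_const c * (ka ^+ 2 + 1) := mulr_gt0 (mulr_gt0 (ltr0Sn _ 7) CW0) k1.
(* the ramp has squared norm at most [ka ^+ 2 * h] *)
pose h := Num.min (T0 / 2) (e / (8 * wave_const c * (ka ^+ 2 + 1))).
have h0 : 0 < h by rewrite lt_min (divr_gt0 T00 (ltr0Sn _ 1)) (divr_gt0 e0 kp).
have hT : h < T0 by rewrite gt_min ltr_pdivrMr// ltr_pMr// ltr1n.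
have hk : ka ^+ 2 * h <= e / (8 * wave_const c).
  have hle : h <= e / (8 * wave_const c * (ka ^+ 2 + 1)) by rewrite ge_min lexx orbT.
  apply: le_trans (ler_wpM2l (sqr_ge0 ka) hle) _.
  have -> : ka ^+ 2 * (e / (8 * wave_const c * (ka ^+ 2 + 1))) = e / (8 * wave_const c) * (ka ^+ 2 / (ka ^+ 2 + 1)).
    by field; rewrite !gt_eqF// ltr_wpDl// sqr_ge0.
  have k2 := sqr_ge0 ka.
  rewrite ger_pMr// ler_pdivrMr ?mul1r ?ltr_wpDl//; lra.
pose tl := pulse (tau - h) tau.
have th : 0 < tau - h by have := tau0; lra.
have htl : sig tl by apply: pulse_sig => //; exact: ltW.
pose v t := dphi t + ka / h * tl t.
have hk2 := sigZ (ka / h) htl.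
have hv : sig v := sigD hd hk2.
have Pv s : 0 < s -> Prim v s = phi s + ka * (Prim tl s / h).
  by move=> s0; rewrite (Prim_sigD s hd hk2) Prim_sigZ// Pd//; ring.
have IT : `[tau - T0, tau] `<=` (`[0, tau]%classic : set R).
  by move=> x /=; rewrite !in_itv/= => /andP[k ->]; rewrite andbT; lra.
have LI f : L2 setT f -> L2 `[tau - T0, tau] f := fun k => L2S mT (mI _) (@subsetT _ _) k.
have cPt : continuous (fun s => Prim tl s / h).
  by apply: cts_mul; [exact: Prim_cts htl|exact: cts_cst].
have LS : L2 `[tau - T0, tau] (fun s => Prim tl s / h) by exact: L2_cts (mI _) IT cPt.
have nS : n2 `[tau - T0, tau] (fun s => Prim tl s / h) <= h.
  have hI : (`[tau - h, tau]%classic : set R) `<=` `[tau - T0, tau].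
    by move=> x /=; rewrite !in_itv/= => /andP[k ->]; rewrite andbT; lra.
  have -> : n2 `[tau - T0, tau] (fun s => Prim tl s / h) = n2 `[tau - h, tau] (fun s => Prim tl s / h).
    apply: Rint_shrink => // x /=; rewrite !in_itv/= => /andP[_ x2] xn.
    rewrite Prim_pulse0 ?mul0r ?expr0n// ltNge; apply/negP => k; apply: xn; by rewrite k.
  have lI : fine (leb (`[tau - h, tau]%classic : set R)) = h.
    by rewrite lebesgue_measure_itv/= lte_fin ifT -?EFinB/=; [ring|lra].
  have := @n2_bounded R `[tau - h, tau] (fun s => Prim tl s / h) 1 (mI _) (leb_itv_fin _ _ _ _)
     (cts_meas (mI _) cPt).
  rewrite lI expr1n mul1r; apply => x /=; rewrite in_itv/= => xI; rewrite Prim_pulse//.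
  have /andP[x1 x2] := xI.
  rewrite normrM ger0_norm ?subr_ge0// gtr0_norm ?invr_gt0//.
  by rewrite ler_pdivrMr// mul1r; lra.
have Lp : L2 `[tau - T0, tau] phi by exact: L2_cts (mI _) IT cphi.
have LP0 := LI _ hP0.1.
have cPv := Prim_cts hv.
have LPv : L2 `[tau - T0, tau] (Prim v) by exact: L2_cts (mI _) IT cPv.
have nP : n2 `[tau - T0, tau] (fun t => P0 t - phi t) < e / (8 * wave_const c).
  have LI0 : L2 `[0, tau] (fun t => P0 t - phi t).
    apply: (L2B (mI _)); first exact: L2S mT (mI _) (@subsetT _ _) hP0.1.
    exact: L2_cts (mI _) (fun x k => k) cphi.
  apply: le_lt_trans (n2S (mI _) (mI _) IT LI0) _.
  by rewrite /n2 -Rint_oo_cc//; exact: LI0.2.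
have nD : n2 `[tau - T0, tau] (fun t => P0 t - Prim v t) < e / (2 * wave_const c).
  have -> : n2 `[tau - T0, tau] (fun t => P0 t - Prim v t) =
     n2 `[tau - T0, tau] (fun t => (P0 t - phi t) - ka * (Prim tl t / h)).
    apply: eq_Rintegral => t /set_mem /=; rewrite in_itv/= => /andP[t1 t2].
    by rewrite Pv; [congr (_ ^+ 2); ring|lra].
  apply: le_lt_trans (n2B_le (mI _) (L2B (mI _) LP0 Lp) (L2Z ka (mI _) LS)) _.
  rewrite (n2Z ka (mI _) LS).
  have k3 := ler_wpM2l (sqr_ge0 ka) nS.
  have -> : e / (2 * wave_const c) = 4 * (e / (8 * wave_const c)) by field; rewrite gt_eqF.
  by move: nP hk k3; lra.
have fin : wave_const c * n2 `[tau - T0, tau] (fun t => P0 t - Prim v t) < e.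
  apply: (@lt_le_trans _ _ (wave_const c * (e / (2 * wave_const c)))); first by rewrite ltr_pM2l.
  have -> : wave_const c * (e / (2 * wave_const c)) = e / 2 by field; rewrite gt_eqF.
  by lra.
have [y1 y2 y3 y4] := wave_L2 l0 lL c0 (L2B (mI _) LP0 LPv).
have [u1 u2 _ _] := wave_sig l0 lL c0 tau hP0.
have [v1 v2] := wave_cts_L2 l0 lL c0 tau cPv.
exists v; split => //.
- apply: le_lt_trans fin; apply: le_trans y3; apply: le_of_eq.
  apply: n2_ae => //; [exact: (L2B mE Lz v1).1|exact: y1.1|].
  apply: (ae_eq_imp _ zE) => x Ex hA.
  by rewrite hA// wave_zetaB.
- apply: le_lt_trans fin; apply: le_trans y4; apply: le_of_eq.
  apply: n2_ae => //; [exact: (L2B mE Lq v2).1|exact: y2.1|].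
  apply: (ae_eq_imp _ qE) => x Ex hA.
  by rewrite hA// wave_qB.
- have tT : 0 < tau - T0 by rewrite subr_gt0.
  rewrite /wave_eta Pv// Pv// Prim_pulse0 ?ltrD2l ?ltrN2// Prim_pulse; last by lra.
  have [-> _] := out tau ltac:(by rewrite ltxx andbF).
  by rewrite /ka; field; rewrite !gt_eqF.
Qed.

End Fold.

(** * The reachable space *)

Section Main.
Context {R : realType} (p : params R).
Hypotheses (adm : admissible p) (LL : Lright p = Lleft p).
Implicit Types (f g v w P : R -> R) (s t x : R) (z : state R).

Local Notation l := (halfl p).
Local Notation L := (Lright p).
Local Notation E := (Edom p).
Local Notation M := (M_ p).
Local Notation c := (celerity p).
Local Notation T0 := (round_trip l L c).
Local Notation zf := (wave_zeta l L c).
Local Notation qf := (wave_q l L c).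
Local Notation etaf := (wave_eta l L c).
Local Notation deltaf := (wave_delta l L c).
Local Notation N := (normX p).
Local Notation X := (spaceX p).
Local Notation S := (spaceS p).
Local Notation W := (spaceW p).
Local Notation wave_state := (wave_state p).
Local Notation cforce := (cforce p).
Let l0 := l_gt0 adm.
Let c0 := celerity_gt0 adm.
Let lL_ := halfl_lt_L adm.
Let mE : mble E := mble_E p.

(** The symmetry of the tank. Symmetric states are its fixed points. *)
Definition mirror z : state R :=
  mkstate (fun x => zeta z (- x)) (fun x => - q_ z (- x)) (- qi z) (delta z) (eta z).

Lemma n2_refl f : L2 E f -> L2 E (fun x => f (- x)) /\ n2 E (fun x => f (- x)) = n2 E f.
Proof.
move=> hf; have a1 : (-1 : R) != 0 by rewrite oppr_eq0 oner_neq0.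
have [h1 h2] := L2_affine 0 a1 (L2_patch mE hf).
have e : (fun x : R => (f \_ E) (-1 * x + 0)) = (fun x => f (- x)) \_ E.
  apply/funext => x; rewrite mulN1r addr0 !patchE.
  have -> : (- x \in E) = (x \in E); last by [].
  rewrite EdomE//; apply/idP/idP => /set_mem H; apply/mem_set; move: H;
  by rewrite /two_sided /= !in_itv/= => -[] /andP[? ?]; [right|left]; apply/andP; split; lra.
rewrite e in h1 h2.
split; last by rewrite -n2_patch h2 normrN normr1 invr1 mul1r n2_patch.
have mT : mble (setT : set R) by exact: measurableT.
have := L2S mT mE (@subsetT _ _) h1 => -[m1 i1]; split.
  apply: (eq_measurable_fun _ _ m1) => // x xE; by rewrite patchE xE.
apply: eq_integrable i1 => // x xE; by rewrite patchE xE.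
Qed.

Lemma mirror_preX z : preX p z -> preX p (mirror z) /\ N (mirror z) = N z.
Proof.
move=> hz; have [[z1 z2] [q1 q2]] := hz.
have [a1 b1] := n2_refl z1; have [a2 b2] := n2_refl z2.
have [a3 b3] := n2_refl q1; have [a4 b4] := n2_refl q2.
have e1 : (fun x => Re (q_ (mirror z) x)) = (fun x => - Re (q_ z (- x))).
  by apply/funext => x; rewrite ReN.
have e2 : (fun x => Im (q_ (mirror z) x)) = (fun x => - Im (q_ z (- x))).
  by apply/funext => x; rewrite ImN.
have pr : preX p (mirror z).
  by split; split => //; rewrite ?e1 ?e2; exact: L2N.
split => //; apply/eqP; rewrite -(@eqrXn2 _ 2)// ?normX_ge0//; apply/eqP.
rewrite !normX_sqr// !rip_self// e1 e2 !n2N.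
by rewrite b1 b2 b3 b4 /qi /= ReN ImN !sqrrN.
Qed.

Lemma mirror_S z : S z -> eq_state p (mirror z) z.
Proof.
move=> [_ h1 h2 h3]; split => //; last by rewrite /qi /= -/(qi z) h3 oppr0.
apply: (ae_eq_imp _ h2) => x Ex h.
by rewrite /q_ /= -/(q_ z) h// opprK.
Qed.

Lemma mirrorB (z w : state R) : mirror (z - w) = mirror z - mirror w.
Proof.
apply: stateP; rewrite !stE //=.
- by apply/funext => x; rewrite -[LHS]/(- (q_ z (- x) - q_ w (- x))) opprD.
- by rewrite -[LHS]/(- (qi z - qi w)) opprD.
Qed.

(** A state close to a symmetric one is close to its own mirror image, as
    [mirror] is an isometry; so the distance from [z] to [mirror z] is 0. *)
Lemma S_closed z : X z ->
  (forall e, 0 < e -> exists w : state R, [/\ X w, S w & N (z - w) < e]) -> S z.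
Proof.
move=> hz H; have pz := X_preX hz; have [pr _] := mirror_preX pz.
have e0 : N (mirror z - z) = 0.
  apply/eqP; rewrite eq_le normX_ge0 andbT; apply/ler_addgt0Pr => e e0; rewrite add0r.
  have e2 : 0 < e / 2 by rewrite divr_gt0.
  have [w [hw sw nw]] := H _ e2.
  have pw := X_preX hw; have [pJw _] := mirror_preX pw.
  have pzw := preXB pz pw; have [pJ nJ] := mirror_preX pzw.
  have -> : mirror z - z = mirror (z - w) + ((mirror w - w) + - (z - w)).
    by rewrite mirrorB opprB !subrKA.
  have pJd := preXB pJw pw.
  have n0 : N (mirror w - w) = 0.
    have [h1 h2 h3 h4 h5] := mirror_S sw.
    rewrite (normX_eq pJd (preXB pw pw)).
      have := normXZ 0 pw; rewrite subrr normr0 mul0r.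
      by have -> : 0%:C *: w = 0 by rewrite scale0r.
    split; rewrite !stE; last first.
    - by rewrite h5.
    - by rewrite h4.
    - by rewrite h3.
    - by apply: (ae_eq_imp _ h2) => x _ ->.
    - by apply: (ae_eq_imp _ h1) => x _ ->.
  have t1 := normX_triangle adm pJ (preXD pJd (preXN pzw)).
  have t2 := normX_triangle adm pJd (preXN pzw).
  rewrite normXN// n0 add0r in t2.
  apply: le_trans t1 _; rewrite nJ [e]splitr; apply: lerD; first exact: ltW.
  exact: le_trans t2 (ltW nw).
have [h1 h2 h3 h4 h5] := normX0_eq adm pr pz e0.
split => //.
- apply: (ae_eq_imp _ h2) => x Ex h.
  by rewrite -h -[q_ (mirror z) x]/(- q_ z (- x)) opprK.
- apply/eqP; have := h3; rewrite /qi /= -/(qi z) => /eqP.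
  by rewrite eq_sym -addr_eq0 -mulr2n mulrn_eq0.
Qed.

Lemma S_rstate z : S z -> z = rstate (fun x => Re (zeta z x)) (fun x => Im (zeta z x))
  (fun x => Re (q_ z x)) (fun x => Im (q_ z x))
  (Re (delta z)) (Im (delta z)) (Re (eta z)) (Im (eta z)).
Proof.
move=> [_ _ _ h].
have e (w : R[i]) : w = Re w +i* Im w by case: w.
by apply: stateP; rewrite ?h //; try (apply/funext => x); exact: e.
Qed.

Lemma S_parity z : S z ->
  [/\ (fun x => Re (zeta z (- x))) = (fun x => 1 * Re (zeta z x)) %[ae leb in E],
      (fun x => Im (zeta z (- x))) = (fun x => 1 * Im (zeta z x)) %[ae leb in E],
      (fun x => Re (q_ z (- x))) = (fun x => -1 * Re (q_ z x)) %[ae leb in E] &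
      (fun x => Im (q_ z (- x))) = (fun x => -1 * Im (q_ z x)) %[ae leb in E]].
Proof.
move=> [_ /cae[h1 h2] /cae[h3 h4] _]; split.
- by apply: (ae_eq_imp _ h1) => x _ ->; rewrite mul1r.
- by apply: (ae_eq_imp _ h2) => x _ ->; rewrite mul1r.
- by apply: (ae_eq_imp _ h3) => x _ ->; rewrite ReN mulN1r.
- by apply: (ae_eq_imp _ h4) => x _ ->; rewrite ImN mulN1r.
Qed.

Lemma X_volume z : X z ->
  \int[leb]_(x in E) Re (zeta z x) = - (2 * l) * Re (delta z) /\
  \int[leb]_(x in E) Im (zeta z x) = - (2 * l) * Im (delta z).
Proof.
move=> [_ _ h]; split.
  have := congr1 (@complex.Re R) h; rewrite ReD Re_realM /= => k.
  by rewrite mulNr; apply/eqP; rewrite -addr_eq0 k.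
have := congr1 (@complex.Im R) h; rewrite ImD Im_realM /= => k.
by rewrite mulNr; apply/eqP; rewrite -addr_eq0 k.
Qed.

Lemma W_sub_X z : W z -> X z.
Proof. by move=> [[[[h1 _] [h2 _]] [[h3 _] [h4 _]]] vol _ _ _]; split. Qed.

Lemma sum_regroup (a a' b b' d d' q : R) : 0 <= q ->
  a + b + d + (a' + b' + d') <= a + a' + (b + b') + (q + (d + d')).
Proof. by lra. Qed.

Lemma normW_ge z : W z ->
  n2 E (fun x => Re (zeta z x)) + n2 E (weak_deriv E (fun x => Re (zeta z x))) +
  n2 E (weak_deriv E (fun x => Re (q_ z x))) +
  (n2 E (fun x => Im (zeta z x)) + n2 E (weak_deriv E (fun x => Im (zeta z x))) +
   n2 E (weak_deriv E (fun x => Im (q_ z x)))) <= normW p z ^+ 2.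
Proof.
move=> [[[z1 z2] [q1 q2]] _ _ _ _].
have [[m1 _] [m2 _]] := (wd_weak z1, wd_weak z2).
have [[m3 _] [m4 _]] := (wd_weak q1, wd_weak q2).
have sq (a : R[i]) : 0 <= sqrabs a.
  by rewrite /sqrabs Re_mulconj -!expr2 addr_ge0 ?sqr_ge0.
have E1 : sqrL2norm E (zeta z) = sqnorm E (zeta z).
  by apply: sqrL2normE => //; split; [exact: z1.1|exact: z2.1].
have E2 : sqrL2norm E (q_ z) = sqnorm E (q_ z).
  by apply: sqrL2normE => //; split; [exact: q1.1|exact: q2.1].
have E3 : sqrL2norm E (cweak_deriv E (zeta z)) = sqnorm E (cweak_deriv E (zeta z)).
  by apply: (sqrL2normE mE); exact: (conj m1 m2).
have E4 : sqrL2norm E (cweak_deriv E (q_ z)) = sqnorm E (cweak_deriv E (q_ z)).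
  by apply: (sqrL2normE mE); exact: (conj m3 m4).
have p2 := sqnorm_ge0 E (q_ z).
have [s1 [s2 s3]] := (sq (qi z), (sq (delta z), sq (eta z))).
have pp : 0 <= sqrH1norm E (zeta z) + sqrH1norm E (q_ z).
  rewrite /sqrH1norm E1 E2 E3 E4.
  by apply: addr_ge0; apply: addr_ge0; exact: sqnorm_ge0.
have p0 : 0 <= sqrH1norm E (zeta z) + sqrH1norm E (q_ z)
   + sqrabs (qi z) + sqrabs (delta z) + sqrabs (eta z).
  by apply: addr_ge0 s3; apply: addr_ge0 s2; exact: addr_ge0 pp s1.
rewrite /normW sqr_sqrtr//.
apply: (@le_trans _ _ (sqrH1norm E (zeta z) + sqrH1norm E (q_ z))); last first.
  exact: ler_wpDr s3 (ler_wpDr s2 (ler_wpDr s1 (lexx _))).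
rewrite /sqrH1norm E1 E2 E3 E4; exact: sum_regroup.
Qed.

Variables (T : R -> state R -> state R) (tau : R).
Hypotheses (ug : unitary_group p T) (gen : generated_by_A p T).
Hypothesis tauT : T0 < tau.
Local Notation sig := (signal tau).
Local Notation I := (`[0, tau]%classic : set R).
Let mI : mble I. Proof. exact: mble_itv. Qed.
Let tau0 : 0 < tau := lt_trans (round_trip_gt0 lL_ c0) tauT.

Lemma input_eq (u : R -> R[i]) z (w : state R) : cL2 I u -> X z -> eq_state p z w ->
  input_map p T tau u w -> input_map p T tau u z.
Proof.
move=> hu hz e /(input_mapP adm ug tau0 _ hu)[hw H].
apply/(input_mapP adm ug tau0 _ hu); split => // y hy.
by rewrite -H//; apply: rip_eql => //; exact: X_preX.
Qed.

Lemma norm_halfl : `|l| = l \/ `|l| = L. Proof. by left; rewrite gtr0_norm. Qed.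
Lemma norm_Nhalfl : `|- l| = l \/ `|- l| = L. Proof. by left; rewrite normrN gtr0_norm. Qed.

Lemma trace_jump q v x : sig v -> q = qf (Prim v) tau %[ae leb in E] ->
  `|x| = l \/ `|x| = L -> trace E q x = qf (Prim v) tau x.
Proof.
move=> hv e xl; move: e; rewrite EdomE// => e.
by apply: (trace_wave l0 lL_ c0 xl _ e) => y y0; apply: wave_q_cts => //; exact: Prim_cts hv.
Qed.

(** One signal for the real parts and one for the imaginary parts. The volume
    constraint determines [delta], and the jump at the object determines [eta]. *)
Lemma W_preimage : exists2 K : R, 0 <= K & forall z, W z -> S z ->
  exists v1 v2, [/\ sig v1, sig v2, eq_state p z (wave_state (Prim v1) (Prim v2) tau) &
    n2 setT v1 + n2 setT v2 <= K * normW p z ^+ 2].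
Proof.
have [K K0 H] := preimage_signal l0 lL_ c0 tauT.
exists K => // z Wz Sz.
have hX := W_sub_X Wz; have nW := normW_ge Wz.
have [vr vi] := X_volume hX.
have [par1 par2 par3 par4] := S_parity Sz.
have [[[z1 z2] [q1 q2]] _ jp _ [_ tL]] := Wz.
have [[m1 w1] [m2 w2]] := (wd_weak z1, wd_weak z2).
have [[m3 w3] [m4 w4]] := (wd_weak q1, wd_weak q2).
have t1 : trace E (fun y => Re (q_ z y)) L = 0.
  by have := congr1 (@complex.Re R) tL; rewrite /ctrace /=.
have t2 : trace E (fun y => Im (q_ z y)) L = 0.
  by have := congr1 (@complex.Im R) tL; rewrite /ctrace /=.
have EE' := EdomE LL.
have [v1 [hv1 a1 a2 a3]] : exists v, [/\ sig v,
   (fun x => Re (zeta z x)) = zf (Prim v) tau %[ae leb in E],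
   (fun x => Re (q_ z x)) = qf (Prim v) tau %[ae leb in E] &
   n2 setT v <= K * (n2 E (fun x => Re (zeta z x)) +
     n2 E (weak_deriv E (fun x => Re (zeta z x))) +
     n2 E (weak_deriv E (fun x => Re (q_ z x))))].
  move: (H (fun x => Re (zeta z x)) (fun x => Re (q_ z x))
    (weak_deriv E (fun x => Re (zeta z x))) (weak_deriv E (fun x => Re (q_ z x)))).
  rewrite -EE'; apply => //; [exact: z1.1|exact: q1.1].
have [v2 [hv2 b1 b2 b3]] : exists v, [/\ sig v,
   (fun x => Im (zeta z x)) = zf (Prim v) tau %[ae leb in E],
   (fun x => Im (q_ z x)) = qf (Prim v) tau %[ae leb in E] &
   n2 setT v <= K * (n2 E (fun x => Im (zeta z x)) +
     n2 E (weak_deriv E (fun x => Im (zeta z x))) +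
     n2 E (weak_deriv E (fun x => Im (q_ z x))))].
  move: (H (fun x => Im (zeta z x)) (fun x => Im (q_ z x))
    (weak_deriv E (fun x => Im (zeta z x))) (weak_deriv E (fun x => Im (q_ z x)))).
  rewrite -EE'; apply => //; [exact: z2.1|exact: q2.1].
have del f v : sig v -> L2 E f -> f = zf (Prim v) tau %[ae leb in E] ->
    forall d, \int[leb]_(x in E) f x = - (2 * l) * d -> d = deltaf (Prim v) tau.
  move=> hv Lf fe d; have cP := Prim_cts hv.
  have [y1 _] := wave_cts_L2 l0 lL_ c0 tau cP; rewrite -EE' in y1.
  rewrite (Rint_ae mE Lf.1 y1.1 fe) EE'.
  rewrite (wave_zeta_volume l0 lL_ c0 tau cP (fun t => @Prim_sig_neg _ _ v t hv)) => /esym h.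
  by apply: (mulfI _ h); rewrite oppr_eq0 mulf_neq0// gt_eqF.
have eta' v e : sig v -> qf (Prim v) tau l - qf (Prim v) tau (- l) = - (2 * l) * e ->
    e = etaf (Prim v) tau.
  move=> hv; rewrite wave_q_l// wave_q_Nl// => h.
  have ln : l != 0 by rewrite gt_eqF.
  have -> : e = - (- (2 * l) * e) / (2 * l) by field.
  by rewrite -h /wave_eta; field.
exists v1, v2; split => //; last first.
  by apply: le_trans (lerD a3 b3) _; rewrite -mulrDr ler_wpM2l.
split.
- exact: cae_conj.
- exact: cae_conj.
- by have [_ _ _ ->] := Sz.
- apply: complexP; first exact: (del _ _ hv1 z1.1 a1 _ vr).
  exact: (del _ _ hv2 z2.1 b1 _ vi).
- apply: complexP.
    have := congr1 (@complex.Re R) jp; rewrite Re_realNM /jump ReD ReN /=.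
    rewrite (trace_jump hv1 a2 norm_halfl) (trace_jump hv1 a2 norm_Nhalfl); exact: eta'.
  have := congr1 (@complex.Im R) jp; rewrite Im_realNM /jump ImD ImN /=.
  rewrite (trace_jump hv2 b2 norm_halfl) (trace_jump hv2 b2 norm_Nhalfl); exact: eta'.
Qed.

Lemma W_Ran z : W z -> S z -> Ran p T tau z.
Proof.
have [K _ H] := W_preimage => Wz Sz; have [v1 [v2 [h1 h2 e _]]] := H z Wz Sz.
have hu := cforce_cL2 adm LL tau0 h1 h2.
exact: (Ran_input adm tau0 ug hu (input_eq hu (W_sub_X Wz) e (input_sig adm LL tau0 ug gen h1 h2))).
Qed.

Lemma W_normRan : exists C : R, forall z, W z /\ S z -> normRan p T tau z <= C * normW p z.
Proof.
have [K K0 H] := W_preimage; have [D D0 G] := cforce_bound adm LL tau0.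
exists (Num.sqrt (D * K)) => z [Wz Sz]; have [v1 [v2 [h1 h2 e le]]] := H z Wz Sz.
have hu := cforce_cL2 adm LL tau0 h1 h2.
have iz := input_eq hu (W_sub_X Wz) e (input_sig adm LL tau0 ug gen h1 h2).
apply: le_trans (normRan_le adm tau0 ug hu iz) _.
have DK : 0 <= D * K by exact: mulr_ge0 (ltW D0) K0.
have w0 : 0 <= normW p z by exact: sqrtr_ge0.
rewrite -[normW p z](ger0_norm w0) -sqrtr_sqr -sqrtrM// ler_sqrt; last first.
  exact: mulr_ge0 DK (sqr_ge0 _).
apply: le_trans (G _ _ h1 h2) _; by rewrite -[leRHS]mulrA ler_wpM2l// ltW.
Qed.

Lemma input_approx (u : R -> R[i]) e : cL2 I u -> 0 < e -> exists v1 v2,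
  [/\ sig v1, sig v2 & sqnorm I (fun s => u s - cforce v1 v2 s) < e].
Proof. by move=> hu e0; exact: cforce_dense. Qed.

(** Waves are symmetric, and approximate [z] because their inputs approximate
    the input that reaches [z]. *)
Lemma Ran_S z : Ran p T tau z -> S z.
Proof.
move=> [u [hu iz]]; have hI := cL2_Rp tau hu.
have hz : X z by have /(input_mapP adm ug tau0 _ hI)[] := iz.
apply: S_closed => // e e0.
have C0 : 0 < input_const p tau + 1 by rewrite ltr_wpDl// input_const_ge0.
have d0 : 0 < e ^+ 2 / (input_const p tau + 1) by rewrite divr_gt0// exprn_gt0.
have [v1 [v2 [h1 h2 nu]]] := input_approx hI d0.
exists (wave_state (Prim v1) (Prim v2) tau); split.
- exact: (wave_state_X adm LL _ h1 h2).
- exact: (wave_state_S adm LL _ h1 h2).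
- have hv := cforce_cL2 adm LL tau0 h1 h2.
  have id := input_sub adm ug tau0 hI hv iz (input_sig adm LL tau0 ug gen h1 h2).
  have nb := input_norm adm ug tau0 (cL2_sub hI hv) id.
  rewrite -(@ltr_pXn2r _ 2)// ?nnegrE ?normX_ge0 ?(ltW e0)//.
  apply: le_lt_trans nb _.
  apply: (@le_lt_trans _ _ ((input_const p tau + 1) * sqnorm I (fun s => u s - cforce v1 v2 s))).
    by rewrite ler_wpM2r ?sqnorm_ge0// lerDl.
  by rewrite mulrC -ltr_pdivlMr.
Qed.

(** As for [Ran_S], the error being now measured by the input. *)
Lemma W_dense z e : Ran p T tau z -> 0 < e ->
  exists2 w, (W `&` S) w & normRan p T tau (z - w) < e.
Proof.
move=> [u [hu iz]] e0; have hI := cL2_Rp tau hu.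
have [v1 [v2 [h1 h2 nu]]] := input_approx hI (exprn_gt0 2 e0).
exists (wave_state (Prim v1) (Prim v2) tau).
  by split; [exact: (wave_state_W adm LL tau0 _ h1 h2)|exact: (wave_state_S adm LL _ h1 h2)].
have hv := cforce_cL2 adm LL tau0 h1 h2.
have id := input_sub adm ug tau0 hI hv iz (input_sig adm LL tau0 ug gen h1 h2).
apply: le_lt_trans (normRan_le adm tau0 ug (cL2_sub hI hv) id) _.
by rewrite -[e](ger0_norm (ltW e0)) -sqrtr_sqr ltr_sqrt// exprn_gt0.
Qed.

Lemma wave_delta_close f v d : sig v -> L2 E f -> \int[leb]_(x in E) f x = - (2 * l) * d ->
  (d - deltaf (Prim v) tau) ^+ 2 <=
  fine (leb E) / (2 * l) ^+ 2 * n2 E (fun x => f x - zf (Prim v) tau x).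
Proof.
move=> hv Lf vol; have cP := Prim_cts hv.
have [y1 _] := wave_cts_L2 l0 lL_ c0 tau cP; rewrite -EdomE// in y1.
have fE : (leb E < +oo)%E by rewrite EdomE//; exact: fin_sub (@mble_two_sided _ _ _) (two_sided_sub l0).
have := int_sqr_le mE fE (L2B mE Lf y1).
have vz := wave_zeta_volume l0 lL_ c0 tau cP (fun t => @Prim_sig_neg _ _ v t hv).
rewrite -EdomE// in vz.
rewrite RintegralB//; [|exact: (L2_integrable mE fE Lf)|exact: (L2_integrable mE fE y1)].
rewrite vol vz -mulrBr mulNr sqrrN exprMn => h.
by rewrite mulrAC ler_pdivlMr ?exprn_gt0 ?mulr_gt0// mulrC.
Qed.

Lemma Ran_dense z e : X z -> S z -> 0 < e ->
  exists2 w, Ran p T tau w & N (z - w) < e.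
Proof.
move=> hz Sz e0; have [vr vi] := X_volume hz.
have [par1 par2 par3 par4] := S_parity Sz.
have [[z1 z2] [q1 q2]] := X_preX hz.
have K0 : 0 < norm_const p := norm_const_gt0 adm.
have mf : 0 <= fine (leb E) by rewrite fine_ge0.
pose B := 1 + fine (leb E) / (2 * l) ^+ 2.
have q0 : 0 <= fine (leb E) / (2 * l) ^+ 2.
  by rewrite divr_ge0// exprn_ge0// mulr_ge0// ltW.
have B0 : 0 < B by exact: ltr_wpDr q0 ltr01.
pose e' := e ^+ 2 / (2 * (norm_const p * B)).
have KB : 0 < 2 * (norm_const p * B) := mulr_gt0 (ltr0Sn _ 1) (mulr_gt0 K0 B0).
have e'0 : 0 < e' := divr_gt0 (exprn_gt0 2 e0) KB.
have EE' := EdomE LL.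
have D f q et : L2 E f -> L2 E q ->
  (fun x => f (- x)) = (fun x => 1 * f x) %[ae leb in E] ->
  (fun x => q (- x)) = (fun x => -1 * q x) %[ae leb in E] ->
  exists v, [/\ sig v, n2 E (fun x => f x - zf (Prim v) tau x) < e',
    n2 E (fun x => q x - qf (Prim v) tau x) < e' & etaf (Prim v) tau = et].
  rewrite EE' => Lf Lq ev od.
  exact: (dense_signal l0 lL_ c0 tauT et Lf Lq ev od e'0).
have [v1 [h1 a1 a2 a3]] := D _ _ (Re (eta z)) z1 q1 par1 par3.
have [v2 [h2 b1 b2 b3]] := D _ _ (Im (eta z)) z2 q2 par2 par4.
exists (wave_state (Prim v1) (Prim v2) tau).
  exact: (Ran_input adm tau0 ug (cforce_cL2 adm LL tau0 h1 h2) (input_sig adm LL tau0 ug gen h1 h2)).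
have d1 := wave_delta_close h1 z1 vr; have d2 := wave_delta_close h2 z2 vi.
have [cP1 cP2] := (Prim_cts h1, Prim_cts h2).
have [y1 y2] := wave_cts_L2 l0 lL_ c0 tau cP1; have [y3 y4] := wave_cts_L2 l0 lL_ c0 tau cP2.
rewrite -EE' in y1 y2 y3 y4.
rewrite (S_rstate Sz) rstateB.
have up (a : R) : a <= e' -> a <= B * e'.
  by move=> ae; apply: le_trans ae _; rewrite ler_peMl ?(ltW e'0)// lerDl.
have dd (a b : R) : a <= fine (leb E) / (2 * l) ^+ 2 * b -> b < e' -> a <= B * e'.
  move=> ab be; apply: le_trans ab _; apply: le_trans (ler_wpM2l q0 (ltW be)) _.
  by rewrite ler_wpM2r ?(ltW e'0)// lerDr.
have s0 (a b : R) : a = b -> (b - a) ^+ 2 <= B * e'.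
  by move=> ->; rewrite subrr expr0n mulr_ge0 ?ltW.
have := rstate_norm_le adm (L2B mE z1 y1) (L2B mE z2 y3) (L2B mE q1 y2) (L2B mE q2 y4)
  (up _ (ltW a1)) (up _ (ltW b1)) (up _ (ltW a2)) (up _ (ltW b2))
  (dd _ _ d1 a1) (dd _ _ d2 b1) (s0 _ _ a3) (s0 _ _ b3).
move=> nb.
rewrite -(@ltr_pXn2r _ 2)// ?nnegrE ?normX_ge0 ?(ltW e0)//.
apply: le_lt_trans nb _.
have -> : norm_const p * (B * e') = e ^+ 2 / 2 by rewrite /e'; field; rewrite !gt_eqF.
by rewrite ltr_pdivrMr// ltr_pMr ?exprn_gt0// ltr1n.
Qed.

End Main.

Theorem theorem1p2 (R : realType) (p : params R)
  (T : R -> state R -> state R) (tau : R) :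
  admissible p ->
  unitary_group p T -> generated_by_A p T ->
  Lright p = Lleft p ->
  2 * (Lleft p - halfl p) / Num.sqrt (grav p * h0 p) < tau ->
  dense_continuous_inclusion (spaceW p `&` spaceS p) (normW p)
                             (Ran p T tau) (normRan p T tau)
  /\
  dense_continuous_inclusion (Ran p T tau) (normRan p T tau)
                             (spaceX p `&` spaceS p) (normX p).
Proof.
move=> adm ug gen LL; rewrite -LL => tauT.
have t0 : 0 < tau := lt_trans (round_trip_gt0 (halfl_lt_L adm) (celerity_gt0 adm)) tauT.
split; split.
- by move=> z [Wz Sz]; exact: (W_Ran adm LL ug gen tauT Wz Sz).
- by move=> z Rz e e0; exact: (W_dense adm LL ug gen tauT Rz e0).
- exact: (W_normRan adm LL ug gen tauT).
- move=> z Rz; split; first exact: (Ran_X adm t0 ug Rz).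
  exact: (Ran_S adm LL ug gen tauT Rz).
- by move=> z [Xz Sz] e e0; exact: (Ran_dense adm LL ug gen tauT Xz Sz e0).
- exists (Num.sqrt (input_const p tau)) => z Rz; exact: (normX_Ran adm t0 ug Rz).
Qed.
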